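(* Let $\varepsilon>0$, let $A>0$ be a constant, and let $K'(x)=-\frac{A}{2}H(x)+V(x)$ for $x\in\mathbb{R}$, where $H$ is the sign function and $V\in W^{1,1}(\mathbb{R})$ satisfies $\|V_x\|_1<A$. Let $u_0\in L^1(\mathbb{R})$ be nonnegative with $$\int_{\mathbb{R}}u_0(x)\,dx=1\quad\text{and}\quad \int_{\mathbb{R}}u_0(x)|x|\,dx<\infty .$$ Let $u=u(x,t)$ be the nonnegative solution of $$u_t=\varepsilon u_{xx}+\left(u\,(K'*u)\right)_x\quad (x\in\mathbb{R},\ t>0),\qquad u(x,0)=u_0(x)\quad (x\in\mathbb{R}),$$ and let $U(x,t)=\int_{-\infty}^x u(y,t)\,dy-\frac12$. Let $W^R$ be the rarefaction wave $$W^R(x,t)=\begin{cases}-\frac12 & \text{for } x\le-\frac{At}{2},\\ \frac{x}{At} & \text{for } -\frac{At}{2}<x<\frac{At}{2},\\ \frac12 & \text{for } x\ge\frac{At}{2}.\end{cases}$$ Then there exists a constant $C>0$, independent of $\varepsilon$, such that for every $t>0$ and each $p\in(1,\infty]$, $$\|U(\cdot,t)-W^R(\cdot,t)\|_p\le C\,t^{-\frac12\left(1-\frac1p\right)}\left(\log(2+t)\right)^{\frac12\left(1+\frac1p\right)}.$$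
   Context: $\|\cdot\|_p$ is the norm of $L^p(\mathbb{R})$ in the space variable $x$ (with $\frac1p=0$ for $p=\infty$); $*$ is convolution in $x$, $(f*g)(x)=\int_{\mathbb{R}}f(x-y)g(y)\,dy$. The sign function is $H(x)=-1$ for $x<0$ and $H(x)=1$ for $x>0$. The symbol $K'$ denotes a given function (the interaction kernel). ''Solution'' means the unique global-in-time solution, known to exist for such data and kernels, in the class $u\in C([0,\infty),L^1(\mathbb{R}))\cap C((0,\infty),W^{1,1}(\mathbb{R}))\cap C^1((0,\infty),L^1(\mathbb{R}))$; for nonnegative $u_0$ it is known to be nonnegative and to conserve the integral $\int_{\mathbb{R}}u(x,t)\,dx=\int_{\mathbb{R}}u_0(x)\,dx$. The function $W^R$ is the unique entropy solution of the Riemann problem $W_t+AWW_x=0$, $W(x,0)=\frac12H(x)$.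
   Formalization: The constant C is uniform for ε in any bounded range (0, ε₀], with ε₀>0 arbitrary, and may depend on ε₀; a single C for all ε>0 is impossible, since for V=0 and t=1 the L^p distance (p<∞) grows like ε^{1/(2p)} as ε→∞. *)

(* Defs.v *)
(* An element of L^1(R) is represented by a function [R -> R], and a
   time-dependent one by [u : R -> R -> R], where [u t] is the profile at
   time [t]. *)
From HB Require Import structures.
From mathcomp Require Import all_boot all_order all_algebra.
From mathcomp Require Import all_classical all_reals all_analysis.
Set Implicit Arguments.
Unset Strict Implicit.
Unset Printing Implicit Defensive.
Import Order.TTheory GRing.Theory Num.Theory.
Import numFieldTopology.Exports numFieldNormedType.Exports.

Local Open Scope classical_set_scope.
Local Open Scope ring_scope.

Notation leb := lebesgue_measure.

Section FunctionSpaces.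
Context {R : realType}.
Implicit Types (f g phi : R -> R) (D : set R) (w : R -> R -> R).

Definition in_L1 f : Prop :=
  (@leb R).-integrable [set: R] (EFin \o f).

Definition Lpnorm (p : \bar R) f : \bar R := 'N[@leb R]_p[EFin \o f]%E.

Definition test_function phi : Prop :=
  (forall n x, derivable (derive1n n phi) x 1) /\
  (exists M, forall x, M < `|x| -> phi x = 0).

Definition weak_derivative f g : Prop :=
  [/\ locally_integrable [set: R] f, locally_integrable [set: R] g &
    forall phi, test_function phi ->
      \int[@leb R]_(x in [set: R]) (f x * derive1 phi x) =
      - \int[@leb R]_(x in [set: R]) (g x * phi x)].

(* f belongs to W^{1,1}(R) and fx is its derivative. *)
Definition in_W11 f fx : Prop :=
  [/\ in_L1 f, in_L1 fx & weak_derivative f fx].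

(* w belongs to C(D, L^1(R)). *)
Definition cont_L1 D w : Prop :=
  forall t, D t -> in_L1 (w t) /\
    Lpnorm 1 (w s \- w t) @[s --> within D (nbhs t)] --> 0%E.

(* w belongs to C(D, W^{1,1}(R)) with spatial derivative wx. *)
Definition cont_W11 D w wx : Prop :=
  [/\ forall t, D t -> in_W11 (w t) (wx t), cont_L1 D w & cont_L1 D wx].

(* w belongs to C^1(D, L^1(R)) with time derivative wt, for D open. *)
Definition cont1_L1 D w wt : Prop :=
  [/\ cont_L1 D w, cont_L1 D wt & forall t, D t ->
    Lpnorm 1 (fun x => h^-1 * (w (t + h) x - w t x) - wt t x) @[h --> 0^']
      --> 0%E].

Definition convolution f g (x : R) : R :=
  \int[@leb R]_(y in [set: R]) (f (x - y) * g y).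

End FunctionSpaces.

Section Model.
Context {R : realType}.

(* [Num.sg] is the sign function; its value 0 at the origin is immaterial,
   the kernel being used only inside a convolution. *)
Definition interaction_kernel (A : R) (V : R -> R) (x : R) : R :=
  - (A / 2) * Num.sg x + V x.

(* u_t = eps u_xx + (u (K * u))_x holds in the sense of distributions in x, at
   each time t > 0: u_t is the weak derivative of eps u_x + u (K * u). *)
Definition solution (eps : R) (K u0 : R -> R) (u : R -> R -> R) : Prop :=
  exists ux ut : R -> R -> R,
    [/\ cont_L1 `[0, +oo[ u,
        cont_W11 `]0, +oo[ u ux,
        cont1_L1 `]0, +oo[ u ut,
        forall t, 0 < t ->
          weak_derivative
            (fun x => eps * ux t x + u t x * convolution K (u t) x) (ut t) &
        {ae @leb R, forall x, u 0 x = u0 x}].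

Definition centered_primitive (u : R -> R -> R) (t x : R) : R :=
  (\int[@leb R]_(y in `]-oo, x]) u t y) - 2^-1.

Definition rarefaction (A t x : R) : R :=
  if x <= - (A * t / 2) then - 2^-1
  else if x < A * t / 2 then x / (A * t)
  else 2^-1.

End Model.

(* Main.v *)
Require Import Defs.
From mathcomp Require Import all_boot all_order all_algebra.
From mathcomp Require Import all_classical all_reals all_analysis.
From mathcomp Require Import measurable_realfun ess_sup_inf.
From mathcomp Require Import ring lra.
Import Order.TTheory GRing.Theory Num.Theory.
Import numFieldTopology.Exports numFieldNormedType.Exports.

Local Open Scope classical_set_scope.
Local Open Scope ring_scope.
Set Implicit Arguments.
Unset Strict Implicit.
Unset Printing Implicit Defensive.

(** The distribution function [U] solves a scalar equation. Convolution with the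
    sign function is twice the primitive minus the mass ([convolution_sg]), and the
    mass stays equal to 1 ([mass_conservation]), so one integration in space gives
      U_t = eps U_xx + U_x (- A U + v),    v = V * u = V * U_x,
    a viscous Burgers equation with a nonlocal drift [v]. An integrable function with
    an integrable weak derivative is the primitive of that derivative
    ([weak_derivative_prim]). Applied to [V], to [u] and to the flux, this makes [U] a
    classical solution, twice differentiable in space and differentiable in time
    uniformly in space ([solution_viscous_flow]). Beyond that point only the
    properties collected in [viscous_flow] and [drift_bounds] are used.

    Growth of the L1 distance ([kato_bound]). The rarefaction wave at time [1 + t] is
    the linear profile x / (A (1 + t)) truncated at the levels -1/2 and 1/2. The
    untruncated profile is smooth and solves the equation without drift, with or
    without viscosity. Comparing [U] with it on a large interval [[- N, N]] by Kato's
    method leaves boundary terms at N and - N, and these are exactly balanced by the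
    growth of the part that truncation removes. What remains is the integral in time
    of sup |v|, and a viscous boundary term that integrates to 2 eps ln (1 + t) / A.
    At the initial time the distance is controlled by the first moment of the data
    ([heaviside_distance]).

    Decay of the slope ([lipschitz_spread], [lipschitz_decay]). At a positive maximum
    of U (x + h) - U x - h / k, where k is an increasing affine function of t, the two
    slopes agree, so the nonlinearity pushes the maximum down at a rate proportional
    to A, while the drift can push it up at a rate proportional to the L1 norm of V_x
    only. The assumption that this norm is less than A yields U_x <= 2 / (a t) with a
    the difference of the two. The compactness needed to have a maximum comes from
    tails that are uniform in time ([uniform_tails]), a consequence of a first
    application of the L1 comparison with a crude bound on [v].

    Conclusion ([flow_bound]). Since |v| is at most the L1 norm of V times the
    supremum of U_x, it decays like 1 / (1 + t), and the L1 comparison gives a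
    distance O(ln (2 + t)) ([L1_growth]). The difference [U - W^R] cannot decrease
    faster than 1 / (A t), so a large value at one point forces large values on an
    interval next to it. Its supremum is therefore at most twice the square root of
    the L1 distance over A t ([sup_of_slope_and_L1]), and the norms with 1 < p follow
    by interpolation. The constant depends on [eps] only through the upper bound
    [eps0], which absorbs the viscous boundary term. *)

(** * Calculus on the real line *)

Section RealCalculus.
Context {R : realType}.
Implicit Types (f g F : R -> R) (a b d e x y t s : R).
Local Notation mu := (@lebesgue_measure R).

Lemma deriv_cst d x : is_derive x 1 (fun=> d) 0.
Proof. exact: is_derive_cst. Qed.

Lemma deriv_id x : is_derive x 1 (fun y : R => y) 1.
Proof. exact: is_derive_id. Qed.

Lemma derivD f g x a b : is_derive x 1 f a -> is_derive x 1 g b ->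
  is_derive x 1 (fun y => f y + g y) (a + b).
Proof. by move=> df dg; exact: (@is_deriveD _ _ _ f g x 1 a b df dg). Qed.

Lemma derivN f x a : is_derive x 1 f a -> is_derive x 1 (fun y => - f y) (- a).
Proof. by move=> df; exact: (@is_deriveN _ _ _ f x 1 a df). Qed.

Lemma derivB f g x a b : is_derive x 1 f a -> is_derive x 1 g b ->
  is_derive x 1 (fun y => f y - g y) (a - b).
Proof. by move=> df dg; apply: derivD => //; exact: derivN. Qed.

Lemma derivM f g x a b : is_derive x 1 f a -> is_derive x 1 g b ->
  is_derive x 1 (fun y => f y * g y) (a * g x + f x * b).
Proof.
move=> df dg; have := @is_deriveM _ _ f g x 1 a b df dg.
by rewrite addrC /GRing.scale /= (mulrC (g x)).
Qed.

Lemma derivZ c f x a : is_derive x 1 f a -> is_derive x 1 (fun y => c * f y) (c * a).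
Proof.
by move=> df; have := derivM (deriv_cst c x) df; rewrite mul0r add0r.
Qed.

Lemma derivV f x a : f x != 0 -> is_derive x 1 f a ->
  is_derive x 1 (fun y => (f y)^-1) (- a / f x ^+ 2).
Proof.
move=> f0 df; have := is_deriveV f0 df.
by rewrite /GRing.scale /= !mulNr (mulrC _ a).
Qed.

Lemma deriv_div f g x a b : g x != 0 ->
  is_derive x 1 f a -> is_derive x 1 g b ->
  is_derive x 1 (fun y => f y / g y) ((a * g x - f x * b) / g x ^+ 2).
Proof.
move=> g0 df dg; have := derivM df (derivV g0 dg).
by congr is_derive; field.
Qed.

Lemma deriv_comp f g x a b : is_derive (g x) 1 f a -> is_derive x 1 g b ->
  is_derive x 1 (fun y => f (g y)) (a * b).
Proof. exact: is_derive1_comp. Qed.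

Lemma deriv_continuous f x a : is_derive x 1 f a -> {for x, continuous f}.
Proof.
by move=> [df _]; apply: differentiable_continuous; exact/derivable1_diffP.
Qed.

Lemma cont_cst d : continuous (fun _ : R => d).
Proof. by move=> ?; exact: cst_continuous. Qed.

Lemma contD f g : continuous f -> continuous g -> continuous (fun x => f x + g x).
Proof. by move=> cf cg x; apply: continuousD; [exact: cf|exact: cg]. Qed.

Lemma contN f : continuous f -> continuous (fun x => - f x).
Proof. by move=> cf x; apply: continuousN; exact: cf. Qed.

Lemma contM f g : continuous f -> continuous g -> continuous (fun x => f x * g x).
Proof. by move=> cf cg x; apply: continuousM; [exact: cf|exact: cg]. Qed.

Lemma contV f : (forall x, f x != 0) -> continuous f ->
  continuous (fun x => (f x)^-1).
Proof. by move=> f0 cf x; apply: continuousV; [exact: f0|exact: cf]. Qed.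

Lemma cont_norm f : continuous f -> continuous (fun x => `|f x|).
Proof.
move=> cf x; apply: (@continuous_comp _ _ _ f (fun z : R => `|z|)); first exact: cf.
exact: norm_continuous.
Qed.

Lemma derivE f x a : is_derive x 1 f a -> derive1 f x = a.
Proof. by move=> df; rewrite derive1E derive_val. Qed.

Lemma deriv_ge0_le f g a b : a <= b ->
  (forall x, a < x < b -> is_derive x 1 f (g x)) ->
  (forall x, a < x < b -> 0 <= g x) ->
  {within `[a, b], continuous f} -> f a <= f b.
Proof.
move=> ab df g0 cf; apply: (@ger0_derive1_ndecr _ f a b) => // x.
- by rewrite in_itv /= => /df[].
- by rewrite in_itv /= => xab; rewrite (derivE (df _ xab)) g0.
Qed.

Lemma continuous_integrable_itv f a b : continuous f ->
  mu.-integrable `[a, b] (EFin \o f).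
Proof.
move=> cf; apply: continuous_compact_integrable; first exact: segment_compact.
exact: continuous_subspaceT.
Qed.

Lemma Rintegral_deriv F f a b : a < b ->
  (forall x, is_derive x 1 F (f x)) -> continuous f ->
  \int[mu]_(x in `[a, b]) f x = F b - F a.
Proof.
move=> ab dF cf.
rewrite /Rintegral (@continuous_FTC2 _ f F)//.
- exact: continuous_subspaceT.
- have cF x : F y @[y --> x] --> F x by exact: (deriv_continuous (dF x)).
  split.
  + by move=> x _; case: (dF x).
  + exact: cvg_at_right_filter.
  + exact: cvg_at_left_filter.
- by move=> x _; exact: derivE.
Qed.

(** The maximum of [F] over [[a, b]] is attained at no [t > a], hence at [a]. This
    form of monotonicity suits functions for which only increments to the left are
    estimated. *)
Lemma le_of_earlier_larger F a b : a <= b -> {within `[a, b], continuous F} ->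
  (forall t, a < t <= b -> exists2 s, a <= s < t & F t < F s) -> F b <= F a.
Proof.
move=> ab cF early; have [c cab Fc] := EVT_max ab cF.
have bab : b \in `[a, b] by rewrite in_itv /= ab lexx.
have := cab; rewrite in_itv /= => /andP[].
rewrite le_eqVlt => /predU1P[->|ac cb]; first by move=> _; exact: Fc.
have [|s /andP[as_ sc]] := early c; first by rewrite ac.
rewrite ltNge Fc// in_itv /= as_ /=; exact: le_trans (ltW sc) cb.
Qed.

Lemma deriv_left_increment f t a e : 0 < e -> is_derive t 1 f a ->
  exists2 d, 0 < d & forall h, 0 < h < d -> `|f t - f (t - h) - h * a| <= e * h.
Proof.
move=> e0 [df fa].
have : (fun h => h^-1 *: (f (h *: 1 + t) - f t)) @ 0^' --> a by rewrite -fa; exact: df.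
move=> /cvgrPdist_le /(_ e e0).
rewrite near_withinE => /nbhs_ballP[d /= d0 H].
exists d => // h /andP[h0 hd].
have := H (- h); rewrite /ball /= sub0r opprK gtr0_norm// => /(_ hd).
have -> : - h != 0 by rewrite oppr_eq0 gt_eqF.
move=> /(_ isT); rewrite [(- h) *: 1]mulr1 (addrC (- h)) => Hh.
have -> : f t - f (t - h) - h * a = - h * (a - (- h)^-1 *: (f (t - h) - f t)).
  rewrite /GRing.scale /= invrN.
  by field; rewrite gt_eqF.
by rewrite normrM normrN (gtr0_norm h0) mulrC ler_wpM2r// ltW.
Qed.

Lemma half_lt e : 0 < e -> e / 2 < e.
Proof. by move=> e0; rewrite ltr_pdivrMr// ltr_pMr// ltr1n. Qed.

End RealCalculus.

(** * Kato's inequality at a fixed time *)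

Section SmoothedAbs.
Context {R : realType}.
Implicit Types d s a b : R.

(** A regularised absolute value, whose derivative [s / smooth_abs d s] stands for
    the sign of [s]. *)
Definition smooth_abs d s := Num.sqrt (s ^+ 2 + d ^+ 2).

Lemma smooth_abs_sqr d s : smooth_abs d s ^+ 2 = s ^+ 2 + d ^+ 2.
Proof. by rewrite sqr_sqrtr// addr_ge0 ?sqr_ge0. Qed.

Lemma smooth_abs_gt0 d s : 0 < d -> 0 < smooth_abs d s.
Proof. by move=> d0; rewrite sqrtr_gt0 ltr_wpDl ?sqr_ge0// exprn_gt0. Qed.

Lemma smooth_abs_ge_norm d s : `|s| <= smooth_abs d s.
Proof. by rewrite -sqrtr_sqr ler_wsqrtr// lerDl sqr_ge0. Qed.

Lemma smooth_abs_ge d s : 0 < d -> d <= smooth_abs d s.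
Proof.
move=> d0; rewrite -[leLHS](gtr0_norm d0) -sqrtr_sqr ler_wsqrtr//.
by rewrite lerDr sqr_ge0.
Qed.

Lemma smooth_abs_le d s : 0 < d -> smooth_abs d s <= `|s| + d.
Proof.
move=> d0; rewrite -(@ler_pXn2r _ 2)// ?nnegrE ?sqrtr_ge0 ?addr_ge0 ?(ltW d0)//.
rewrite smooth_abs_sqr sqrrD real_normK ?num_real//.
by rewrite lerD2r lerDl mulrn_wge0// mulr_ge0// ltW.
Qed.

Lemma smooth_abs_deriv d s : 0 < d ->
  is_derive s 1 (smooth_abs d) (s / smooth_abs d s).
Proof.
move=> d0; have q0 : 0 < s ^+ 2 + d ^+ 2.
  by rewrite ltr_wpDl ?sqr_ge0// exprn_gt0.
have dq : is_derive s 1 (fun y => y ^+ 2 + d ^+ 2) (2 * s).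
  have := derivD (derivM (deriv_id s) (deriv_id s)) (deriv_cst (d ^+ 2) s).
  by congr is_derive; rewrite mul1r mulr1 addr0 mulr_natl mulr2n.
have := @deriv_comp R Num.sqrt (fun y => y ^+ 2 + d ^+ 2) s _ _ (is_derive1_sqrt q0) dq.
have := smooth_abs_gt0 s d0; rewrite /smooth_abs => j0.
by congr is_derive; rewrite /=; field; rewrite gt_eqF.
Qed.

Lemma smooth_abs_slope_le1 d s : 0 < d -> `|s / smooth_abs d s| <= 1.
Proof.
move=> d0; have j0 := smooth_abs_gt0 s d0.
by rewrite normrM normfV (gtr0_norm j0) ler_pdivrMr// mul1r smooth_abs_ge_norm.
Qed.

Lemma smooth_abs_convex d a b : 0 < d ->
  smooth_abs d a - smooth_abs d b <= a / smooth_abs d a * (a - b).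
Proof.
move=> d0; have ja := smooth_abs_gt0 a d0; have jb := smooth_abs_gt0 b d0.
rewrite mulrAC ler_pdivlMr//.
suff : a * b + d ^+ 2 <= smooth_abs d a * smooth_abs d b.
  have := smooth_abs_sqr d a; nra.
rewrite /smooth_abs -sqrtrM ?addr_ge0 ?sqr_ge0//.
apply: le_trans (ler_norm _) _; rewrite -sqrtr_sqr ler_wsqrtr//.
have : 0 <= d ^+ 2 * (a - b) ^+ 2 by rewrite mulr_ge0 ?sqr_ge0.
nra.
Qed.

End SmoothedAbs.

Section SpatialKato.
Context {R : realType}.
Local Notation mu := (@lebesgue_measure R).

(** The bracket is U_t - l_t for the linear profile l = x / k with k = A (1 + t), so
    the left side is the rate of growth of the regularised L1 norm of U - l. Convection
    is the derivative of A (U + l) (U - l) / 2, and at the end points |U| <= 1/2 <= |l|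
    fixes the sign of U - l. There A |U - l| (U + l) / 2 is controlled by
    A (1/4 - l ^ 2) / 2 and [U] drops out. *)
Lemma kato_slice (A eps d c k N : R) (U Du w v : R -> R) :
  0 < A -> 0 < eps -> 0 < d -> 0 < k -> k / 2 <= N ->
  (forall x : R, is_derive x 1 U (Du x)) -> (forall x : R, is_derive x 1 Du (w x)) ->
  continuous w -> continuous v ->
  (forall x, `|U x| <= 2^-1) -> (forall x, 0 <= Du x) ->
  (forall x, `|v x| <= c) ->
  \int[mu]_(x in `[- N, N]) ((U x - x / k) / smooth_abs d (U x - x / k) *
     (eps * w x + Du x * (- A * U x + v x) + A * x / k ^+ 2)) <=
  2 * eps / k + (A / 4 - A * N ^+ 2 / k ^+ 2)
    + d * (A / 2 * (1 + 2 * N / k)) + c.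
Proof.
move=> A0 eps0 d0 k0 kN dU dDu cw cv U1 Du0 vc.
pose f x := U x - x / k.
pose J (x : R) : R := smooth_abs d (f x).
have J0 x : 0 < J x by exact: smooth_abs_gt0.
have N0 : 0 < N by lra.
pose f' x := Du x - k^-1.
have dl (x : R) : is_derive x 1 (fun y : R => y / k) k^-1.
  by have := derivM (deriv_id x) (deriv_cst k^-1 x); rewrite mul1r mulr0 addr0.
have df (x : R) : is_derive x 1 f (f' x) by apply: derivB.
have df' (x : R) : is_derive x 1 f' (w x).
  by have := derivB (dDu x) (deriv_cst k^-1 x); rewrite subr0.
have dJ (x : R) : is_derive x 1 J (f x / J x * f' x).
  exact: deriv_comp (smooth_abs_deriv (f x) d0) (df x).
(* [b] is the convective flux divided by U - l, and [p] a total derivative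
   dominating the integrand. *)
pose b x := A / 2 * (U x + x / k).
pose b' x := A / 2 * (Du x + k^-1).
have db (x : R) : is_derive x 1 b (b' x) by exact: (derivZ (A / 2) (derivD (dU x) (dl x))).
have Jneq0 x : J x != 0 by rewrite gt_eqF.
pose P x := eps * (f x / J x * f' x) - J x * b x + d * b x + c * U x.
pose p x := eps * ((f' x * J x - f x * (f x / J x * f' x)) / J x ^+ 2 * f' x
                   + f x / J x * w x)
  - (f x / J x * f' x * b x + J x * b' x) + d * b' x + c * Du x.
have dP (x : R) : is_derive x 1 P (p x).
  have d1 := derivZ eps (derivM (deriv_div (Jneq0 x) (df x) (dJ x)) (df' x)).
  have d2 := derivB d1 (derivM (dJ x) (db x)).
  exact: (derivD (derivD d2 (derivZ d (db x))) (derivZ c (dU x))).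
have cst_c (r : R) : continuous (fun _ : R => r) := @cont_cst R r.
have cU : continuous U by move=> x; exact: deriv_continuous (dU x).
have cDu : continuous Du by move=> x; exact: deriv_continuous (dDu x).
have cf : continuous f by move=> x; exact: deriv_continuous (df x).
have cf' : continuous f' by move=> x; exact: deriv_continuous (df' x).
have cJ : continuous J by move=> x; exact: deriv_continuous (dJ x).
have cb : continuous b by move=> x; exact: deriv_continuous (db x).
have cVJ : continuous (fun x => (J x)^-1).
  exact: contV.
have cfJ : continuous (fun x => f x / J x) by exact: contM.
have cid : continuous (fun x : R => x) by move=> x; exact: cvg_id.
have cb' : continuous b' by apply: contM => //; exact: contD.
have cp : continuous p.
  apply: contD; last exact: contM.
  apply: contD; last exact: contM.
  apply: contD; last by apply: contN; apply: contD; apply: contM => //; exact: contM.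
  apply: contM => //; apply: contD; last exact: contM.
  apply: contM => //; apply: contM; last first.
    rewrite (_ : (fun x => _) = fun x => (J x)^-1 * (J x)^-1); first exact: contM.
    by apply/funext => x; rewrite expr2 invfM.
  apply: contD; first exact: contM.
  by apply: contN; apply: contM => //; exact: contM.
have fJ1 x : `|f x / J x| <= 1 by exact: smooth_abs_slope_le1.
have key x : f x / J x * (eps * w x + Du x * (- A * U x + v x) + A * x / k ^+ 2)
    <= p x.
  rewrite -subr_ge0.
  (* The three defects are the convexity of the regularised absolute value, the error
   of regularisation in the convective term, and the drift. *)
have -> : p x - f x / J x *
      (eps * w x + Du x * (- A * U x + v x) + A * x / k ^+ 2)
      = eps * f' x ^+ 2 * (J x ^+ 2 - f x ^+ 2) / J x ^+ 3
        + b' x * (d - (J x ^+ 2 - f x ^+ 2) / J x)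
        + Du x * (c - f x / J x * v x).
    rewrite /p /b' /b; move: (Jneq0 x); move: (J x) => j j0.
    by rewrite /f /f'; field; rewrite j0 gt_eqF.
  have -> : J x ^+ 2 - f x ^+ 2 = d ^+ 2.
    by rewrite smooth_abs_sqr addrAC subrr add0r.
  have b'0 : 0 <= b' x.
    by rewrite mulr_ge0 ?divr_ge0 ?addr_ge0 ?invr_ge0 ?Du0 ?(ltW A0) ?(ltW k0).
  apply: addr_ge0; [apply: addr_ge0|].
  - apply: divr_ge0; last by apply/exprn_ge0/ltW.
    by apply: mulr_ge0; [apply: mulr_ge0; [exact: ltW|exact: sqr_ge0]|exact: sqr_ge0].
  - rewrite mulr_ge0// subr_ge0 ler_pdivrMr// expr2 ler_wpM2l ?(ltW d0)//.
    exact: smooth_abs_ge.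
  - rewrite mulr_ge0// subr_ge0; apply: le_trans (ler_norm _) _.
    rewrite normrM -[leRHS]mul1r; apply: ler_pM => //; exact: vc.
have NN : - N < N by lra.
apply: (@le_trans _ _ (P N - P (- N))).
  rewrite -(Rintegral_deriv NN dP cp); apply: le_Rintegral => //.
  - apply: continuous_integrable_itv; apply: contM => //; apply: contD.
      apply: contD; first exact: contM.
      by apply: contM => //; apply: contD => //; exact: contM.
    by apply: contM => //; exact: contM.
  - exact: continuous_integrable_itv.
  - by move=> x _; exact: key.
have lN : 2^-1 <= N / k by rewrite ler_pdivlMr// mulrC.
have /ler_normlP[UN1 UN2] := U1 N.
have /ler_normlP[UmN1 UmN2] := U1 (- N).
have fN : f N <= 0 by rewrite /f; lra.
have fmN : 0 <= f (- N) by rewrite /f mulNr; lra.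
have ki0 : 0 <= k^-1 by rewrite invr_ge0 ltW.
have eN : f N / J N * f' N <= k^-1.
  have /ler_normlP[h1 h2] := fJ1 N.
  have h3 : f N / J N <= 0 by rewrite pmulr_lle0// invr_gt0.
  have := Du0 N; rewrite /f'; nra.
have emN : - (f (- N) / J (- N) * f' (- N)) <= k^-1.
  have /ler_normlP[h1 h2] := fJ1 (- N).
  have h3 : 0 <= f (- N) / J (- N) by rewrite pmulr_lge0// invr_gt0.
  have := Du0 (- N); rewrite /f'; nra.
have jN : N / k - U N <= J N.
  by apply: le_trans (smooth_abs_ge_norm _ _); rewrite -opprB -/(f N) ler_normr lexx orbT.
have jmN : U (- N) + N / k <= J (- N).
  apply: le_trans (smooth_abs_ge_norm _ _).
  by apply: le_trans (ler_norm _); rewrite /f mulNr opprK.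
have bN : - (J N * b N) <= A / 2 * (4^-1 - (N / k) ^+ 2).
  rewrite /b mulrCA -mulrN ler_pM2l ?divr_gt0//.
  have : (N / k - U N) * (U N + N / k) <= J N * (U N + N / k).
    by rewrite ler_wpM2r//; lra.
  nra.
have bmN : J (- N) * b (- N) <= A / 2 * (4^-1 - (N / k) ^+ 2).
  rewrite /b mulrCA ler_pM2l ?divr_gt0// mulNr.
  have : (U (- N) + N / k) * (N / k - U (- N)) <= J (- N) * (N / k - U (- N)).
    by rewrite ler_wpM2r//; lra.
  nra.
have e1 := ler_wpM2l (ltW eps0) (lerD eN emN).
have c0 : 0 <= c by apply: le_trans (vc 0).
have cU1 : c * (U N - U (- N)) <= c by rewrite ler_piMr//; lra.
have dU1 : d * (b N - b (- N)) <= d * (A / 2 * (1 + 2 * N / k)).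
  rewrite ler_wpM2l ?(ltW d0)// /b -mulrBr ler_wpM2l ?divr_ge0 ?(ltW A0)//.
  by rewrite mulNr -mulrA; lra.
have -> : A * N ^+ 2 / k ^+ 2 = A * (N / k) ^+ 2 by rewrite expr_div_n; ring.
rewrite /P -[2 * eps / k]mulrA; lra.
Qed.

End SpatialKato.

(** * Kato's inequality in time *)

Section KatoInTime.
Context {R : realType}.
Local Notation mu := (@lebesgue_measure R).
Implicit Types t x e s r h : R.

Lemma Rintegral_sym_cst (N a : R) : 0 < N ->
  \int[mu]_(x in `[- N, N]) (fun=> a) x = 2 * N * a.
Proof.
move=> N0; rewrite Rintegral_cst//= lebesgue_measure_itv /= lte_fin.
have -> : - N < N by lra.
by rewrite /= opprK mulrC; congr (_ * _); lra.
Qed.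

(** What the proof uses of the distribution function [U] of a solution: [Du] and [w]
    are its first two space derivatives and [v] is the drift. Continuity and
    differentiability in time are required uniformly in space, which convergence in L1
    of the density provides and which replaces joint regularity in both variables. *)
Record viscous_flow (A eps : R) (U Du w v : R -> R -> R) : Prop := ViscousFlow {
  vf_bound : forall t x, 0 <= t -> `|U t x| <= 2^-1 ;
  vf_cont_x : forall t, 0 <= t -> continuous (U t) ;
  vf_cont_t : forall t, 0 <= t -> forall e, 0 < e -> exists2 d, 0 < d &
    forall s, 0 <= s -> `|s - t| < d -> forall x, `|U s x - U t x| <= e ;
  vf_dx : forall t (x : R), 0 < t -> is_derive x 1 (U t) (Du t x) ;
  vf_dxx : forall t (x : R), 0 < t -> is_derive x 1 (Du t) (w t x) ;
  vf_w_cont : forall t, 0 < t -> continuous (w t) ;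
  vf_v_cont : forall t, 0 < t -> continuous (v t) ;
  vf_incr : forall t x, 0 < t -> 0 <= Du t x ;
  vf_lip : forall t, 0 < t -> exists K, forall x, Du t x <= K ;
  vf_dt : forall t, 0 < t -> forall e, 0 < e -> exists2 d, 0 < d &
    forall h, `|h| < d -> forall x,
      `|U (t + h) x - U t x
        - h * (eps * w t x + Du t x * (- A * U t x + v t x))| <= e * `|h| }.

Lemma within_continuous_near (F : R -> R) (a b : R) :
  (forall t, a <= t <= b -> forall e, 0 < e -> exists2 d, 0 < d &
    forall s, a <= s <= b -> `|s - t| < d -> `|F s - F t| <= e) ->
  {within `[a, b], continuous F}.
Proof.
move=> H; apply/subspace_continuousP => t tab.
have {}tab : a <= t <= b by move: tab; rewrite /= in_itv.
apply/cvgrPdist_le => e e0; have [d d0 Hd] := H t tab e e0.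
rewrite near_withinE; apply/nbhs_ballP; exists d => // s /= ts.
rewrite in_itv /= => sab; rewrite distrC; apply: Hd => //.
by rewrite distrC.
Qed.

Variables (A eps : R) (U Du w v : R -> R -> R).
Hypotheses (A0 : 0 < A) (eps0 : 0 < eps).
Hypothesis sol : viscous_flow A eps U Du w v.
Variables (d N : R).
Hypotheses (d0 : 0 < d) (N0 : 0 < N).

Let k t := A * (1 + t).
Let f t x := U t x - x / k t.
Let E t := \int[mu]_(x in `[- N, N]) smooth_abs d (f t x).

Let k_gt0 t : 0 <= t -> 0 < k t.
Proof. by move=> t0; rewrite mulr_gt0// ltr_pwDl. Qed.

Let f_cont t : 0 <= t -> continuous (f t).
Proof.
move=> t0; apply: contD; first exact: vf_cont_x sol t t0.
by apply: contN; apply: contM; [move=> x; exact: cvg_id|exact: cont_cst].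
Qed.

Let smooth_abs_cont : continuous (smooth_abs d).
Proof. by move=> s; exact: deriv_continuous (smooth_abs_deriv s d0). Qed.

Let Jf_cont t : 0 <= t -> continuous (fun x => smooth_abs d (f t x)).
Proof.
move=> t0 x; apply: (@continuous_comp _ _ _ (f t) (smooth_abs d)).
  exact: f_cont.
exact: smooth_abs_cont.
Qed.

Let Jf_int t : 0 <= t ->
  mu.-integrable `[- N, N] (EFin \o (fun x => smooth_abs d (f t x))).
Proof. by move=> t0; apply: continuous_integrable_itv; exact: Jf_cont. Qed.

Let dkV t : 0 <= t -> is_derive t 1 (fun s => (k s)^-1) (- A / k t ^+ 2).
Proof.
move=> t0; have dk : is_derive t 1 k A.
  have := derivZ A (derivD (deriv_cst 1 t) (deriv_id t)).
  by rewrite add0r mulr1.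
by apply: derivV => //; rewrite gt_eqF// k_gt0.
Qed.

Let f_cont_t t : 0 <= t -> forall e, 0 < e -> exists2 r, 0 < r &
  forall s, 0 <= s -> `|s - t| < r ->
  forall x, `|x| <= N -> `|f s x - f t x| <= e.
Proof.
move=> t0 e e0.
have e20 : 0 < e / 2 by rewrite divr_gt0.
have eN0 : 0 < e / 2 / N by rewrite divr_gt0.
have [r1 r10 H1] := vf_cont_t sol t0 e20.
have /cvgrPdist_le /(_ _ eN0) := deriv_continuous (dkV t0).
move=> /nbhs_ballP[r2 /= r20 H2].
exists (Num.min r1 r2); first by rewrite lt_min r10.
move=> s s0; rewrite lt_min => /andP[s1 s2] x xN.
have -> : f s x - f t x = (U s x - U t x) + x * ((k t)^-1 - (k s)^-1).
  by rewrite /f; ring.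
apply: le_trans (ler_normD _ _) _.
rewrite [leRHS](splitr e) lerD//; first exact: H1.
have := H2 s; rewrite /ball /= distrC => /(_ s2) => H.
rewrite normrM; have -> : e / 2 = N * (e / 2 / N) by field; rewrite gt_eqF.
exact: ler_pM.
Qed.

Lemma kato_energy_cont T : 0 <= T -> {within `[0, T], continuous E}.
Proof.
move=> T0; apply: within_continuous_near => t /andP[t0 tT] e e0.
have e'0 : 0 < e / (2 * N) by rewrite divr_gt0// mulr_gt0.
have [r r0 Hr] := f_cont_t t0 e'0; exists r => // s /andP[s0 sT] st.
have half u u' : 0 <= u -> 0 <= u' ->
    (forall x, `|x| <= N -> `|f u x - f u' x| <= e / (2 * N)) -> E u - E u' <= e.
  move=> u0 u'0 H; rewrite /E -RintegralB//; [|exact: Jf_int|exact: Jf_int].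
  have -> : e = \int[mu]_(x in `[- N, N]) (fun=> e / (2 * N)) x.
    by rewrite Rintegral_sym_cst//; field; rewrite gt_eqF.
  apply: le_Rintegral => //.
  - apply: continuous_integrable_itv; apply: contD; first exact: Jf_cont.
    by apply: contN; exact: Jf_cont.
  - apply: continuous_integrable_itv; exact: cont_cst.
  - move=> x; rewrite /= in_itv /= -ler_norml => xN.
    apply: le_trans (smooth_abs_convex _ _ d0) _.
    apply: le_trans (ler_norm _) _; rewrite normrM.
    rewrite -[leRHS]mul1r; apply: ler_pM => //; last exact: H.
    exact: smooth_abs_slope_le1.
rewrite ler_norml; apply/andP; split; last by apply: half => // x xN; exact: Hr.
by rewrite lerNl opprB; apply: half => // x xN; rewrite distrC; exact: Hr.
Qed.

(** Left increments of the energy: convexity bounds J (f t) - J (f (t - h)) by the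
    slope at time [t] times the increment, and the uniform time derivative replaces
    the increment by [h * psi]. This reduces the question to the fixed time
    inequality. *)
Lemma kato_energy_step t c e : 0 < t -> k t / 2 <= N ->
  (forall x, `|v t x| <= c) -> 0 < e ->
  exists2 r, 0 < r & forall h, 0 < h < r ->
    E t - E (t - h) <= h * (2 * eps / k t + (A / 4 - A * N ^+ 2 / k t ^+ 2)
      + d * (A / 2 * (1 + 2 * N / k t)) + c + e).
Proof.
move=> t0 kN vc e0.
have e20 : 0 < e / 2 / (2 * N) by rewrite !divr_gt0// mulr_gt0.
have eN0 : 0 < e / 2 / (2 * N) / N by rewrite divr_gt0.
have [r1 r10 H1] := vf_dt sol t0 e20.
have [r2 r20 H2] := deriv_left_increment eN0 (dkV (ltW t0)).
exists (Num.min (Num.min r1 r2) t); first by rewrite !lt_min r10 r20.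
move=> h; rewrite !lt_min => /andP[h0 /andP[/andP[h1 h2] ht]].
have th0 : 0 <= t - h by rewrite subr_ge0 ltW.
have := ltW t0 => t00.
pose psi x := eps * w t x + Du t x * (- A * U t x + v t x) + A * x / k t ^+ 2.
pose g x := f t x / smooth_abs d (f t x) * psi x.
have g_cont : continuous g.
  have cU := vf_cont_x sol t00; have cid : continuous (fun x : R => x).
    by move=> x; exact: cvg_id.
  have cDu : continuous (Du t) by move=> x; exact: deriv_continuous (vf_dxx sol x t0).
  apply: contM.
    apply: contM; first exact: f_cont.
    apply: contV => [x|]; last exact: Jf_cont.
    by rewrite gt_eqF// smooth_abs_gt0.
  apply: contD; last by apply: contM; [apply: contM => //|]; exact: cont_cst.
  apply: contD; first by apply: contM; [exact: cont_cst|exact: vf_w_cont sol t t0].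
  apply: contM => //; apply: contD; last exact: vf_v_cont sol t t0.
  by apply: contM => //; exact: cont_cst.
have slice := kato_slice A0 eps0 d0 (k_gt0 t00) kN (fun x => vf_dx sol x t0)
  (fun x => vf_dxx sol x t0) (vf_w_cont sol t0) (vf_v_cont sol t0)
  (fun x => vf_bound sol x t00) (fun x => vf_incr sol x t0) vc.
have incr x : `|x| <= N -> `|f t x - f (t - h) x - h * psi x| <= h * (e / (2 * N)).
  move=> xN; have := H1 (- h); rewrite normrN gtr0_norm// => /(_ h1 x) U1.
  have k1 := H2 h; rewrite h0 h2 in k1; move: (k1 isT) => {}k1.
  have -> : f t x - f (t - h) x - h * psi x =
     - (U (t - h) x - U t x - (- h) * (eps * w t x + Du t x * (- A * U t x + v t x)))
     - x * ((k t)^-1 - (k (t - h))^-1 - h * (- A / k t ^+ 2)).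
    by rewrite /f /psi; ring.
  apply: le_trans (ler_normB _ _) _; rewrite normrN normrM.
  have -> : h * (e / (2 * N)) =
     e / 2 / (2 * N) * h + N * (e / 2 / (2 * N) / N * h).
    by field; rewrite gt_eqF.
  by rewrite lerD// ler_pM.
rewrite /E -RintegralB//; [|exact: Jf_int|exact: Jf_int].
apply: (@le_trans _ _ (\int[mu]_(x in `[- N, N]) (h * g x + h * (e / (2 * N))))).
  apply: le_Rintegral => //.
  - apply: continuous_integrable_itv; apply: contD; first exact: Jf_cont.
    by apply: contN; exact: Jf_cont.
  - apply: continuous_integrable_itv; apply: contD; last exact: cont_cst.
    by apply: contM => //; exact: cont_cst.
  - move=> x; rewrite /= in_itv /= -ler_norml => xN.
    apply: le_trans (smooth_abs_convex _ _ d0) _.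
    have -> : h * g x = f t x / smooth_abs d (f t x) * (h * psi x).
      by rewrite /g; ring.
    rewrite -lerBlDl -mulrBr.
    apply: le_trans (ler_norm _) _; rewrite normrM.
    rewrite -[leRHS]mul1r; apply: ler_pM => //; last exact: incr.
    exact: smooth_abs_slope_le1.
have int_g : mu.-integrable `[- N, N] (EFin \o g) by exact: continuous_integrable_itv.
rewrite RintegralD//.
- rewrite RintegralZl// (Rintegral_sym_cst (h * (e / (2 * N))) N0).
  have -> : 2 * N * (h * (e / (2 * N))) = h * e by field; rewrite gt_eqF.
  by rewrite -mulrDr ler_pM2l// lerD2r.
- apply: continuous_integrable_itv.
  by apply: contM => //; exact: cont_cst.
- by apply: continuous_integrable_itv; exact: cont_cst.
Qed.

End KatoInTime.

(** * The rarefaction wave and the L1 comparison *)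

Section Rarefaction.
Context {R : realType}.
Local Notation mu := (@lebesgue_measure R).
Implicit Types a s t x y N C : R.

Lemma deriv_of_quadratic_bound (F : R -> R) x a C :
  (forall h, `|F (x + h) - F x - h * a| <= C * h ^+ 2) -> is_derive x 1 F a.
Proof.
move=> H.
have L : (fun h : R => h^-1 *: (F (h *: 1 + x) - F x)) @ 0^' --> a.
  apply/cvgrPdist_le => e e0.
  have C0 : 0 < `|C| + 1 by rewrite ltr_wpDl.
  rewrite near_withinE; apply/nbhs_ballP; exists (e / (`|C| + 1)) => /=.
    by rewrite divr_gt0.
  move=> h; rewrite /ball /= sub0r normrN => hd hn0.
  have := H h; rewrite /GRing.scale /= mulr1 (addrC h).
  have -> : a - h^-1 * (F (x + h) - F x) = - (h^-1 * (F (x + h) - F x - h * a)).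
    by field.
  move=> Hh; rewrite normrN normrM normfV.
  rewrite ler_pdivrMl ?normr_gt0//.
  apply: le_trans Hh _.
  rewrite -(real_normK (num_real h)) expr2 mulrCA ler_wpM2l//.
  apply: le_trans (_ : (`|C| + 1) * `|h| <= _).
    by rewrite ler_wpM2r// (le_trans (ler_norm _))// lerDl.
  by rewrite mulrC -ler_pdivlMr// ltW.
split; first by apply/cvg_ex; exists a.
exact: cvg_lim L.
Qed.

Definition pos_part x := Num.max x 0.

Lemma pos_part_sqr_deriv x :
  is_derive x 1 (fun y => pos_part y ^+ 2 / 2) (pos_part x).
Proof.
apply: (@deriv_of_quadratic_bound _ _ _ 2^-1) => h.
rewrite /pos_part ler_norml.
by case: (leP x 0); case: (leP (x + h) 0) => *; apply/andP; split; nra.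
Qed.

Lemma pos_part_continuous : continuous pos_part.
Proof.
move=> x; apply/cvgrPdist_le => e e0; apply/nbhs_ballP; exists e => // y /=.
rewrite /ball /= => /ltW; apply: le_trans; rewrite /pos_part.
rewrite ler_norml.
have := ler_norm (x - y); have := ler_norm (y - x); rewrite distrC.
by case: (leP x 0); case: (leP y 0) => *; apply/andP; split; lra.
Qed.

Variable A : R.
Hypothesis A0 : 0 < A.
Local Notation W := (rarefaction A).

Variable s : R.
Hypothesis s0 : 0 < s.
Let k := A * s.
Let k0 : 0 < k. Proof. exact: mulr_gt0. Qed.

Lemma rarefaction_cases x : [\/ x <= - (k / 2) /\ W s x = - 2^-1,
  - (k / 2) < x < k / 2 /\ W s x = x / k | k / 2 <= x /\ W s x = 2^-1].
Proof.
rewrite /rarefaction -/k; case: (leP x (- (k / 2))) => x1; first by apply: Or31.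
by case: (ltP x (k / 2)) => x2; [apply: Or32|apply: Or33].
Qed.

(** The profile is [x / k] truncated to [[-1/2, 1/2]], so it lies between
    [x / k] and any value of that range. *)
Lemma rarefaction_between a x : `|a| <= 2^-1 ->
  `|a - x / k| = `|a - W s x| + `|W s x - x / k|.
Proof.
rewrite ler_norml => /andP[a1 a2].
have kx1 : x <= - (k / 2) -> x / k <= - 2^-1 by move=> ?; rewrite ler_pdivrMr//; lra.
have kx2 : k / 2 <= x -> 2^-1 <= x / k by move=> ?; rewrite ler_pdivlMr//; lra.
case: (rarefaction_cases x) => -[xk ->].
- have := kx1 xk => H; rewrite !ger0_norm; lra.
- by rewrite subrr normr0 addr0.
- have := kx2 xk => H; rewrite !ler0_norm; lra.
Qed.

Lemma rarefaction_excess x :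
  `|W s x - x / k| = (pos_part (x - k / 2) + pos_part (- x - k / 2)) / k.
Proof.
rewrite /pos_part; have k0' := k0.
have kx1 : x <= - (k / 2) -> x / k <= - 2^-1 by move=> ?; rewrite ler_pdivrMr//; lra.
have kx2 : k / 2 <= x -> 2^-1 <= x / k by move=> ?; rewrite ler_pdivlMr//; lra.
case: (rarefaction_cases x) => -[xk ->].
- have := kx1 xk => H; rewrite ger0_norm ?(@max_r _ _ (x - _)) ?max_l; try lra.
  by field; rewrite gt_eqF.
- move: xk => /andP[x1 x2].
  by rewrite subrr normr0 !max_r ?addr0 ?mul0r//; lra.
- have := kx2 xk => H; rewrite ler0_norm ?(@max_l _ _ (x - _)) ?max_r; try lra.
  by field; rewrite gt_eqF.
Qed.

Lemma rarefaction_continuous : continuous (W s).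
Proof.
have -> : W s = fun x => x / k - (pos_part (x - k / 2) - pos_part (- x - k / 2)) / k.
  apply/funext => x; rewrite /pos_part; have k0' := k0.
  case: (rarefaction_cases x) => -[xk ->].
  - rewrite (@max_r _ _ (x - _)) ?max_l; try lra.
    by field; rewrite gt_eqF.
  - move: xk => /andP[x1 x2].
    by rewrite !max_r ?subr0 ?mul0r ?subr0//; lra.
  - rewrite (@max_l _ _ (x - _)) ?max_r; try lra.
    by field; rewrite gt_eqF.
have cid : continuous (fun x : R => x) by move=> x; exact: cvg_id.
have comp (g : R -> R) : continuous g -> continuous (fun x => pos_part (g x)).
  move=> cg x; apply: (@continuous_comp _ _ _ g pos_part); first exact: cg.
  exact: pos_part_continuous.
apply: contD; first by apply: contM => //; exact: cont_cst.
apply: contN; apply: contM; last exact: cont_cst.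
apply: contD.
  by apply: comp; apply: contD => //; exact: cont_cst.
apply: contN; apply: comp; apply: contD; last exact: cont_cst.
exact: contN.
Qed.

Lemma rarefaction_excess_integral N : k / 2 <= N ->
  \int[mu]_(x in `[- N, N]) `|W s x - x / k| = N ^+ 2 / k - N + k / 4.
Proof.
move=> kN; have N0 : - N < N by have := k0; lra.
pose F x := (pos_part (x - k / 2) ^+ 2 / 2 - pos_part (- x - k / 2) ^+ 2 / 2) / k.
pose f x := (pos_part (x - k / 2) + pos_part (- x - k / 2)) / k.
have dF (x : R) : is_derive x 1 F (f x).
  have d1 := derivD (deriv_id x) (deriv_cst (- (k / 2)) x).
  have d2 := derivD (derivN (deriv_id x)) (deriv_cst (- (k / 2)) x).
  have d3 := deriv_comp (g := fun y => y - k / 2) (pos_part_sqr_deriv (x - k / 2)) d1.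
  have d4 := deriv_comp (g := fun y => - y - k / 2) (pos_part_sqr_deriv (- x - k / 2)) d2.
  have := derivM (derivB d3 d4) (deriv_cst k^-1 x).
  by congr is_derive; rewrite /f; ring.
have cid : continuous (fun x : R => x) by move=> x; exact: cvg_id.
have comp (g : R -> R) : continuous g -> continuous (fun x => pos_part (g x)).
  move=> cg x; apply: (@continuous_comp _ _ _ g pos_part); first exact: cg.
  exact: pos_part_continuous.
have cf : continuous f.
  apply: contM; last exact: cont_cst.
  by apply: contD; apply: (comp); apply: contD; try exact: cont_cst; try exact: contN.
under eq_Rintegral do rewrite rarefaction_excess.
rewrite (Rintegral_deriv N0 dF cf) /F /pos_part opprK.
have k0' := k0.
rewrite (@max_l _ _ (N - _)) ?(@max_r _ _ (- N - _)); try lra.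
by field; rewrite gt_eqF.
Qed.

End Rarefaction.

Section KatoBound.
Context {R : realType}.
Local Notation mu := (@lebesgue_measure R).
Implicit Types t x e s r h : R.

(** [D t] below is the integral of |W - l| over [[- N, N]], and |U - l| splits as
    |U - W| + |W - l|. Its derivative A / 4 - A N ^ 2 / k ^ 2 is exactly the convective
    boundary term of [kato_slice], so that only the drift and the viscous boundary
    term contribute to the growth of the distance from [U] to [W]. The unit time shift
    keeps the profile bounded at the initial time. *)
Lemma kato_bound (A eps : R) (U Du w v : R -> R -> R) (M c : R -> R) (T N : R) :
  0 < A -> 0 < eps -> viscous_flow A eps U Du w v ->
  0 < T -> A * (1 + T) / 2 <= N ->
  (forall t, 0 <= t -> is_derive t 1 M (c t)) ->
  (forall t x, 0 < t -> `|v t x| <= c t) ->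
  \int[mu]_(x in `[- N, N]) `|U T x - rarefaction A (1 + T) x| <=
  \int[mu]_(x in `[- N, N]) `|U 0 x - rarefaction A 1 x|
   + (M T - M 0) + 2 * eps / A * ln (1 + T).
Proof.
move=> A0 eps0 sol T0 TN dM vc.
have N0 : 0 < N by apply: lt_le_trans TN; rewrite divr_gt0// mulr_gt0// addr_gt0.
pose k t := A * (1 + t).
have k_gt0 t : 0 <= t -> 0 < k t by move=> t0; rewrite mulr_gt0// ltr_pwDl.
pose K := A / 2 * (1 + 2 * N / A).
apply/ler_addgt0Pr => e e0.
have K0 : 0 <= K.
  by rewrite mulr_ge0// ?divr_ge0 ?addr_ge0 ?divr_ge0 ?mulr_ge0 ?(ltW A0) ?(ltW N0).
have Z0 : 0 < 2 * N + (K + 1) * T by rewrite addr_gt0 ?mulr_gt0// ltr_wpDl.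
(* With this [d] the regularisation costs at most [e] over the time interval. *)
pose d := e / (2 * N + (K + 1) * T).
have d0 : 0 < d by rewrite divr_gt0.
pose E t := \int[mu]_(x in `[- N, N]) smooth_abs d (U t x - x / k t).
pose D t := N ^+ 2 / k t - N + k t / 4.
pose Q t := D t + M t + 2 * eps / A * ln (1 + t) + (d * (K + 1)) * t.
pose q t := A / 4 - A * N ^+ 2 / k t ^+ 2 + c t + 2 * eps / k t + d * (K + 1).
have dQ t : 0 <= t -> is_derive t 1 Q (q t).
  move=> t0; have t1 : 0 < 1 + t by rewrite ltr_pwDl.
  have d1 := derivD (deriv_cst 1 t) (deriv_id t).
  have dk := derivZ A d1.
  have kn0 : k t != 0 by rewrite gt_eqF// k_gt0.
  have dD1 := derivZ (N ^+ 2) (derivV kn0 dk).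
  have dD2 := derivD (derivD dD1 (deriv_cst (- N) t)) (derivM dk (deriv_cst 4^-1 t)).
  have dl := derivZ (2 * eps / A) (deriv_comp (g := fun t => 1 + t) (is_derive1_ln t1) d1).
  have := derivD (derivD (derivD dD2 (dM t t0)) dl) (derivZ (d * (K + 1)) (deriv_id t)).
  congr is_derive; rewrite /q /k.
  by field; rewrite !gt_eqF.
have cid : continuous (fun x : R => x) by move=> x; exact: cvg_id.
have cU t : 0 <= t -> continuous (U t) := @vf_cont_x _ _ _ _ _ _ _ sol t.
have cW s : 0 < s -> continuous (rarefaction A s).
  by move=> s0; exact: rarefaction_continuous.
have cl t : continuous (fun x => x / k t) by apply: contM => //; exact: cont_cst.
have cUl t : 0 <= t -> continuous (fun x => U t x - x / k t).
  by move=> t0; apply: contD; [exact: cU|apply: contN; exact: cl].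
have cUW t : 0 <= t -> continuous (fun x => `|U t x - rarefaction A (1 + t) x|).
  move=> t0; apply: cont_norm; apply: contD; first exact: cU.
  by apply: contN; apply: cW; rewrite ltr_pwDl.
have cWl t : 0 <= t -> continuous (fun x => `|rarefaction A (1 + t) x - x / k t|).
  move=> t0; apply: cont_norm; apply: contD; first by apply: cW; rewrite ltr_pwDl.
  by apply: contN; exact: cl.
have cJ t : 0 <= t -> continuous (fun x => smooth_abs d (U t x - x / k t)).
  move=> t0 x; apply: (@continuous_comp _ _ _ (fun x => U t x - x / k t) (smooth_abs d)).
    exact: cUl.
  exact: deriv_continuous (smooth_abs_deriv _ d0).
(* The truncated part of [x / k t] accounts exactly for [D t]. *)
have split_abs t : 0 <= t <= T ->
    \int[mu]_(x in `[- N, N]) `|U t x - x / k t| =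
    \int[mu]_(x in `[- N, N]) `|U t x - rarefaction A (1 + t) x| + D t.
  move=> /andP[t0 tT]; have t1 : 0 < 1 + t by rewrite ltr_pwDl.
  rewrite /D -(rarefaction_excess_integral A0 t1); last first.
    by apply: le_trans TN; rewrite ler_pM2r// ler_pM2l// lerD2l.
  rewrite -RintegralD//; last 2 first.
  - exact/continuous_integrable_itv/cUW.
  - exact/continuous_integrable_itv/cWl.
  apply: eq_Rintegral => x _; apply: rarefaction_between => //.
  exact: vf_bound sol t x t0.
have E_ge : \int[mu]_(x in `[- N, N]) `|U T x - x / k T| <= E T.
  apply: le_Rintegral => //; last by move=> x _; exact: smooth_abs_ge_norm.
  - by apply: continuous_integrable_itv; apply: cont_norm; apply: cUl; exact: ltW.
  - by apply: continuous_integrable_itv; apply: cJ; exact: ltW.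
have E_le : E 0 <= \int[mu]_(x in `[- N, N]) `|U 0 x - x / k 0| + 2 * N * d.
  have iU0 : mu.-integrable `[- N, N] (EFin \o (fun x => `|U 0 x - x / k 0|)).
    by apply: continuous_integrable_itv; apply: cont_norm; exact: cUl.
  have icst : mu.-integrable `[- N, N] (EFin \o (fun=> d)).
    by apply: continuous_integrable_itv; exact: cont_cst.
  rewrite -(Rintegral_sym_cst d N0) -RintegralD//.
  apply: le_Rintegral => //; last by move=> x _; exact: smooth_abs_le.
  - by apply: continuous_integrable_itv; exact: cJ.
  - apply: continuous_integrable_itv; apply: contD; last exact: cont_cst.
    by apply: cont_norm; exact: cUl.
have FTF0 : E T - Q T <= E 0 - Q 0.
  apply: (@le_of_earlier_larger _ (fun t => E t - Q t)); first exact: ltW.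
    apply: within_continuousB.
      exact: (kato_energy_cont A0 sol d0 N0 (ltW T0)).
    apply: derivable_within_continuous => t; rewrite in_itv /= => /andP[t0 _].
    by case: (dQ t t0).
  move=> t /andP[t0 tT]; have t00 := ltW t0; have kt := k_gt0 t t00.
  have d40 : 0 < d / 4 by rewrite divr_gt0.
  have ktN : k t / 2 <= N.
    by apply: le_trans TN; rewrite ler_pM2r// ler_pM2l// lerD2l.
  have [r1 r10 H1] := kato_energy_step A0 eps0 sol d0 N0 t0 ktN (fun x => vc t x t0) d40.
  have [r2 r20 H2] := deriv_left_increment d40 (dQ t t00).
  pose h := Num.min (Num.min r1 r2) t / 2.
  have m0 : 0 < Num.min (Num.min r1 r2) t by rewrite !lt_min r10 r20.
  have h0 : 0 < h by rewrite divr_gt0.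
  have : h < Num.min (Num.min r1 r2) t by exact: half_lt.
  rewrite !lt_min => /andP[/andP[h1 h2] ht].
  exists (t - h); first by rewrite subr_ge0 (ltW ht) ltrBlDr ltrDl h0.
  have := H1 h; rewrite h0 h1 => /(_ isT) E1.
  have := H2 h; rewrite h0 h2 => /(_ isT) /ler_normlP[_ Q1].
  have := H2 h; rewrite h0 h2 => /(_ isT) /ler_normlP[Q2 _].
  have kA : A <= k t by rewrite /k ler_pMr// lerDl.
  have Kd : d * (A / 2 * (1 + 2 * N / k t)) <= d * K.
    rewrite ler_wpM2l ?(ltW d0)// /K ler_wpM2l ?divr_ge0 ?(ltW A0)// lerD2l.
    by rewrite ler_wpM2l ?mulr_ge0 ?(ltW N0)// lef_pV2.
  have hd : 0 < h * d by exact: mulr_gt0.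
  have hK := ler_wpM2l (ltW h0) Kd.
  rewrite -/(k t) in E1; rewrite -/(E t) -/(E (t - h)) in E1.
  move: Q2; rewrite /q; lra.
have QT : Q T - Q 0 = D T - D 0 + (M T - M 0) + 2 * eps / A * ln (1 + T)
    + d * (K + 1) * T.
  by rewrite /Q addr0 ln1; ring.
have dZ : d * (2 * N + (K + 1) * T) = e by rewrite /d mulfVK// gt_eqF.
have sT := split_abs T; rewrite (ltW T0) lexx in sT; move: (sT isT) => {}sT.
have s0 := split_abs 0; rewrite lexx (ltW T0) in s0; move: (s0 isT) => {}s0.
rewrite addr0 in s0.
lra.
Qed.

End KatoBound.

(** * Decay of the slope by a maximum principle *)

Section MaximumPrinciple.
Context {R : realType}.
Implicit Types t x y e s r h c b : R.

(** The second-order condition when [g] is differentiable at [c] only: if [b] were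
    positive, [f] would exceed a parabola to the right of [c]. *)
Lemma second_order_max (f g : R -> R) c b r : 0 < r ->
  (forall x, is_derive x 1 f (g x)) -> is_derive c 1 g b ->
  (forall y, `|y - c| < r -> f y <= f c) -> g c = 0 /\ b <= 0.
Proof.
move=> r0 df dg fmax.
have gc : g c = 0.
  have cI : c \in `](c - r), (c + r)[ by rewrite in_itv /=; apply/andP; split; lra.
  have : is_derive c 1 f 0.
    apply: (@derive1_at_max _ f (c - r) (c + r) c _ _ cI); first lra.
    - by move=> x _; case: (df x).
    - by move=> x; rewrite in_itv /= => /andP[x1 x2]; apply: fmax; rewrite ltr_norml; apply/andP; split; lra.
  by move=> d0; rewrite -(derivE (df c)) (derivE d0).
split => //; rewrite leNgt; apply/negP => b0.
have b20 : 0 < b / 2 by rewrite divr_gt0.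
have [dg1 gE] := dg.
have : (fun h => h^-1 *: (g (h *: 1 + c) - g c)) @ 0^' --> b by rewrite -gE; exact: dg1.
move=> /cvgrPdist_le /(_ _ b20); rewrite near_withinE => /nbhs_ballP[d /= d0 H].
have gpos h : 0 < h < d -> h * (b / 2) <= g (c + h).
  move=> /andP[h0 hd]; have := H h; rewrite /ball /= sub0r normrN gtr0_norm//.
  rewrite (gt_eqF h0) => /(_ hd isT); rewrite gc subr0 /GRing.scale /= mulr1 (addrC h).
  move=> /ler_normlP[_]; rewrite lerBlDl -lerBlDr.
  have -> : b - b / 2 = b / 2 by lra.
  by rewrite ler_pdivlMl//.
pose m := Num.min d r / 2.
have m0 : 0 < Num.min d r by rewrite lt_min d0.
have m1 : 0 < m by rewrite divr_gt0.
have : m < Num.min d r by exact: half_lt.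
rewrite lt_min => /andP[md mr].
have fle : f (c + m) <= f c by apply: fmax; rewrite addrAC subrr add0r gtr0_norm.
pose p y := f y - b / 4 * ((y - c) * (y - c)).
have dp (x : R) : is_derive x 1 p (g x - b / 2 * (x - c)).
  have d1 := derivD (deriv_id x) (deriv_cst (- c) x).
  have := derivB (df x) (derivZ (b / 4) (derivM d1 d1)).
  by congr is_derive; lra.
have : p c <= p (c + m).
  apply: (deriv_ge0_le _ (fun x _ => dp x)).
  - by rewrite lerDl ltW.
  - move=> x /andP[x1 x2]; have := gpos (x - c); rewrite (addrC c) subrK.
    have -> : 0 < x - c < d by apply/andP; split; lra.
    by move=> /(_ isT); rewrite subr_ge0 mulrC.
  - apply: derivable_within_continuous => x _; by case: (dp x).
rewrite /p subrr mulr0 mulr0 subr0 (addrC c) addrK => H1.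
have : 0 < b / 4 * (m * m) by rewrite !mulr_gt0.
by move: fle; rewrite (addrC c); lra.
Qed.

Variables (A eps : R) (U Du w v : R -> R -> R).
Hypotheses (A0 : 0 < A) (eps0 : 0 < eps).
Hypothesis sol : viscous_flow A eps U Du w v.

Lemma vf_joint_cont (T : topologicalType) (p : T -> R) (q : T -> R) (z : T) :
  0 < q z -> {for z, continuous p} -> {for z, continuous q} ->
  {for z, continuous (fun z => U (q z) (p z))}.
Proof.
move=> qz cp cq; apply/cvgrPdist_le => e e0.
have e20 : 0 < e / 2 by rewrite divr_gt0.
have [d d0 Hd] := vf_cont_t sol (ltW qz) e20.
have cUq : {for p z, continuous (U (q z))} by exact: (vf_cont_x sol (ltW qz)).
have /cvgrPdist_le /(_ _ e20) /nbhs_ballP[r /= r0 Hr] := cUq.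
have dq : 0 < Num.min d (q z) by rewrite lt_min d0.
move/cvgrPdist_lt : cp => /(_ _ r0) cp.
move/cvgrPdist_lt : cq => /(_ _ dq) cq.
near=> y.
have py : `|p z - p y| < r by near: y.
have qy : `|q z - q y| < Num.min d (q z) by near: y.
have := qy; rewrite lt_min => /andP[qd qq].
have qy0 : 0 <= q y by have /ltr_normlP[_] := qq; lra.
have -> : U (q z) (p z) - U (q y) (p y) =
   (U (q z) (p z) - U (q z) (p y)) - (U (q y) (p y) - U (q z) (p y)) by ring.
apply: le_trans (ler_normB _ _) _; rewrite [leRHS](splitr e) lerD//.
  exact: Hr.
by apply: Hd => //; rewrite distrC.
Unshelve. all: by end_near. Qed.

(** If U (x + h) - U x - h / k t took a positive value, it would have a positive
    maximum [S] over [x], [h] and [t]. There the slopes at [x + h] and [x] both equal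
    L = 1 / k t and the viscous term is nonpositive, while convection and drift
    contribute at most - (A - lam) L (S + h L). Since k has slope A - lam, the term
    h / k t compensates - (A - lam) h L ^ 2 and the quantity decreases at the rate
    (A - lam) L S, so it was larger shortly before, a contradiction. The initial value
    1 / K of [k] encodes the Lipschitz bound at time [t0]. *)
Lemma lipschitz_spread (lam K t0 T : R) : 0 <= lam -> lam < A ->
  0 < t0 -> t0 < T -> 0 < K -> (forall x, Du t0 x <= K) ->
  (forall t h S, 0 < t -> 0 <= h -> (forall z, U t (z + h) - U t z <= S) ->
     forall x, `|v t (x + h) - v t x| <= lam * S) ->
  (forall e, 0 < e -> exists N, forall t x, 0 < t <= T -> N <= x ->
     2^-1 - e <= U t x /\ U t (- x) <= - 2^-1 + e) ->
  forall x h, 0 <= h ->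
    U T (x + h) - U T x <= h / ((A - lam) * (T - t0) + K^-1).
Proof.
move=> lam0 lamA t00 t0T K0 DuK Hv tails x0 h0 h0ge.
set a := A - lam; have a0 : 0 < a by rewrite subr_gt0.
pose k t := a * (t - t0) + K^-1.
have k_gt0 t : t0 <= t -> 0 < k t.
  move=> tt; apply: ltr_wpDl; last by rewrite invr_gt0.
  by apply: mulr_ge0; [exact: ltW|rewrite subr_ge0].
pose Phi (p : R * R * R) := U p.2 (p.1.1 + p.1.2) - U p.2 p.1.1 - p.1.2 / k p.2.
rewrite -/(k T) leNgt; apply/negP => Phi0.
set S0 := U T (x0 + h0) - U T x0 - h0 / k T.
have S00 : 0 < S0 by rewrite subr_gt0.
have e0 : 0 < S0 / 2 by rewrite divr_gt0.
have [N HN] := tails _ e0.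
have kmono t : t0 <= t <= T -> k t <= k T.
  by move=> /andP[_ tT]; rewrite lerD2r ler_pM2l// lerD2r.
have Ub t x : t0 <= t -> - 2^-1 <= U t x /\ U t x <= 2^-1.
  move=> tt; have := vf_bound sol x (le_trans (ltW t00) tt).
  by rewrite ler_norml => /andP.
(* Beyond the box [Phi] is too small to compete with [S0]. *)
have outside t x h : t0 <= t <= T -> 0 <= h -> S0 <= U t (x + h) - U t x - h / k t ->
    - (`|N| + k T) <= x <= `|N| /\ h <= k T.
  move=> tT h_ge; have /andP[tt0 tT'] := tT; have kt0 := k_gt0 _ tt0.
  have hk : 0 <= h / k t by rewrite divr_ge0// ltW.
  have [U1 U2] := Ub t (x + h) tt0; have [U3 U4] := Ub t x tt0.
  have tpos : 0 < t <= T by rewrite (lt_le_trans t00).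
  move=> HS.
  have hkT : h <= k T.
    rewrite leNgt; apply/negP => hk'.
    have : 1 < h / k t by rewrite ltr_pdivlMr// mul1r (le_lt_trans (kmono _ tT)).
    lra.
  split => //; apply/andP; split; rewrite leNgt; apply/negP => Hx.
  - have NX : N <= - (x + h) by have := ler_norm N; lra.
    have [_] := HN t _ tpos NX; rewrite opprK; lra.
  - have NX : N <= x by have := ler_norm N; lra.
    have [] := HN t _ tpos NX; lra.
pose B : set (R * R * R) :=
  (`[- (`|N| + k T), `|N|] `*` `[0, k T]) `*` `[t0, T].
have in_B x h t : t0 <= t <= T -> 0 <= h -> S0 <= U t (x + h) - U t x - h / k t ->
    B ((x, h), t).
  move=> tT hge HS; have [xN hk] := outside _ _ _ tT hge HS.
  by split; [split|]; rewrite /= in_itv /=; rewrite ?hge ?hk.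
have cB : compact B.
  by apply: compact_setX; [apply: compact_setX|]; exact: segment_compact.
have TT : t0 <= T <= T by rewrite lexx ltW.
have B0 : B !=set0 by exists ((x0, h0), T); exact: in_B.
have cPhi : {within B, continuous Phi}.
  apply: continuous_in_subspaceT => -[[x h] t]; rewrite inE => -[_ /=].
  rewrite in_itv /= => /andP[tt0 _].
  have tpos : 0 < t by exact: lt_le_trans tt0.
  have c1 : {for ((x, h), t), continuous (fun p : R * R * R => p.1.1)}.
    by apply: (@cvg_comp _ _ _ (fun p : R * R * R => p.1) fst); [exact: cvg_fst|exact: cvg_fst].
  have c2 : {for ((x, h), t), continuous (fun p : R * R * R => p.1.2)}.
    by apply: (@cvg_comp _ _ _ (fun p : R * R * R => p.1) snd); [exact: cvg_fst|exact: cvg_snd].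
  have c3 : {for ((x, h), t), continuous (fun p : R * R * R => p.2)} by exact: cvg_snd.
  have c12 : {for ((x, h), t), continuous (fun p : R * R * R => p.1.1 + p.1.2)}.
    exact: continuousD.
  have c4 := vf_joint_cont (q := fun p : R * R * R => p.2) (z := ((x, h), t)) tpos c12 c3.
  have c5 := vf_joint_cont (q := fun p : R * R * R => p.2) (z := ((x, h), t)) tpos c1 c3.
  have c7 : {for ((x, h), t), continuous (fun p : R * R * R => (k p.2)^-1)}.
    apply: (@continuous_comp _ _ _ (fun p : R * R * R => p.2) (fun s => (k s)^-1)) => //=.
    apply: continuousV; first by rewrite gt_eqF// k_gt0.
    have d1 := derivD (deriv_id t) (deriv_cst (- t0) t).
    exact: deriv_continuous (derivD (derivZ a d1) (deriv_cst K^-1 t)).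
  exact: (continuousB (continuousB c4 c5) (continuousM c2 c7)).
have [[[x h] t] /set_mem Bm Pmax] := compact_EVT_max B0 cB cPhi.
have [[_ /=]] := Bm; rewrite !in_itv /= => /andP[hge _] tT.
have /andP[tt0 tT'] := tT.
have tpos : 0 < t by exact: lt_le_trans tt0.
set S := Phi ((x, h), t).
have SS0 : S0 <= S by apply: (Pmax ((x0, h0), T)); rewrite inE; exact: in_B.
have Sglob y r : 0 <= r -> U t (y + r) - U t y - r / k t <= S.
  move=> rge; have [le|gt] := leP S0 (U t (y + r) - U t y - r / k t).
    by apply: (Pmax ((y, r), t)); rewrite inE; exact: in_B.
  by rewrite (le_trans (ltW gt)).
have S_gt0 : 0 < S by exact: lt_le_trans SS0.
have kt0 := k_gt0 t tt0; pose L := (k t)^-1.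
have L0 : 0 < L by rewrite invr_gt0.
have hpos : 0 < h.
  rewrite lt_neqAle hge andbT; apply/eqP => h00; move: S_gt0.
  by rewrite /S /Phi /= -h00 addr0 subrr mul0r subr0 ltxx.
have SE : S = U t (x + h) - U t x - h * L by [].
have dL (y : R) : is_derive y 1 (fun z : R => L * z) L.
  by have := derivZ L (deriv_id y); rewrite mulr1.
have [DX wX] : Du t (x + h) - L = 0 /\ w t (x + h) <= 0.
  have dX (y : R) := derivB (vf_dx sol y tpos) (dL y).
  have dDX := derivB (vf_dxx sol (x + h) tpos) (deriv_cst L (x + h)).
  rewrite -[w _ _]subr0; apply: second_order_max hpos dX dDX _ => y yh.
  have := Sglob x (y - x); rewrite (addrC x) subrK SE -/L.
  have := ltW yh; rewrite ler_distl addrK => /andP[xy _]; rewrite subr_ge0 xy.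
  by move=> /(_ isT); lra.
have [DY wY] : L - Du t x = 0 /\ - w t x <= 0.
  have dY (y : R) := derivB (dL y) (vf_dx sol y tpos).
  have dDY := derivB (deriv_cst L x) (vf_dxx sol x tpos).
  rewrite -[- w _ _]add0r; apply: second_order_max hpos dY dDY _ => y yh.
  have := Sglob y (x + h - y); rewrite (addrC y) subrK SE -/L.
  have := ltW yh; rewrite ler_distl => /andP[_ yxh]; rewrite subr_ge0 yxh.
  by move=> /(_ isT); lra.
(* At time [t0] the Lipschitz constant [K] = L makes the quantity nonpositive. *)
have t0t : t0 < t.
  rewrite lt_neqAle tt0 andbT; apply/eqP => tE; move: S_gt0.
  rewrite SE /L /k -tE subrr mulr0 add0r invrK ltNge => /negP; apply.
  pose f y := K * y - U t0 y.
  have df (y : R) : is_derive y 1 f (K - Du t0 y).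
    have d1 := derivZ K (deriv_id y).
    by have := derivB d1 (vf_dx sol y t00); rewrite mulr1.
  have : f x <= f (x + h).
    apply: (deriv_ge0_le _ (fun y _ => df y)).
    - by rewrite lerDl.
    - by move=> y _; rewrite subr_ge0.
    - by apply: derivable_within_continuous => y _; case: (df y).
  by rewrite /f; lra.
pose G y := eps * w t y + Du t y * (- A * U t y + v t y).
have spread z : U t (z + h) - U t z <= S + h * L by rewrite -lerBlDr; exact: Sglob.
have vxh : v t (x + h) - v t x <= lam * (S + h * L).
  by apply: le_trans (ler_norm _) _; apply: Hv.
have Gle : G (x + h) - G x + a * h * L ^+ 2 <= - (a * L * S).
  have -> : G (x + h) - G x = eps * (w t (x + h) - w t x)
      + L * (- A * (S + h * L) + (v t (x + h) - v t x)).
    have DXE : Du t (x + h) = L by apply/eqP; rewrite -subr_eq0 DX.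
    have DYE : Du t x = L by apply/eqP; rewrite eq_sym -subr_eq0 DY.
    by rewrite /G DXE DYE SE; ring.
  have e1 : eps * (w t (x + h) - w t x) <= 0
    by rewrite pmulr_rle0// subr_le0 (le_trans wX)// -oppr_le0.
  have := ler_wpM2l (ltW L0) (lerD (lexx (- A * (S + h * L))) vxh).
  by rewrite /a; lra.
have Z0 : 0 < a * L * S by rewrite !mulr_gt0.
(* Three error terms of size [e * s] must stay below the gain [a * L * S * s]. *)
pose e := a * L * S / 6.
have e_gt0 : 0 < e by rewrite divr_gt0.
have [r1 r10 H1] := vf_dt sol tpos e_gt0.
have dk : is_derive t 1 (fun s => h / k s) (- (a * h * L ^+ 2)).
  have d1 := derivD (deriv_id t) (deriv_cst (- t0) t).
  have d2 := derivD (derivZ a d1) (deriv_cst K^-1 t).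
  have kn0 : k t != 0 by rewrite gt_eqF.
  have := derivZ h (derivV (f := k) kn0 d2).
  by congr is_derive; rewrite /L; field.
have [r2 r20 H2] := deriv_left_increment e_gt0 dk.
pose s := Num.min (Num.min r1 r2) (t - t0) / 2.
have m0 : 0 < Num.min (Num.min r1 r2) (t - t0) by rewrite !lt_min r10 r20 subr_gt0.
have s0 : 0 < s by rewrite divr_gt0.
have : s < Num.min (Num.min r1 r2) (t - t0) by exact: half_lt.
rewrite !lt_min => /andP[/andP[s1 s2] st].
have sT : t0 <= t - s <= T.
  by rewrite lerBrDr -lerBrDl (ltW st) (le_trans _ tT')// lerBlDr lerDl ltW.
have := H1 (- s); rewrite normrN gtr0_norm// => /(_ s1) Hs.
have /ler_normlP[X _] := Hs (x + h); have /ler_normlP[_ Y] := Hs x.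
have := H2 s; rewrite s0 s2 => /(_ isT) /ler_normlP[K1 _].
have es : 0 < e * s by exact: mulr_gt0.
have Gs := ler_wpM2l (ltW s0) Gle.
have eS : s * - (a * L * S) = - (6 * (e * s)) by rewrite /e; field.
rewrite eS in Gs.
have : S < Phi ((x, h), t - s).
  rewrite SE /Phi /=.
  move: X Y K1 Gs es; rewrite -/(G (x + h)) -/(G x) -/L.
  by clear; move: (G (x + h)) (G x) => g1 g2; lra.
have [leS|gtS] := leP S0 (Phi ((x, h), t - s)).
  rewrite ltNge => /negP; apply; apply: (Pmax ((x, h), t - s)).
  by rewrite inE; exact: in_B.
by move=> /lt_trans /(_ gtS); rewrite ltNge SS0.
Qed.

End MaximumPrinciple.

(** * From one-sided slopes and L1 bounds to Lp bounds *)

Section SupAndInterpolation.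
Context {R : realType}.
Local Notation mu := (@lebesgue_measure R).
Implicit Types x y h N K S p : R.

Lemma Lpnorm_interpolation (f : R -> R) S K p : measurable_fun setT f ->
  0 <= S -> (forall x, `|f x| <= S) -> 0 <= K ->
  (\int[mu]_x (`|f x|)%:E <= K%:E)%E -> 1 < p ->
  (Lpnorm p%:E f <= (S `^ (1 - p^-1) * K `^ p^-1)%:E)%E.
Proof.
move=> mf S0 fS K0 fK p1.
have p0 : 0 < p by rewrite (lt_trans ltr01).
have pn0 : p != 0 by rewrite gt_eqF.
have mabs : measurable_fun setT (fun x => `|f x|).
  by apply: measurableT_comp => //; exact: normr_measurable.
rewrite /Lpnorm unlock /=.
have step : (\int[mu]_x `|(f x)%:E| `^ p <= (S `^ (p - 1) * K)%:E)%E.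
  apply: (@le_trans _ _ (\int[mu]_x ((S `^ (p - 1))%:E * (`|f x|)%:E))%E).
    apply: ge0_le_integral => //.
    - by move=> x _; exact: poweR_ge0.
    - apply: (measurableT_comp (measurable_poweR p)).
      exact/measurable_EFinP.
    - by apply/measurable_EFinP; apply: measurable_funM.
    - move=> x _; rewrite abse_EFin poweR_EFin -EFinM lee_fin.
      have -> : `|f x| `^ p = `|f x| `^ (p - 1) * `|f x|.
        rewrite -[X in _ = _ * X]powRr1// -powRD ?subrK// (gt_eqF p0).
        by [].
      rewrite ler_wpM2r// ge0_ler_powR ?nnegrE//; lra.
  rewrite ge0_integralZl//.
  - by rewrite EFinM lee_wpmul2l// lee_fin powR_ge0.
  - exact/measurable_EFinP.
  - by rewrite lee_fin powR_ge0.
apply: (@le_trans _ _ ((S `^ (p - 1) * K)%:E `^ p^-1)%E).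
  apply: gt0_ler_poweR => //; first by rewrite invr_ge0 ltW.
  - by rewrite in_itv /= leey andbT integral_ge0// => x _; exact: poweR_ge0.
  - by rewrite in_itv /= leey andbT lee_fin mulr_ge0// powR_ge0.
rewrite poweR_EFin lee_fin powRM ?powR_ge0// -powRrM.
by have -> : (p - 1) * p^-1 = 1 - p^-1 by field.
Qed.

Lemma Lpnorm_pinfty_le (f : R -> R) S :
  (forall x, `|f x| <= S) -> (Lpnorm +oo%E f <= S%:E)%E.
Proof.
move=> fS; have S0 : 0 <= S by exact: le_trans (fS 0).
rewrite /Lpnorm unlock /=; case: ifP => _; last by rewrite lee_fin.
by apply/ess_sup_inf.ess_supP; apply: nearW => x /=; rewrite lee_fin.
Qed.

(** A function whose slope is bounded below on one side cannot be large at a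
    point without being large on an interval next to it. *)
Lemma sup_of_slope_and_L1 (f : R -> R) (l K : R) : 0 < l -> continuous f ->
  (forall x y, x <= y -> - ((y - x) / l) <= f y - f x) ->
  (forall N0, exists2 N, N0 <= N & \int[mu]_(x in `[- N, N]) `|f x| <= K) ->
  forall x, `|f x| <= 2 * Num.sqrt (K / l).
Proof.
move=> l0 cf slope fK.
have piece a b m : 0 < m -> b - a = m * l / 2 ->
    (forall y, a <= y <= b -> m / 2 <= `|f y|) -> m <= 2 * Num.sqrt (K / l).
  move=> m0 ab fm.
  have ml : 0 < m * l / 2 by rewrite divr_gt0// mulr_gt0.
  have [N N0 HN] := fK (`|a| + `|b|).
  have cabs : continuous (fun x => `|f x|).
    exact: cont_norm.
  have iabs c d : mu.-integrable `[c, d] (EFin \o (fun x => `|f x|)).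
    exact: continuous_integrable_itv.
  have : \int[mu]_(x in `[a, b]) `|f x| <= K.
    apply: le_trans HN; rewrite /Rintegral fine_le//.
    - exact: integrable_fin_num (iabs _ _).
    - exact: integrable_fin_num (iabs _ _).
    apply: ge0_subset_integral => //.
    - by apply/measurable_EFinP; apply: measurable_funTS; exact: continuous_measurable_fun.
    - move=> z /=; rewrite !in_itv /= => /andP[z1 z2].
      have := ler_norm (- a); rewrite normrN; have := ler_norm b.
      have := normr_ge0 a; have := normr_ge0 b.
      by move=> *; apply/andP; split; lra.
  have : m / 2 * (m * l / 2) <= \int[mu]_(x in `[a, b]) `|f x|.
    have -> : m / 2 * (m * l / 2) = \int[mu]_(x in `[a, b]) (fun=> m / 2) x.
      rewrite Rintegral_cst//= lebesgue_measure_itv /= lte_fin.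
      have -> : a < b by lra.
      by rewrite /= ab.
    apply: le_Rintegral => //.
    by apply: continuous_integrable_itv; exact: cont_cst.
  move=> H1 H2; have mK : (m / 2) ^+ 2 <= K / l.
    rewrite ler_pdivlMr// (le_trans _ (le_trans H1 H2))// le_eqVlt.
    by apply/orP; left; apply/eqP; field.
  have : m / 2 <= Num.sqrt (K / l).
    rewrite -[leLHS]ger0_norm; last by rewrite divr_ge0// ltW.
    by rewrite -sqrtr_sqr ler_wsqrtr.
  lra.
move=> x; have [fx|fx|->] := ltgtP (f x) 0; last by rewrite normr0 mulr_ge0 ?sqrtr_ge0.
- rewrite ltr0_norm//; apply: (piece (x - - f x * l / 2) x); first by rewrite oppr_gt0.
    by lra.
  move=> y /andP[y1 y2]; have := slope y x y2.
  have : (x - y) / l <= - f x / 2.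
    by rewrite ler_pdivrMr//; lra.
  by move=> H1 H2; rewrite ler0_norm; lra.
- rewrite gtr0_norm//; apply: (piece x (x + f x * l / 2)) => //.
    by lra.
  move=> y /andP[y1 y2]; have := slope x y y1.
  have : (y - x) / l <= f x / 2.
    by rewrite ler_pdivrMr//; lra.
  by move=> H1 H2; rewrite ger0_norm; lra.
Qed.

(** Only arbitrarily large intervals are controlled, as in [sup_of_slope_and_L1],
    because the L1 comparison holds for intervals that contain the wave. *)
Lemma integral_line_le (f : R -> R) K : continuous f -> (forall x, 0 <= f x) ->
  (forall N0, exists2 N, N0 <= N & \int[mu]_(x in `[- N, N]) f x <= K) ->
  (\int[mu]_x (f x)%:E <= K%:E)%E.
Proof.
move=> cf f0 fK.
have mf : measurable_fun setT (EFin \o f).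
  by apply/measurable_EFinP; exact: continuous_measurable_fun.
have int_le (N : R) : (\int[mu]_(x in `[(- N)%R, N]) (f x)%:E <= K%:E)%E.
  have [M NM HM] := fK N.
  have iM : mu.-integrable `[- M, M] (EFin \o f) by exact: continuous_integrable_itv.
  apply: (@le_trans _ _ (\int[mu]_(x in `[(- M)%R, M]) (f x)%:E)%E).
    apply: ge0_subset_integral => //.
    - exact: measurable_funTS.
    - by move=> x _; rewrite lee_fin.
    - by apply: subset_itv; rewrite bnd_simp// lerN2.
  by rewrite -[leLHS]fineK ?lee_fin//; exact: integrable_fin_num iM.
pose I (n : nat) : set R := `[- (n%:R : R), n%:R]%classic.
have cover : \bigcup_n I n = [set: R].
  apply/seteqP; split => // x _; exists (Num.truncn `|x|).+1 => //=.
  by rewrite /I /= in_itv /= -ler_norml ltW// truncnS_gt.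
have mI (n : nat) : measurable (I n) by exact: measurable_itv.
have cvg : ((\int[mu]_(x in I i) (f x)%:E)%E @[i --> \oo] -->
    (\int[mu]_(x in \bigcup_i I i) (f x)%:E)%E).
  apply: ge0_nondecreasing_set_cvg_integral => //.
  - move=> n m nm; apply/subsetPset; apply: subset_itv; rewrite bnd_simp ?lerN2 ler_nat//.
  - by move=> n; exact: measurable_funTS.
  - by move=> n x _; rewrite lee_fin.
rewrite -cover; apply: (cvge_to_le cvg).
by apply: nearW => n; exact: int_le.
Qed.

End SupAndInterpolation.

(** * The estimate for classical solutions *)

Section FlowBound.
Context {R : realType}.
Local Notation mu := (@lebesgue_measure R).
Implicit Types t x y e s r h N K : R.

Lemma rarefaction_slope (A t : R) x y : 0 < A -> 0 < t -> x <= y ->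
  rarefaction A t y - rarefaction A t x <= (y - x) / (A * t).
Proof.
move=> A0 t0 xy; have k0 : 0 < A * t by exact: mulr_gt0.
rewrite ler_pdivlMr//.
have xk z : z / (A * t) * (A * t) = z by rewrite mulfVK// gt_eqF.
case: (rarefaction_cases A t x) => -[x1 ->]; case: (rarefaction_cases A t y) => -[y1 ->];
  rewrite ?mulrBl ?xk; move: x1 y1; rewrite ?andbA;
  by try (move=> /andP[x1 x2]); try (move=> x1); try (move=> /andP[y1 y2]); try (move=> y1); lra.
Qed.

(** The comparison takes place at time [1 + t]. Going back to time [t] costs a
    bounded amount in L1, since the support has length A (1 + t). *)
Lemma rarefaction_shift (A t : R) x : 0 < A -> 0 < t ->
  `|rarefaction A t x - rarefaction A (1 + t) x|
    <= (1 + t)^-1 * \1_(`[- (A * (1 + t) / 2), A * (1 + t) / 2]) x.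
Proof.
move=> A0 t0; have t1 : 0 < 1 + t by rewrite ltr_pwDl// ltW.
have k0 : 0 < A * t by exact: mulr_gt0.
have k1 : 0 < A * (1 + t) by exact: mulr_gt0.
have kk : A * t < A * (1 + t) by rewrite ltr_pM2l// ltrDr.
rewrite indicE; case: (boolP (_ \in _)) => [/set_mem|].
  rewrite /= in_itv /= => /andP[x1 x2]; rewrite mulr1.
  have xle : x / (A * (1 + t)) <= 2^-1 by rewrite ler_pdivrMr//; lra.
  have xge : - 2^-1 <= x / (A * (1 + t)) by rewrite ler_pdivlMr//; lra.
  have -> : rarefaction A (1 + t) x = x / (A * (1 + t)).
    case: (rarefaction_cases A (1 + t) x) => -[xx ->] //.
      have -> : x = - (A * (1 + t) / 2) by lra.
      by field; rewrite !gt_eqF.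
    have -> : x = A * (1 + t) / 2 by lra.
    by field; rewrite !gt_eqF.
  have E : x / (A * (1 + t)) * (1 + t) = x / A by field; rewrite !gt_eqF.
  rewrite -[leRHS]mul1r ler_pdivlMr// -[X in _ * X](gtr0_norm t1) -normrM mulrBl E.
  have xA : x / A <= (1 + t) / 2 by rewrite ler_pdivrMr//; lra.
  have xA' : - ((1 + t) / 2) <= x / A by rewrite ler_pdivlMr//; lra.
  rewrite ler_norml; case: (rarefaction_cases A t x) => -[xx ->].
  - have : x / A <= - (t / 2) by rewrite ler_pdivrMr//; lra.
    by move=> ?; apply/andP; split; lra.
  - have -> : x / (A * t) * (1 + t) - x / A = x / (A * t) by field; rewrite !gt_eqF.
    move: xx => /andP[y1 y2].
    by rewrite ler_pdivrMr// ler_pdivlMr//; apply/andP; split; lra.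
  - have : t / 2 <= x / A by rewrite ler_pdivlMr//; lra.
    by move=> ?; apply/andP; split; lra.
move=> xI; rewrite mulr0.
have /orP[xx|xx] : (x < - (A * (1 + t) / 2)) || (A * (1 + t) / 2 < x).
  rewrite !ltNge -negb_and; apply: contra xI => /andP[x1 x2].
  by rewrite inE /= in_itv /= x1 x2.
- have -> : rarefaction A t x = - 2^-1.
    by case: (rarefaction_cases A t x) => -[xz ->] //; [move: xz => /andP[]|]; lra.
  have -> : rarefaction A (1 + t) x = - 2^-1.
    by case: (rarefaction_cases A (1 + t) x) => -[xz ->] //; [move: xz => /andP[]|]; lra.
  by rewrite subrr normr0.
- have -> : rarefaction A t x = 2^-1.
    by case: (rarefaction_cases A t x) => -[xz ->] //; [|move: xz => /andP[]]; lra.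
  have -> : rarefaction A (1 + t) x = 2^-1.
    by case: (rarefaction_cases A (1 + t) x) => -[xz ->] //; [|move: xz => /andP[]]; lra.
  by rewrite subrr normr0.
Qed.

Lemma Rintegral_indic_sym N r : 0 < r -> r <= N ->
  \int[mu]_(x in `[- N, N]) (\1_(`[- r, r]) x : R) = 2 * r.
Proof.
move=> r0 rN.
rewrite /Rintegral integral_indic//=.
have -> : `[- r, r]%classic `&` `[- N, N]%classic = `[- r, r]%classic :> set R.
  apply/setIidPl => x; rewrite /= !in_itv /= => /andP[x1 x2].
  by apply/andP; split; lra.
rewrite lebesgue_measure_itv /= lte_fin.
have -> : - r < r by lra.
by rewrite /=; lra.
Qed.

Variables (A lam CV V1 I0 eps0 : R).
Hypotheses (A0 : 0 < A) (lam0 : 0 <= lam) (lamA : lam < A).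
Hypotheses (CV0 : 0 <= CV) (V10 : 0 <= V1) (I00 : 0 <= I0) (eps00 : 0 < eps0).

(** The drift is V * U_x. [CV] is a bound on |V|, [V1] the L1 norm of V and [lam] that
    of its derivative. The increment of the drift is bounded by that of [U], without
    reference to the slope of [U], which is what the maximum principle requires. *)
Record drift_bounds (U Du v : R -> R -> R) : Prop := DriftBounds {
  drift_bound : forall t x, 0 < t -> `|v t x| <= CV ;
  drift_decay : forall t K, 0 < t -> (forall x, Du t x <= K) ->
    forall x, `|v t x| <= V1 * K ;
  drift_osc : forall t h S, 0 < t -> 0 <= h ->
    (forall z, U t (z + h) - U t z <= S) ->
    forall x, `|v t (x + h) - v t x| <= lam * S }.

Let a := A - lam.
Let a0 : 0 < a. Proof. by rewrite subr_gt0. Qed.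

Section OneFlow.
Variables (eps : R) (U Du w v : R -> R -> R).
Hypotheses (e0 : 0 < eps) (e1 : eps <= eps0).
Hypothesis sol : viscous_flow A eps U Du w v.
Hypothesis drift : drift_bounds U Du v.
Hypothesis init : forall N,
  \int[mu]_(x in `[- N, N]) `|U 0 x - rarefaction A 1 x| <= I0.

Let U_mono t x y : 0 < t -> x <= y -> U t x <= U t y.
Proof.
move=> t0 xy; apply: (deriv_ge0_le xy (fun x _ => vf_dx sol x t0)).
  by move=> z _; exact: vf_incr sol t z t0.
by apply: continuous_subspaceT; exact: vf_cont_x sol t (ltW t0).
Qed.

Let diff_cont t s : 0 <= t -> 0 < s ->
  continuous (fun x => `|U t x - rarefaction A s x|).
Proof.
move=> t0 s0; apply: cont_norm; apply: contD; first exact: (vf_cont_x sol t0).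
by apply: contN; exact: rarefaction_continuous.
Qed.

(** The L1 estimate with the crude bound [CV] on the drift already shows that
    no mass escapes to infinity in finite time. *)
Lemma uniform_tails T e : 0 < T -> 0 < e -> exists N, forall t x,
  0 < t <= T -> N <= x -> 2^-1 - e <= U t x /\ U t (- x) <= - 2^-1 + e.
Proof.
move=> T0 e_gt0.
have T1 : 0 < 1 + T by rewrite addr_gt0.
pose B := I0 + CV * T + 2 * eps / A * ln (1 + T).
have B0 : 0 <= B.
  rewrite /B !addr_ge0 ?mulr_ge0 ?(ltW T0) ?invr_ge0 ?(ltW A0) ?(ltW e0)//.
  by rewrite ln_ge0// lerDl ltW.
pose r := A * (1 + T) / 2.
have r0 : 0 < r by rewrite divr_gt0// mulr_gt0.
pose N := r + (B + 1) / e.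
exists N => t x /andP[t0 tT] Nx.
have B1 : 0 < (B + 1) / e by rewrite divr_gt0// ltr_wpDl.
have rx : r < x by rewrite (lt_le_trans _ Nx)// ltrDl.
have rt : A * (1 + t) / 2 <= r by rewrite ler_pM2r// ler_pM2l// lerD2l.
have dM s : 0 <= s -> is_derive s 1 (fun s => CV * s) CV.
  by move=> _; have := derivZ CV (deriv_id s); rewrite mulr1.
have xr : A * (1 + t) / 2 <= x by rewrite (le_trans rt)// ltW.
have vc s y : 0 < s -> `|v s y| <= CV by exact: drift_bound drift s y.
have := kato_bound A0 e0 sol t0 xr dM vc.
have t1 : 0 < 1 + t by rewrite addr_gt0.
move=> /le_trans kb.
have Bt : \int[mu]_(y in `[- x, x]) `|U t y - rarefaction A (1 + t) y| <= B.
  apply: kb; rewrite /B mulr0 subr0 lerD//; first by rewrite lerD// ler_wpM2l.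
  rewrite ler_wpM2l ?mulr_ge0 ?invr_ge0 ?(ltW A0) ?(ltW e0)//.
  by rewrite ler_ln ?posrE// lerD2l.
have piece p q : - x <= p -> q <= x -> q - p = x - r ->
    ~ (forall y, p <= y <= q -> e <= `|U t y - rarefaction A (1 + t) y|).
  move=> xp qx pq H.
  have pq' : p < q by lra.
  have int_c : \int[mu]_(y in `[p, q]) (fun=> e) y = e * (x - r).
    rewrite Rintegral_cst//= lebesgue_measure_itv /= lte_fin pq' /=.
    by rewrite pq.
  have iabs c d : mu.-integrable `[c, d]
      (EFin \o (fun y => `|U t y - rarefaction A (1 + t) y|)).
    by apply: continuous_integrable_itv; apply: diff_cont => //; exact: ltW.
  have : e * (x - r) <= B.
    rewrite -int_c; apply: le_trans Bt.
    apply: (@le_trans _ _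
        (\int[mu]_(y in `[p, q]) `|U t y - rarefaction A (1 + t) y|)).
      apply: le_Rintegral => //.
      by apply: continuous_integrable_itv; exact: cont_cst.
    rewrite /Rintegral fine_le//.
    - exact: integrable_fin_num (iabs _ _).
    - exact: integrable_fin_num (iabs _ _).
    apply: ge0_subset_integral => //.
    - apply/measurable_EFinP; apply: measurable_funTS.
      by apply: continuous_measurable_fun; apply: diff_cont => //; exact: ltW.
    - by apply: subset_itv; rewrite bnd_simp.
  have : B + 1 <= e * (x - r).
    by rewrite mulrC -ler_pdivrMr//; rewrite /N in Nx; lra.
  lra.
have k0 : 0 < A * (1 + t) by exact: mulr_gt0.
have W_right y : r <= y -> rarefaction A (1 + t) y = 2^-1.
  move=> ry; have := le_trans rt ry => ky.
  by case: (rarefaction_cases A (1 + t) y) => -[yk ->] //; [|move: yk => /andP[]]; lra.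
have W_left y : y <= - r -> rarefaction A (1 + t) y = - 2^-1.
  move=> ry; have ky : y <= - (A * (1 + t) / 2) by lra.
  by case: (rarefaction_cases A (1 + t) y) => -[yk ->] //; [move: yk => /andP[]|]; lra.
split; rewrite leNgt; apply/negP => H.
- apply: (piece r x) => //; first lra.
  move=> y /andP[y1 y2]; rewrite W_right//.
  have Uy := U_mono t0 y2.
  by rewrite ler0_norm; lra.
- apply: (piece (- x) (- r)) => //; try lra.
  move=> y /andP[y1 y2]; rewrite W_left//.
  have Uy := U_mono t0 y1.
  by rewrite ger0_norm; lra.
Qed.

(** Started at time t / 2 from any Lipschitz bound, the spreading estimate retains
    no memory of that bound at time [t]. *)
Lemma lipschitz_decay t x : 0 < t -> Du t x <= 2 / (a * t).
Proof.
move=> t0; have t20 : 0 < t / 2 by rewrite divr_gt0.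
have t2t : t / 2 < t by lra.
have [K0 HK0] := vf_lip sol t20.
pose K := Num.max K0 1.
have K1 : 0 < K by rewrite lt_max ltr01 orbT.
have HK y : Du (t / 2) y <= K by rewrite (le_trans (HK0 y))// le_max lexx.
have spread := lipschitz_spread e0 sol lam0 lamA t20 t2t K1 HK
  (fun t h S pt ph H => drift_osc drift pt ph H) (fun e => @uniform_tails t e t0).
have at0 : 0 < a * t by exact: mulr_gt0.
have at2 : 0 < a * (t / 2) by exact: mulr_gt0.
have slope h : 0 <= h -> U t (x + h) - U t x <= h * (2 / (a * t)).
  move=> h0; apply: le_trans (spread x h h0) _; rewrite ler_wpM2l// -/a.
  have -> : 2 / (a * t) = (a * (t / 2))^-1 by field; rewrite !gt_eqF.
  rewrite lef_pV2 ?posrE//.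
    have -> : t - t / 2 = t / 2 by lra.
    by rewrite lerDl invr_ge0 ltW.
  have -> : t - t / 2 = t / 2 by lra.
  by rewrite ltr_wpDr// invr_ge0 ltW.
apply/ler_addgt0Pr => e e_gt0.
have [dU UE] := vf_dx sol x t0.
have : (fun h => h^-1 *: (U t (h *: 1 + x) - U t x)) @ 0^' --> Du t x.
  by rewrite -UE; exact: dU.
move=> /cvgrPdist_le /(_ e e_gt0); rewrite near_withinE => /nbhs_ballP[d /= d0 H].
have d2 : 0 < d / 2 by rewrite divr_gt0.
have := H (d / 2); rewrite /ball /= sub0r normrN gtr0_norm// (gt_eqF d2).
have -> : d / 2 < d by lra.
move=> /(_ isT isT); rewrite /GRing.scale /= mulr1 (addrC (d / 2)) => /ler_normlP[_].
have : (d / 2)^-1 * (U t (x + d / 2) - U t x) <= 2 / (a * t).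
  by rewrite ler_pdivrMl//; exact: slope (ltW d2).
lra.
Qed.

Let C2 := CV + V1 * (2 / a).

Lemma drift_time_decay t x : 0 < t -> `|v t x| <= C2 / (1 + t).
Proof.
move=> t0; have t1 : 0 < 1 + t by rewrite addr_gt0.
have := drift_bound drift x t0.
have := drift_decay drift t0 (fun y => lipschitz_decay y t0) x.
have -> : V1 * (2 / (a * t)) = V1 * (2 / a) / t by field; rewrite !gt_eqF.
rewrite ler_pdivlMr// => H1 H2; rewrite ler_pdivlMr// /C2; lra.
Qed.

(** The three terms bound, relative to ln (2 + t), the initial distance with the cost
    of the time shift, the drift, and the viscous boundary term. *)
Definition L1_constant := (I0 + A) / ln 2 + C2 + 2 * eps0 / A.

Lemma L1_growth t N : 0 < t -> A * (1 + t) / 2 <= N ->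
  \int[mu]_(x in `[- N, N]) `|U t x - rarefaction A t x| <= L1_constant * ln (2 + t).
Proof.
move=> t0 tN; have t1 : 0 < 1 + t by rewrite addr_gt0.
have r0 : 0 < A * (1 + t) / 2 by rewrite divr_gt0// mulr_gt0.
have dM s : 0 <= s -> is_derive s 1 (fun s => C2 * ln (1 + s)) (C2 / (1 + s)).
  move=> s0; have s1 : 0 < 1 + s by rewrite ltr_pwDl.
  have d1 := derivD (deriv_cst 1 s) (deriv_id s).
  have := derivZ C2 (deriv_comp (g := fun s => 1 + s) (is_derive1_ln s1) d1).
  by rewrite add0r mulr1.
have vc s y : 0 < s -> `|v s y| <= C2 / (1 + s) by exact: drift_time_decay.
have kb := kato_bound A0 e0 sol t0 tN dM vc.
have iU s : 0 < s -> mu.-integrable `[- N, N]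
    (EFin \o (fun x => `|U t x - rarefaction A s x|)).
  by move=> s0; apply: continuous_integrable_itv; apply: diff_cont => //; exact: ltW.
pose ind : R -> R := \1_(`[- (A * (1 + t) / 2), A * (1 + t) / 2]%classic).
have iI : mu.-integrable `[- N, N] (EFin \o ind).
  apply: (@integrableS _ _ _ mu setT) => //.
  by apply: integrable_indic_itv.
have iZ : mu.-integrable `[- N, N] (EFin \o (fun x => (1 + t)^-1 * ind x)).
  rewrite (_ : EFin \o _ = fun x => (((1 + t)^-1)%:E * (EFin \o ind) x)%E).
    exact: integrableZl.
  by apply/funext => x; rewrite /= EFinM.
have shift : \int[mu]_(x in `[- N, N]) `|U t x - rarefaction A t x| <=
   \int[mu]_(x in `[- N, N]) `|U t x - rarefaction A (1 + t) x| + A.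
  have AE : (1 + t)^-1 * \int[mu]_(x in `[- N, N]) ind x = A.
    by rewrite Rintegral_indic_sym//; field; rewrite gt_eqF.
  rewrite -[X in _ <= _ + X]AE -RintegralZl// -RintegralD//; last exact: iU.
  apply: le_Rintegral => //.
  - exact: iU.
  - pose F x := `|U t x - rarefaction A (1 + t) x|.
    pose Z x := (1 + t)^-1 * ind x.
    apply: (@eq_integrable _ _ _ mu _ _ ((EFin \o F) \+ (EFin \o Z))%E) => //.
    by apply: integrableD => //; exact: iU.
  - move=> x _; have := rarefaction_shift x A0 t0; rewrite distrC => H.
    apply: le_trans (ler_distD (rarefaction A (1 + t) x) _ _) _.
    by rewrite lerD2l.
apply: (le_trans shift); apply: (le_trans (lerD kb (lexx A))).
rewrite addr0 ln1 mulr0 subr0.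
have ln20 : 0 < ln (2 : R) by rewrite ln_gt0// ltr1n.
have C20 : 0 <= C2 by rewrite addr_ge0// mulr_ge0// divr_ge0// ltW.
have l1 : ln (1 + t) <= ln (2 + t) by rewrite ler_ln ?posrE ?addr_gt0// lerD2r ler1n.
have l10 : 0 <= ln (1 + t) by rewrite ln_ge0// lerDl ltW.
have l2 : ln 2 <= ln (2 + t) by rewrite ler_ln ?posrE ?addr_gt0// lerDl ltW.
have i1 : I0 + A <= (I0 + A) / ln 2 * ln (2 + t).
  by rewrite mulrAC ler_pdivlMr// ler_wpM2l// addr_ge0// ltW.
have i2 : C2 * ln (1 + t) <= C2 * ln (2 + t) by rewrite ler_wpM2l.
have i3 : 2 * eps / A * ln (1 + t) <= 2 * eps0 / A * ln (2 + t).
  apply: ler_pM => //; first by rewrite !mulr_ge0 ?invr_ge0 ?(ltW A0) ?(ltW e0).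
  by rewrite ler_pM2r ?invr_gt0// ler_pM2l.
have i4 := init N.
rewrite /L1_constant; lra.
Qed.

End OneFlow.

Lemma flow_bound : exists C : R, 0 < C /\
  forall eps U Du w v, 0 < eps <= eps0 ->
  viscous_flow A eps U Du w v -> drift_bounds U Du v ->
  (forall N, \int[mu]_(x in `[- N, N]) `|U 0 x - rarefaction A 1 x| <= I0) ->
  forall (t : R) (p : \bar R), 0 < t -> (1 < p)%E ->
    (Lpnorm p (U t \- rarefaction A t)%R
     <= (C * t `^ (- 2^-1 * (1 - fine p^-1))
           * ln (2 + t) `^ (2^-1 * (1 + fine p^-1)))%:E)%E.
Proof.
have ln20 : 0 < ln (2 : R) by rewrite ln_gt0// ltr1n.
have C20 : 0 <= CV + V1 * (2 / a) by rewrite addr_ge0// mulr_ge0// divr_ge0// ltW.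
have C10 : 0 < L1_constant.
  rewrite /L1_constant ltr_wpDr ?divr_ge0 ?mulr_ge0 ?(ltW eps00) ?(ltW A0)//.
  by rewrite ltr_wpDr// divr_gt0// ltr_wpDl.
pose C := Num.max L1_constant (2 * Num.sqrt (L1_constant / A)).
have C0 : 0 < C by rewrite lt_max C10.
exists C; split => // eps U Du w v /andP[e0 e1] sol drift init t p t0 p1.
have l0 : 0 < ln (2 + t) by apply: ln_gt0; lra.
set l := ln (2 + t) in l0 *.
pose f x := U t x - rarefaction A t x.
have At : 0 < A * t by exact: mulr_gt0.
have cf : continuous f.
  apply: contD; first exact: (vf_cont_x sol (ltW t0)).
  by apply: contN; exact: rarefaction_continuous.
have fK N0 : exists2 N, N0 <= N & \int[mu]_(x in `[- N, N]) `|f x| <= L1_constant * l.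
  exists (Num.max N0 (A * (1 + t) / 2)); first by rewrite le_max lexx.
  by apply: (L1_growth e0 e1 sol drift init) => //; rewrite le_max lexx orbT.
have slope x y : x <= y -> - ((y - x) / (A * t)) <= f y - f x.
  move=> xy; have := rarefaction_slope A0 t0 xy.
  have : U t x <= U t y.
    apply: (deriv_ge0_le xy (fun x _ => vf_dx sol x t0)).
      by move=> z _; exact: vf_incr sol t z t0.
    by apply: continuous_subspaceT; exact: vf_cont_x sol t (ltW t0).
  rewrite /f; lra.
have supf := sup_of_slope_and_L1 At cf slope fK.
have supE : 2 * Num.sqrt (L1_constant * l / (A * t)) =
    2 * Num.sqrt (L1_constant / A) * (t `^ (- 2^-1) * l `^ 2^-1).
  have -> : L1_constant * l / (A * t) = L1_constant / A * (t^-1 * l).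
    by field; rewrite !gt_eqF.
  have LA : 0 <= L1_constant / A by rewrite divr_ge0 ?(ltW C10) ?(ltW A0).
  have ti : 0 <= t^-1 by rewrite invr_ge0 ltW.
  rewrite (sqrtrM (t^-1 * l) LA) (sqrtrM l ti).
  by rewrite powRN !powR12_sqrt ?(ltW t0) ?(ltW l0)// sqrtrV ?(ltW t0)// mulrA.
have tl0 : 0 <= t `^ (- 2^-1) * l `^ 2^-1 by rewrite mulr_ge0 ?powR_ge0.
have supf' x : `|f x| <= C * (t `^ (- 2^-1) * l `^ 2^-1).
  by rewrite (le_trans (supf x))// supE ler_wpM2r// le_max lexx orbT.
have L1f : (\int[mu]_x (`|f x|)%:E <= (C * l)%:E)%E.
  apply: (@integral_line_le _ (fun x => `|f x|)) => //.
    exact: cont_norm.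
  move=> N0; have [N N0N HN] := fK N0; exists N => //.
  by rewrite (le_trans HN)// ler_wpM2r ?(ltW l0)// le_max lexx.
have mf : measurable_fun setT f by exact: continuous_measurable_fun.
case: p p1 => [p| |] //; last first.
  move=> _; rewrite /inve /= subr0 addr0 !mulr1 -mulrA; exact: Lpnorm_pinfty_le.
rewrite lte_fin => p1; rewrite fine_invr.
have p0 : 0 < p by rewrite (lt_trans ltr01).
have q1 : p^-1 < 1 by rewrite invf_lt1.
have q0 : 0 < p^-1 by rewrite invr_gt0.
set q := p^-1 in q0 q1 *.
have S0 : 0 <= C * (t `^ (- 2^-1) * l `^ 2^-1) by rewrite mulr_ge0// ltW.
have K0 : 0 <= C * l by rewrite mulr_ge0// ltW.
apply: le_trans (Lpnorm_interpolation mf S0 supf' K0 L1f p1) _.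
rewrite lee_fin -/q le_eqVlt; apply/orP; left; apply/eqP.
rewrite !powRM ?mulr_ge0 ?powR_ge0 ?(ltW C0) ?(ltW l0)//.
rewrite -!powRrM.
have -> : C `^ (1 - q) * (t `^ (- 2^-1 * (1 - q)) * l `^ (2^-1 * (1 - q))) * (C `^ q * l `^ q)
  = (C `^ (1 - q) * C `^ q) * t `^ (- 2^-1 * (1 - q)) * (l `^ (2^-1 * (1 - q)) * l `^ q).
  by ring.
rewrite -!powRD ?(gt_eqF C0) ?(gt_eqF l0) ?implybT// subrK powRr1 ?(ltW C0)//.
by congr (_ * _ `^ _); field.
Qed.

End FlowBound.

(** * Integrable functions and their primitives *)

Section AlmostEverywhere.
Context {R : realType}.
Local Notation mu := (@lebesgue_measure R).

Lemma aeS (P Q : R -> Prop) : {ae mu, forall x, P x} ->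
  (forall x, P x -> Q x) -> {ae mu, forall x, Q x}.
Proof.
move=> aeP PQ; apply: filterS aeP => //; exact: (ae_filter_ringOfSetsType mu).
Qed.

Lemma aeS2 (P Q T : R -> Prop) : {ae mu, forall x, P x} ->
  {ae mu, forall x, Q x} -> (forall x, P x -> Q x -> T x) ->
  {ae mu, forall x, T x}.
Proof.
move=> aeP aeQ PQT; apply: filterS2 aeP aeQ => //.
exact: (ae_filter_ringOfSetsType mu).
Qed.

Lemma aeW (P : R -> Prop) : (forall x, P x) -> {ae mu, forall x, P x}.
Proof. by move=> H; exists set0; split => // x /= []. Qed.

End AlmostEverywhere.

Section Reflection.
Context {R : realType}.
Local Notation mu := (@lebesgue_measure R).
Implicit Types x y c : R.

Let T := measurableTypeR R.

Let reflection_measurable c : measurable_fun [set: T] (fun y : T => (c - y : T)).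
Proof.
apply: continuous_measurable_fun; apply: contD; first exact: cont_cst.
by apply: contN => y; exact: cvg_id.
Qed.

Let reflected c :=
  measure_function_pushforward__canonical__measure_function_Measure mu
    (reflection_measurable c).

(** Lebesgue measure is determined by its values on half-open intervals, which
    reflection turns into half-open intervals of the same length. *)
Lemma lebesgue_reflection c (E : set R) : measurable E ->
  mu ((fun y => c - y) @^-1` E) = mu E.
Proof.
move=> mE; rewrite [RHS](@lebesgue_measure_unique R (reflected c))// => X [[a b] _ <-] /=.
rewrite /pushforward lebesgue_measure_itv.
have -> : (fun y => c - y) @^-1` `]a, b]%classic = `[c - b, c - a[%classic.
  by apply/seteqP; split => y /=; rewrite !in_itv /= => /andP[y1 y2]; apply/andP; split; lra.
rewrite lebesgue_measure_itv /= !lte_fin ltrD2l ltrN2.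
by case: ifP => // _; rewrite -!EFinD; congr (_%:E); lra.
Qed.

Lemma ge0_integral_reflection c (f : R -> \bar R) : measurable_fun setT f ->
  (forall y, 0 <= f y)%E ->
  (\int[mu]_y f (c - y)%R = \int[mu]_y f y)%E.
Proof.
move=> mf f0.
have := @ge0_integral_pushforward _ _ _ _ R _ (reflection_measurable c) mu setT f.
rewrite preimage_setT => <- //; apply: eq_measure_integral => E mE _.
exact: lebesgue_reflection.
Qed.

Lemma ae_reflection c (P : R -> Prop) : {ae mu, forall y, P y} ->
  {ae mu, forall y, P (c - y)}.
Proof.
move=> [N [mN N0 PN]]; exists ((fun y => c - y) @^-1` N); split.
- by rewrite -[X in measurable X]setTI; exact: reflection_measurable.
- by rewrite lebesgue_reflection.
- by move=> y /= Py; apply: PN => /=.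
Qed.

End Reflection.

Section Primitive.
Context {R : realType}.
Local Notation mu := (@lebesgue_measure R).
Implicit Types (f g : R -> R) (x y e : R).

Lemma integrable_sub (D : set R) f g : measurable D ->
  mu.-integrable D (EFin \o f) -> mu.-integrable D (EFin \o g) ->
  mu.-integrable D (EFin \o (fun x => f x - g x)).
Proof.
move=> mD fi gi.
have H : mu.-integrable D ((EFin \o f) \- (EFin \o g))%E by apply: integrableB.
by apply: eq_integrable H.
Qed.

Lemma integrable_scale (D : set R) (c : R) f : measurable D ->
  mu.-integrable D (EFin \o f) -> mu.-integrable D (EFin \o (fun x => c * f x)).
Proof.
move=> mD fi.
have H : mu.-integrable D (fun x => c%:E * (EFin \o f) x)%E by apply: integrableZl.
by apply: eq_integrable H.
Qed.

Lemma in_L1_measurable f : in_L1 f -> measurable_fun setT f.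
Proof. by move=> /integrableP[/measurable_EFinP]. Qed.

Lemma in_L1S f (D : set R) : measurable D -> in_L1 f ->
  mu.-integrable D (EFin \o f).
Proof. by move=> mD; apply: integrableS. Qed.

Lemma in_L1_norm f : in_L1 f -> in_L1 (fun x => `|f x|).
Proof. by move=> fi; exact: integrable_norm. Qed.

Lemma in_L1B f g : in_L1 f -> in_L1 g -> in_L1 (fun x => f x - g x).
Proof.
move=> fi gi; rewrite /in_L1.
have := integrableB measurableT fi gi.
by apply: eq_integrable.
Qed.

Lemma in_L1D f g : in_L1 f -> in_L1 g -> in_L1 (fun x => f x + g x).
Proof.
move=> fi gi; rewrite /in_L1.
have := integrableD measurableT fi gi.
by apply: eq_integrable.
Qed.

Lemma in_L1Z (c : R) f : in_L1 f -> in_L1 (fun x => c * f x).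
Proof.
move=> fi; rewrite /in_L1.
have := integrableZl measurableT c fi.
by apply: eq_integrable.
Qed.

Lemma in_L1_bounded_mul (c : R) f g : in_L1 f -> measurable_fun setT g ->
  {ae mu, forall x, `|g x| <= c} -> in_L1 (fun x => g x * f x).
Proof.
move=> fi mg gc; have mf := in_L1_measurable fi.
apply/integrableP; split.
  by apply/measurable_EFinP; exact: measurable_funM.
have cfi : in_L1 (fun x => `|c| * `|f x|) by apply: in_L1Z; exact: in_L1_norm.
have m1 : measurable_fun setT (fun x : R => (`|g x * f x|)%:E).
  by apply/measurable_EFinP/measurableT_comp => //; exact: measurable_funM.
have m2 : measurable_fun setT (fun x : R => (`|c| * `|f x|)%:E).
  by apply/measurable_EFinP; exact: in_L1_measurable cfi.
have le12 : {ae mu, forall x, setT x ->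
    ((`|g x * f x|)%:E <= (`|c| * `|f x|)%:E)%E}.
  apply: (aeS gc) => x gx _; rewrite lee_fin normrM ler_wpM2r//.
  exact: le_trans gx (ler_norm _).
have cfE : (\int[mu]_x (`|c| * `|f x|)%:E \is a fin_num)%E.
  exact: integrable_fin_num cfi.
apply: (@le_lt_trans _ _ (\int[mu]_x (`|c| * `|f x|)%:E)%E).
  exact: ae_ge0_le_integral.
by rewrite -ge0_fin_numE// integral_ge0// => x _; rewrite lee_fin mulr_ge0.
Qed.

Lemma Lpnorm1E f : in_L1 f -> Lpnorm 1 f = (\int[mu]_x `|f x|)%:E.
Proof.
move=> fi; rewrite /Lpnorm Lnorm1 /Rintegral fineK//.
exact: integrable_fin_num (in_L1_norm fi).
Qed.

Lemma ae_Rintegral_le f g : in_L1 f -> in_L1 g ->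
  {ae mu, forall x, f x <= g x} -> \int[mu]_x f x <= \int[mu]_x g x.
Proof.
move=> fi gi fg; rewrite -subr_ge0 -RintegralB//.
rewrite /Rintegral fine_ge0//.
have gfi := in_L1B gi fi.
have -> : (\int[mu]_x (g x - f x)%:E = \int[mu]_x (`|g x - f x|)%:E)%E.
  apply: ae_eq_integral => //.
  - exact: measurable_int gfi.
  - exact: measurable_int (in_L1_norm gfi).
  - by apply: (aeS fg) => x fx _; rewrite ger0_norm// subr_ge0.
by apply: integral_ge0 => x _; rewrite lee_fin.
Qed.

Lemma ae_ge0_Rintegral_norm (D : set R) f : measurable D -> in_L1 f ->
  {ae mu, forall x, 0 <= f x} ->
  \int[mu]_(x in D) `|f x| = \int[mu]_(x in D) f x.
Proof.
move=> mD fi f0; rewrite /Rintegral; congr fine; apply: ae_eq_integral => //.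
- exact: measurable_funTS (measurable_int _ (in_L1_norm fi)).
- exact: measurable_funTS (measurable_int _ fi).
- by apply: (aeS f0) => z fz _; rewrite /= ger0_norm.
Qed.

Definition prim f x : R := \int[mu]_(y in `]-oo, x]) f y.

Lemma primB f x y : in_L1 f -> x <= y ->
  prim f y - prim f x = \int[mu]_(z in `]x, y]) f z.
Proof.
move=> fi xy; rewrite /prim Rintegral_itvB//.
by apply: in_L1S.
Qed.

Lemma prim_compl f x : in_L1 f ->
  \int[mu]_y f y - prim f x = \int[mu]_(y in `]x, +oo[) f y.
Proof.
by move=> fi; rewrite /prim -set_itvNyy Rintegral_itvB// set_itvNyy.
Qed.

Lemma prim_nondecreasing f x y : in_L1 f -> {ae mu, forall x, 0 <= f x} ->
  x <= y -> prim f x <= prim f y.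
Proof.
move=> fi f0 xy; rewrite -subr_ge0 primB// -ae_ge0_Rintegral_norm//.
exact: Rintegral_ge0.
Qed.

Lemma prim_norm_le f x : in_L1 f -> `|prim f x| <= \int[mu]_y `|f y|.
Proof.
move=> fi; apply: (le_trans (le_normr_Rintegral _ (in_L1S _ fi))) => //.
have ni := in_L1_norm fi.
rewrite -subr_ge0 (prim_compl x ni); exact: Rintegral_ge0.
Qed.

Lemma prim_dist f g x : in_L1 f -> in_L1 g ->
  `|prim f x - prim g x| <= \int[mu]_y `|f y - g y|.
Proof.
move=> fi gi; rewrite /prim -RintegralB//; try by exact: in_L1S.
exact: (prim_norm_le x (in_L1B fi gi)).
Qed.

Lemma prim_le_mass f x : in_L1 f -> {ae mu, forall x, 0 <= f x} ->
  0 <= prim f x <= \int[mu]_y f y.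
Proof.
move=> fi f0; rewrite -(@ae_ge0_Rintegral_norm setT)//.
rewrite (le_trans (ler_norm _) (prim_norm_le x fi)) andbT.
by rewrite /prim -ae_ge0_Rintegral_norm//; exact: Rintegral_ge0.
Qed.

Lemma prim_continuous f : in_L1 f -> continuous (prim f).
Proof.
move=> fi x; apply/cvgrPdist_lt => e e0.
have [d [d0 Hd]] := integral_normr_continuous fi e0.
apply/nbhs_ballP; exists d => // y; rewrite /ball /= => xy.
wlog xley : x y xy / x <= y.
  move=> W; have [|yx] := leP x y; first exact: W.
  by rewrite distrC; apply: W; [rewrite distrC|exact: ltW].
rewrite distrC primB//.
apply: le_lt_trans (le_normr_Rintegral _ (in_L1S _ fi)) _ => //.
apply: Hd => //; rewrite /= lebesgue_measure_itv /= lte_fin.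
case: ifP => _; rewrite -?EFinD lte_fin//.
by rewrite distrC in xy; rewrite (le_lt_trans (ler_norm _)).
Qed.

(** The integrals of |f| over growing symmetric intervals converge to the full
    integral, which bounds both tails at once. *)
Lemma prim_limits f e : in_L1 f -> 0 < e -> exists N, forall x, N <= x ->
  `|prim f x - \int[mu]_y f y| <= e /\ `|prim f (- x)| <= e.
Proof.
move=> fi e0; pose g (x : R) : R := `|f x|.
have gi : in_L1 g by exact: in_L1_norm.
have g0 : {ae mu, forall x, 0 <= g x} by apply: aeW => x; rewrite /g.
have mono := prim_nondecreasing gi g0.
have pos x := prim_le_mass x gi g0.
have [N [N0 HN]] : exists N, 0 <= N /\ \int[mu]_y g y - (prim g N - prim g (- N)) <= e.
  apply: contrapT => Hno.
  have Hlt N : 0 <= N -> prim g N - prim g (- N) <= \int[mu]_y g y - e.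
    move=> N0; rewrite leNgt; apply/negP => H; apply: Hno; exists N; split => //.
    lra.
  pose I (n : nat) : set R := `]- (n%:R : R), n%:R]%classic.
  have cover : \bigcup_n I n = [set: R].
    apply/seteqP; split => // x _; exists (Num.truncn `|x|).+1 => //=.
    have := truncnS_gt `|x|; rewrite /I /= in_itv /= ltr_norml => /andP[-> x2].
    exact: ltW.
  have mI (n : nat) : measurable (I n) by exact: measurable_itv.
  have cvg : ((\int[mu]_(x in I i) (g x)%:E)%E @[i --> \oo] -->
      (\int[mu]_(x in \bigcup_i I i) (g x)%:E)%E).
    apply: ge0_nondecreasing_set_cvg_integral => //.
    - by move=> n m nm; apply/subsetPset; apply: subset_itv; rewrite bnd_simp ?lerN2 ler_nat.
    - by move=> n; apply: measurable_funTS; exact: measurable_int gi.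
    - by move=> n x _; rewrite lee_fin /g normr_ge0.
  rewrite cover in cvg.
  have : (\int[mu]_x (g x)%:E <= (\int[mu]_y g y - e)%:E)%E.
    apply: (cvge_to_le cvg); apply: nearW => n.
    have In : mu.-integrable (I n) (EFin \o g) by exact: in_L1S.
    have n0 : 0 <= n%:R :> R by [].
    have nn : - (n%:R : R) <= n%:R by lra.
    have := Hlt _ n0; rewrite (primB gi nn) /Rintegral -lee_fin fineK//.
    by apply: integrable_fin_num => //; exact: In.
  have gE : ((\int[mu]_y g y)%:E = \int[mu]_y (g y)%:E)%E.
    by rewrite fineK//; exact: integrable_fin_num gi.
  by rewrite -gE lee_fin lerBrDr gerDl leNgt e0.
exists N => x Nx.
have /andP[p1 p2] := pos (- N); have /andP[p3 p4] := pos N.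
split.
  rewrite distrC prim_compl//.
  apply: le_trans (le_normr_Rintegral _ (in_L1S _ fi)) _ => //.
  rewrite -(prim_compl x gi); move: (mono _ _ Nx) p1 HN.
  move: (prim g x) (prim g N) (prim g (- N)) (\int[mu]_y g y) => {g gi g0 mono pos p2 p3 p4} a b c d.
  lra.
apply: le_trans (le_normr_Rintegral _ (in_L1S _ fi)) _ => //.
rewrite -/(prim g (- x)).
have xN : - x <= - N by lra.
move: (mono _ _ xN) p4 HN.
move: (prim g (- x)) (prim g N) (prim g (- N)) (\int[mu]_y g y) => {g gi g0 mono pos p1 p2 p3} a b c d.
lra.
Qed.

Lemma prim_sub f g x : in_L1 f -> in_L1 g ->
  prim (fun y => f y - g y) x = prim f x - prim g x.
Proof. by move=> fi gi; rewrite /prim RintegralB//; exact: in_L1S. Qed.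

Lemma primZ (c : R) f x : in_L1 f -> prim (fun y => c * f y) x = c * prim f x.
Proof. by move=> fi; rewrite /prim RintegralZl//; exact: in_L1S. Qed.

Lemma prim_deriv f x : in_L1 f -> continuous f -> is_derive x 1 (prim f) (f x).
Proof.
move=> fi cf; have x1 : x < x + 1 by rewrite ltrDl.
have xN : (-oo%O < BRight x)%E by rewrite ltNyr.
have Bi : mu.-integrable `]-oo, x + 1] (EFin \o f) by exact: in_L1S.
have [d1 d2] := continuous_FTC1 x1 Bi xN (cf x).
by split; [exact: d1|rewrite -derive1E; exact: d2].
Qed.

End Primitive.

(** * Smooth cut-off functions *)

Section Bump.
Context {R : realType}.
Local Notation mu := (@lebesgue_measure R).
Implicit Types (x y a b c r : R) (m n : nat) (f g : R -> R).

(** The functions x ^ (- n) exp (- 1 / x), extended by 0, differentiate into linear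
    combinations of one another. *)
Definition flat n x : R := if 0 < x then x^-1 ^+ n * expR (- x^-1) else 0.

Lemma flat_pos n x : 0 < x -> flat n x = x^-1 ^+ n * expR (- x^-1).
Proof. by rewrite /flat => ->. Qed.

Lemma flat_npos n x : x <= 0 -> flat n x = 0.
Proof. by rewrite /flat ltNge => ->. Qed.

Lemma flat_ge0 n x : 0 <= flat n x.
Proof.
rewrite /flat; case: ifP => // x0.
by rewrite mulr_ge0 ?expR_ge0// exprn_ge0// invr_ge0 ltW.
Qed.

Lemma expR_beats_power n y : 0 < y -> y ^+ n * expR (- y) <= n%:R ^+ n.
Proof.
move=> y0; case: n => [|n]; first by rewrite expr0 mul1r expr0 -expR0 ler_expR; lra.
have n0 : 0 < n.+1%:R :> R by rewrite ltr0n.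
rewrite expRN ler_pdivrMr ?expR_gt0//.
have -> : expR y = expR (y / n.+1%:R) ^+ n.+1.
  by rewrite -expRM_natl mulrCA mulfV ?mulr1// gt_eqF.
rewrite -exprMn ler_pXn2r ?nnegrE ?mulr_ge0 ?expR_ge0 ?(ltW y0)//.
rewrite -ler_pdivrMl//; apply: le_trans (expR_ge1Dx _).
by rewrite mulrC lerDr.
Qed.

Lemma flat_quadratic n : exists c, forall x, `|flat n x| <= c * x ^+ 2.
Proof.
exists ((n.+2)%:R ^+ n.+2) => x; rewrite ger0_norm ?flat_ge0//.
have [x0|x0] := leP x 0.
  by rewrite flat_npos// mulr_ge0 ?sqr_ge0 ?exprn_ge0.
rewrite flat_pos// -ler_pdivrMr ?exprn_gt0//.
have xV : 0 < x^-1 by rewrite invr_gt0.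
have := expR_beats_power n.+2 xV; congr (_ <= _).
by rewrite !exprS; field; rewrite gt_eqF.
Qed.

Lemma flat_deriv n x : is_derive x 1 (flat n) (flat n.+2 x - n%:R * flat n.+1 x).
Proof.
have [x0|x0|->] := ltgtP x 0.
- rewrite !flat_npos ?(ltW x0)// mulr0 subr0.
  apply: near_eq_is_derive (deriv_cst 0 x).
  by near=> y; rewrite flat_npos//; near: y; exact: lt_le_nbhsl.
- rewrite !flat_pos//; have xn0 : x != 0 by rewrite gt_eqF.
  have dV := derivV xn0 (deriv_id x).
  have dX : is_derive x 1 (fun y : R => y^-1 ^+ n) (- n%:R * x^-1 ^+ n.+1).
    elim: n => [|n IH].
      by have := deriv_cst (1 : R) x; congr is_derive; rewrite oppr0 mul0r.
    have := derivM dV IH; congr is_derive.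
      by apply/funext => y; rewrite exprS.
    by rewrite -natr1 !exprS; field.
  have dE := deriv_comp (g := fun y : R => - y^-1) (is_derive_expR _) (derivN dV).
  apply: near_eq_is_derive (_ : is_derive x 1 (fun y : R => y^-1 ^+ n * expR (- y^-1)) _).
    by near=> y; rewrite flat_pos//; near: y; exact: lt_nbhsr.
  have := derivM dX dE; congr is_derive.
  by rewrite !exprS; field.
- have [c Hc] := flat_quadratic n.
  rewrite !flat_npos// mulr0 subr0; apply: (@deriv_of_quadratic_bound _ _ _ _ c) => h.
  by rewrite add0r mulr0 subr0 (flat_npos n (lexx 0)) subr0.
Unshelve. all: by end_near. Qed.

Definition bump x : R := flat 0 (1 + x) * flat 0 (1 - x).

Definition step : R -> R := prim bump.

(** A class of functions closed under differentiation, so that smoothness reduces to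
    one differentiation. It contains the translates and dilates of [step]. *)
Inductive smooth_family : (R -> R) -> Prop :=
| sf_bump m n : smooth_family (fun x => flat m (1 + x) * flat n (1 - x))
| sf_add f g : smooth_family f -> smooth_family g ->
    smooth_family (fun x => f x + g x)
| sf_affine c r a f : smooth_family f ->
    smooth_family (fun x => c * f (r * (x - a)))
| sf_step : smooth_family step.

Lemma bump_ge0 x : 0 <= bump x.
Proof. by rewrite mulr_ge0// flat_ge0. Qed.

Lemma flat0_le1 x : flat 0 x <= 1.
Proof.
rewrite /flat; case: ifP => // x0; rewrite expr0 mul1r -expR0 ler_expR.
by rewrite lerNl oppr0 invr_ge0 ltW.
Qed.

Lemma bump_le1 x : bump x <= 1.
Proof. by rewrite mulr_ile1 ?flat_ge0 ?flat0_le1. Qed.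

Lemma bump_out x : 1 <= `|x| -> bump x = 0.
Proof.
rewrite ler_normr => /orP[x1|x1]; rewrite /bump.
  by rewrite (@flat_npos _ (1 - x)) ?mulr0//; lra.
by rewrite (@flat_npos _ (1 + x)) ?mul0r//; lra.
Qed.

Lemma bump_deriv m n x : is_derive x 1 (fun x => flat m (1 + x) * flat n (1 - x))
  ((flat m.+2 (1 + x) - m%:R * flat m.+1 (1 + x)) * flat n (1 - x)
   + flat m (1 + x) * ((flat n.+2 (1 - x) - n%:R * flat n.+1 (1 - x)) * -1)).
Proof.
have d1 : is_derive x 1 (fun y : R => 1 + y) 1.
  by have := derivD (deriv_cst 1 x) (deriv_id x); rewrite add0r.
have d2 : is_derive x 1 (fun y : R => 1 - y) (-1).
  by have := derivB (deriv_cst 1 x) (deriv_id x); rewrite sub0r.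
have d3 := deriv_comp (g := fun y : R => 1 + y) (flat_deriv m (1 + x)) d1.
have d4 := deriv_comp (g := fun y : R => 1 - y) (flat_deriv n (1 - x)) d2.
by have := derivM d3 d4; rewrite mulr1.
Qed.

Lemma bump_continuous : continuous bump.
Proof. by move=> x; exact: deriv_continuous (bump_deriv 0 0 x). Qed.

Lemma bump_L1 : in_L1 bump.
Proof.
have H := continuous_integrable_itv (-1) 1 bump_continuous.
have H1 : mu.-integrable setT ((EFin \o bump) \_ `[-1, 1]%classic).
  by apply: (integrable_mkcond _ _).1 => //; exact: measurable_itv.
apply: eq_integrable H1 => // x _; rewrite patchE; case: ifPn => // xI.
rewrite /= bump_out// leNgt; apply/negP; rewrite ltr_norml => /andP[x1 x2].
by move/negP: xI; apply; rewrite inE /= in_itv /= !ltW.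
Qed.

Lemma step_deriv x : is_derive x 1 step (bump x).
Proof. exact: prim_deriv bump_L1 bump_continuous. Qed.

Lemma smooth_family_deriv f : smooth_family f ->
  exists2 g, smooth_family g & forall x : R, is_derive x 1 f (g x).
Proof.
elim=> [m n|f1 f2 _ [g1 s1 d1] _ [g2 s2 d2]|c r a f1 _ [g1 s1 d1]|].
- pose B m n x := flat m (1 + x) * flat n (1 - x).
  have scale c f1 : smooth_family f1 -> smooth_family (fun x => c * f1 x).
    move=> s1; have := sf_affine c 1 0 s1; congr smooth_family.
    by apply/funext => x; rewrite subr0 mul1r.
  exists (fun x => (B m.+2 n x + (- m%:R) * B m.+1 n x)
             + (-1 * B m n.+2 x + n%:R * B m n.+1 x)).
    by apply: sf_add; apply: sf_add; try apply: (scale); exact: sf_bump.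
  by move=> x; have := bump_deriv m n x; congr is_derive; rewrite /B; ring.
- by exists (fun x => g1 x + g2 x); [exact: sf_add|move=> x; exact: derivD].
- exists (fun x => (c * r) * g1 (r * (x - a))); first exact: sf_affine.
  move=> x; have da := derivZ r (derivD (deriv_id x) (deriv_cst (- a) x)).
  have := derivZ c (deriv_comp (g := fun y => r * (y - a)) (d1 (r * (x - a))) da).
  by congr is_derive; ring.
- by exists bump; [exact: sf_bump|move=> x; exact: step_deriv].
Qed.

Lemma smooth_family_smooth f : smooth_family f ->
  forall n x, derivable (derive1n n f) x 1.
Proof.
move=> + n; elim: n f => [|n IH] f sf x.
  by have [g _ dg] := smooth_family_deriv sf; rewrite derive1n0; case: (dg x).
have [g sg dg] := smooth_family_deriv sf.
rewrite derive1Sn (_ : derive1 f = g); first exact: IH.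
by apply/funext => y; exact: derivE.
Qed.

Lemma bump_pos0 : 0 < bump 0.
Proof. by rewrite /bump addr0 subr0 mulr_gt0// flat_pos// mul1r ?expr0 ?invr1 ?mul1r expR_gt0. Qed.

Lemma step_left x : x <= -1 -> step x = 0.
Proof.
move=> x1; rewrite /step /prim (@eq_Rintegral _ _ R mu _ (fun=> 0)) ?Rintegral_cst ?mul0r//.
move=> y; rewrite inE /= in_itv /= => yx; rewrite bump_out// ler_normr.
by apply/orP; right; lra.
Qed.

Lemma step_right x : 1 <= x -> step x = step 1.
Proof.
move=> x1; apply/eqP; rewrite -subr_eq0; apply/eqP.
rewrite (primB bump_L1 x1).
rewrite (@eq_Rintegral _ _ R mu _ (fun=> 0)) ?Rintegral_cst ?mul0r//.
move=> y; rewrite inE /= in_itv /= => /andP[y1 y2]; rewrite bump_out// ler_normr.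
by rewrite (ltW y1).
Qed.

Lemma step_bounds x : 0 <= step x <= step 1.
Proof.
have mono (u v : R) : u <= v -> step u <= step v.
  by move=> uv; apply: (prim_nondecreasing bump_L1) => //; apply: aeW; exact: bump_ge0.
have [x1|x1] := leP x 1.
  rewrite mono// andbT; have [xm|xm] := leP x (-1); first by rewrite step_left.
  by rewrite -(step_left (lexx (-1))) mono// ltW.
by rewrite step_right ?(ltW x1)// lexx andbT -(step_left (lexx (-1))) mono//; lra.
Qed.

Lemma step1_gt0 : 0 < step 1.
Proof.
have : step (-1) < step 1.
  rewrite lt_neqAle; apply/andP; split; last first.
    by rewrite (step_left (lexx _)); case/andP: (step_bounds 1).
  apply/eqP => E.
  have cst x : -1 <= x <= 1 -> step x = 0.
    move=> /andP[x1 x2].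
    have : step (-1) <= step x <= step 1.
      rewrite (step_left (lexx _)); exact: step_bounds.
    by rewrite -E step_left// => /andP[? ?]; apply/eqP; rewrite eq_le; apply/andP.
  have : is_derive (0 : R) 1 step 0.
    apply: near_eq_is_derive (deriv_cst 0 0).
    near=> y; rewrite cst// -ler_norml.
    by near: y; apply/nbhs_ballP; exists 1 => //= y; rewrite /ball /= sub0r normrN => /ltW.
  move=> /derivE; rewrite (derivE (step_deriv 0)) => b0.
  by have := bump_pos0; rewrite b0 ltxx.
by rewrite step_left.
Unshelve. all: by end_near. Qed.

End Bump.

(** * Weak derivatives of integrable functions *)

Section WeakDerivative.
Context {R : realType}.
Local Notation mu := (@lebesgue_measure R).
Implicit Types (f g F : R -> R) (x y a b c r e : R).

Lemma L1_lower_bound F p q c : in_L1 F -> p < q ->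
  {ae mu, forall x, p <= x <= q -> c <= `|F x|} -> c * (q - p) <= \int[mu]_x `|F x|.
Proof.
move=> Fi pq Fc; pose ind : R -> R := \1_(`[p, q]%classic).
have indi : in_L1 ind by exact: integrable_indic_itv.
have -> : c * (q - p) = \int[mu]_x (c * ind x).
  rewrite RintegralZl//; congr (_ * _).
  by rewrite /Rintegral integral_indic//= setIT lebesgue_measure_itv /= lte_fin pq.
apply: ae_Rintegral_le; [exact: in_L1Z|exact: in_L1_norm|].
apply: (aeS Fc) => x H; rewrite /ind indicE; case: (boolP (_ \in _)) => [/set_mem|_].
  by rewrite mulr1 => xI; apply: H; move: xI; rewrite /= in_itv.
by rewrite mulr0.
Qed.

(** An integrable function cannot approach a nonzero constant at infinity. *)
Lemma L1_prim_const F g c : in_L1 F -> in_L1 g ->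
  {ae mu, forall x, F x = c + prim g x} -> c = 0 /\ \int[mu]_x g x = 0.
Proof.
move=> Fi gi FE.
have plateau l e : 0 < e -> e <= `|l| / 2 ->
    (exists p, {ae mu, forall x, p <= x <= p + (\int[mu]_x `|F x| + 1) / (`|l| / 2) ->
        `|F x - l| <= e}) -> False.
  move=> e0 el [p Hp]; have l0 : 0 < `|l| / 2 by exact: lt_le_trans el.
  set I := \int[mu]_x `|F x| in Hp *.
  have I0 : 0 <= I by exact: Rintegral_ge0.
  have q0 : 0 < (I + 1) / (`|l| / 2) by rewrite divr_gt0// ltr_wpDl.
  have : `|l| / 2 * (p + (I + 1) / (`|l| / 2) - p) <= I.
    apply: L1_lower_bound => //; first by rewrite ltrDl.
    apply: (aeS Hp) => x H /H Fx.
    have := ler_distD (F x) l 0; rewrite !subr0 (distrC l) => H2.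
    lra.
  rewrite addrAC subrr add0r mulrC divfK ?gt_eqF//; lra.
have c0 : c = 0.
  apply/eqP/negPn/negP => c0.
  have e0 : 0 < `|c| / 2 by rewrite divr_gt0// normr_gt0.
  have [N HN] := prim_limits gi e0.
  set I := (\int[mu]_x `|F x| + 1) / (`|c| / 2).
  apply: (plateau c (`|c| / 2)) => //; exists (- `|N| - I); rewrite -/I.
  apply: (aeS FE) => x -> /andP[_ x2].
  have Nx : N <= - x by have := ler_norm N; lra.
  by have [_] := HN _ Nx; rewrite opprK addrAC subrr add0r.
split => //; apply/eqP/negPn/negP => g0.
set l := \int[mu]_x g x in g0.
have e0 : 0 < `|l| / 2 by rewrite divr_gt0// normr_gt0.
have [N HN] := prim_limits gi e0.
apply: (plateau l (`|l| / 2)) => //; exists N.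
apply: (aeS FE) => x -> /andP[x1 _]; rewrite c0 add0r.
by have [] := HN _ x1.
Qed.

Let Z : R := step 1.
(* [ramp a r] rises from 0 to [Z] across the interval of radius [r] around [a], and
   [kernel a r] is its derivative, an approximate identity of mass [Z]. *)
Let kernel a r y : R := r^-1 * bump (r^-1 * (y - a)).
Let ramp a r y : R := step (r^-1 * (y - a)).

Let ramp_deriv a r y : is_derive y 1 (ramp a r) (kernel a r y).
Proof.
have da := derivZ r^-1 (derivD (deriv_id y) (deriv_cst (- a) y)).
have := deriv_comp (g := fun y => r^-1 * (y - a)) (step_deriv (r^-1 * (y - a))) da.
by congr is_derive; rewrite /kernel; ring.
Qed.

Let ramp_continuous a r : continuous (ramp a r).
Proof. by move=> y; exact: deriv_continuous (ramp_deriv a r y). Qed.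

Let kernel_continuous a r : continuous (kernel a r).
Proof.
apply: contM; first exact: cont_cst.
move=> y; apply: (@continuous_comp _ _ _ (fun y => r^-1 * (y - a)) bump).
  have da := derivZ r^-1 (derivD (deriv_id y) (deriv_cst (- a) y)).
  exact: deriv_continuous da.
exact: bump_continuous.
Qed.

Let kernel_out a r y : 0 < r -> r <= `|y - a| -> kernel a r y = 0.
Proof.
move=> r0 ry; rewrite /kernel bump_out ?mulr0// normrM gtr0_norm ?invr_gt0//.
by rewrite ler_pdivlMl// mulr1.
Qed.

Let kernel_bound a r y : 0 < r -> `|kernel a r y| <= r^-1.
Proof.
move=> r0; rewrite ger0_norm.
  by rewrite -[leRHS]mulr1 ler_wpM2l ?bump_le1// invr_ge0 ltW.
by rewrite mulr_ge0 ?bump_ge0// invr_ge0 ltW.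
Qed.

Let ballE a r : ball a r = `]a - r, a + r[%classic :> set R.
Proof. exact: ball_itv. Qed.

Lemma Rintegral_vanishing_out f (D : set R) : measurable D ->
  (forall x, ~ D x -> f x = 0) ->
  \int[mu]_x f x = \int[mu]_(x in D) f x.
Proof.
move=> mD fD; rewrite [RHS]Rintegral_mkcond; congr Rintegral.
apply/funext => x; rewrite patchE; case: ifPn => // /negP xD.
by rewrite fD// => Dx; apply: xD; rewrite inE.
Qed.

Let kernel_mass a r : 0 < r -> \int[mu]_y kernel a r y = Z.
Proof.
move=> r0; rewrite (@Rintegral_vanishing_out _ `[a - r, a + r]%classic)//; last first.
  move=> y /=; rewrite in_itv /= => /negP; rewrite -ler_distl -ltNge => yr.
  by apply: kernel_out => //; exact: ltW.
have ar : a - r < a + r by lra.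
rewrite (Rintegral_deriv ar (ramp_deriv a r) (@kernel_continuous a r)) /ramp.
have -> : r^-1 * (a + r - a) = 1 by field; rewrite gt_eqF.
have -> : r^-1 * (a - r - a) = -1 by field; rewrite gt_eqF.
by rewrite (step_left (lexx (-1))) subr0.
Qed.

Let measurable_kernel a r : measurable_fun setT (kernel a r).
Proof. exact: continuous_measurable_fun. Qed.

Let kernel_mul_L1 a r f : 0 < r -> in_L1 f -> in_L1 (fun y => kernel a r y * f y).
Proof.
move=> r0 fi; apply: (in_L1_bounded_mul (c := r^-1)) => //.
by apply: aeW => y; exact: kernel_bound.
Qed.

Let kernel_in_L1 a r : 0 < r -> in_L1 (kernel a r).
Proof.
move=> r0.
have H := continuous_integrable_itv (a - r) (a + r) (@kernel_continuous a r).
have H1 : mu.-integrable setT ((EFin \o kernel a r) \_ `[a - r, a + r]%classic).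
  by apply: (integrable_mkcond _ _).1 => //; exact: measurable_itv.
apply: eq_integrable H1 => // x _; rewrite patchE; case: ifPn => // xI.
rewrite /= kernel_out// leNgt; apply/negP => /ltW; rewrite ler_distl => xr.
by move/negP: xI; apply; rewrite inE /= in_itv.
Qed.

Let dist_integrable f a r : in_L1 f ->
  mu.-integrable `]a - r, a + r[ (EFin \o (fun y => f y - f a)).
Proof.
move=> fi.
have I1 : mu.-integrable `]a - r, a + r[ (EFin \o f) by exact: in_L1S.
have I2 : mu.-integrable `]a - r, a + r[ (EFin \o cst (f a)).
  apply: (@integrableS _ _ _ mu `[a - r, a + r]%classic) => //.
    by apply: subset_itv; rewrite bnd_simp.
  by apply: continuous_integrable_itv; exact: cont_cst.
exact: integrable_sub.
Qed.

Lemma kernel_approx f a r : 0 < r -> in_L1 f ->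
  `|\int[mu]_y (kernel a r y * f y) - Z * f a|
    <= r^-1 * \int[mu]_(y in `]a - r, a + r[) `|f y - f a|.
Proof.
move=> r0 fi.
have fai := dist_integrable a r fi.
have -> : Z * f a = \int[mu]_y (f a * kernel a r y).
  by rewrite RintegralZl ?kernel_mass 1?mulrC//; exact: kernel_in_L1.
rewrite -RintegralB//; [|exact: kernel_mul_L1|exact/in_L1Z/kernel_in_L1].
rewrite (@Rintegral_vanishing_out _ `]a - r, a + r[%classic)//; last first.
  move=> y /=; rewrite in_itv /= => /negP; rewrite -ltr_distl -leNgt => ry.
  by rewrite kernel_out// mul0r mulr0 subrr.
have dif : mu.-integrable `]a - r, a + r[
    (EFin \o (fun y => kernel a r y * f y - f a * kernel a r y)).
  by apply: in_L1S => //; apply: in_L1B; [exact: kernel_mul_L1|exact/in_L1Z/kernel_in_L1].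
apply: le_trans (le_normr_Rintegral _ dif) _ => //.
have nfai := integrable_norm fai.
rewrite -RintegralZl//; apply: le_Rintegral => //.
- exact: integrable_norm dif.
- exact: integrable_scale nfai.
- move=> y _; have -> : kernel a r y * f y - f a * kernel a r y = kernel a r y * (f y - f a).
    by ring.
  by rewrite normrM ler_wpM2r// kernel_bound.
Qed.

Lemma kernel_cvg f a e : in_L1 f -> lebesgue_pt f a -> 0 < e ->
  exists2 d, 0 < d & forall r, 0 < r < d ->
    `|\int[mu]_y (kernel a r y * f y) - Z * f a| <= e.
Proof.
move=> fi fa e0; have e20 : 0 < e / 2 by rewrite divr_gt0.
have /fine_cvgP[_ H] := fa.
move/cvgrPdist_le : H => /(_ _ e20); rewrite near_withinE => /nbhs_ballP[d /= d0 Hd].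
exists d => // r /andP[r0 rd]; apply: le_trans (kernel_approx _ r0 fi) _.
have r20 : 0 < r *+ 2 by rewrite mulrn_wgt0.
set I := \int[mu]_(y in `]a - r, a + r[) `|f y - f a|.
have E : davg f a r = ((r *+ 2)^-1 * I)%:E.
  rewrite /davg /iavg lebesgue_measure_ball ?(ltW r0)// inver gt_eqF// EFinM.
  congr (_ * _)%E; rewrite /I /Rintegral fineK; last first.
    by apply: integrable_fin_num => //; exact: integrable_norm (dist_integrable a r fi).
  by rewrite ballE.
have := Hd r; rewrite /ball /= !sub0r !normrN (gtr0_norm r0) => /(_ rd r0).
have r2E : (r *+ 2)^-1 = r^-1 / 2 by rewrite -(mulr_natr r 2) invfM.
rewrite E /= r2E mulrAC => /ler_normlP[_ H1].
lra.
Qed.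

Lemma ramp_approx g a r : 0 < r -> in_L1 g ->
  `|\int[mu]_y (ramp a r y * g y) - Z * (\int[mu]_y g y - prim g a)|
    <= Z * \int[mu]_(y in `]a - r, a + r[) `|g y|.
Proof.
move=> r0 gi; have gn := in_L1_norm gi.
have Z0 : 0 <= Z by exact: ltW step1_gt0.
have ramp01 y : 0 <= ramp a r y <= Z by exact: step_bounds.
pose ia : R -> R := \1_(`]a, +oo[%classic).
pose ib : R -> R := \1_(`]a - r, a + r[%classic).
have mia : measurable_fun setT ia by exact: measurable_indic.
have mib : measurable_fun setT ib by exact: measurable_indic.
have ind1 (E : set R) x : `|\1_E x : R| <= 1.
  by rewrite indicE; case: (_ \in _); rewrite ?normr1 ?normr0.
have i1 : in_L1 (fun y => ramp a r y * g y).
  apply: (in_L1_bounded_mul (c := Z)) => //.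
    by apply: continuous_measurable_fun; exact: ramp_continuous.
  apply: aeW => y; have /andP[y1 y2] := ramp01 y; by rewrite ger0_norm.
have i2 : in_L1 (fun y => ia y * g y).
  by apply: (in_L1_bounded_mul (c := 1)) => //; apply: aeW => y; exact: ind1.
have i3 : in_L1 (fun y => ib y * `|g y|).
  by apply: (in_L1_bounded_mul (c := 1)) => //; apply: aeW => y; exact: ind1.
have E2 : \int[mu]_y (ia y * g y) = \int[mu]_y g y - prim g a.
  rewrite prim_compl// [RHS]Rintegral_mkcond; congr Rintegral.
  apply/funext => y; rewrite /ia indicE patchE.
  by case: (_ \in _); rewrite ?mul1r ?mul0r.
have E3 : \int[mu]_y (ib y * `|g y|) = \int[mu]_(y in `]a - r, a + r[) `|g y|.
  rewrite [RHS]Rintegral_mkcond; congr Rintegral.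
  apply/funext => y; rewrite /ib indicE patchE.
  by case: (_ \in _); rewrite ?mul1r ?mul0r.
rewrite -E2 -E3 -!RintegralZl// -RintegralB//; last exact: in_L1Z.
have i4 : in_L1 (fun y => ramp a r y * g y - Z * (ia y * g y)).
  by apply: in_L1B => //; exact: in_L1Z.
apply: le_trans (le_normr_Rintegral _ i4) _ => //.
apply: le_Rintegral => //.
- exact: in_L1_norm.
- exact: in_L1Z.
move=> y _; have -> : ramp a r y * g y - Z * (ia y * g y) = (ramp a r y - Z * ia y) * g y.
  by ring.
rewrite normrM mulrA ler_wpM2r//.
have /andP[y1 y2] := ramp01 y.
rewrite /ia /ib !indicE; case: (boolP (y \in `]a - r, a + r[%classic)) => yI.
  rewrite mulr1; case: (_ \in _); rewrite ?mulr1 ?mulr0 ler_norml; apply/andP; split; lra.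
rewrite mulr0 normr_le0 subr_eq0; apply/eqP.
case: (boolP (y \in `]a, +oo[%classic)) => [/set_mem|/negP] ya; rewrite ?mulr1 ?mulr0.
  apply: step_right; rewrite ler_pdivlMl// mulr1 leNgt; apply/negP => yr.
  move/negP: yI; apply; rewrite inE /= in_itv /=; move: ya; rewrite /= in_itv /= andbT => ya.
  by apply/andP; split; lra.
apply: step_left; rewrite ler_pdivrMl// mulrN1 leNgt; apply/negP => yr.
have ya' : y <= a by rewrite leNgt; apply/negP => ay; apply: ya; rewrite inE /= in_itv /= ay.
by move/negP: yI; apply; rewrite inE /= in_itv /=; apply/andP; split; lra.
Qed.

Lemma ramp_cvg g a e : in_L1 g -> 0 < e ->
  exists2 d, 0 < d & forall r, 0 < r < d ->
    `|\int[mu]_y (ramp a r y * g y) - Z * (\int[mu]_y g y - prim g a)| <= e.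
Proof.
move=> gi e0; have Z0 := @step1_gt0 R; have eZ : 0 < e / Z by rewrite divr_gt0.
have [d [d0 Hd]] := integral_normr_continuous gi eZ.
exists (d / 2); first by rewrite divr_gt0.
move=> r /andP[r0 rd]; apply: le_trans (ramp_approx _ r0 gi) _.
rewrite -ler_pdivlMl// mulrC; apply: ltW; apply: Hd => //.
rewrite /= lebesgue_measure_itv /= lte_fin.
have -> : a - r < a + r by lra.
by rewrite -EFinD lte_fin; lra.
Qed.

Let ramp_test a b r : a < b -> 0 < r ->
  test_function (fun y => ramp a r y - ramp b r y).
Proof.
move=> ab r0; split.
  have := smooth_family_smooth (sf_add (sf_affine 1 r^-1 a (@sf_step R))
    (sf_affine (-1) r^-1 b (@sf_step R))).
  by under eq_fun do rewrite mul1r mulN1r.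
exists (`|a| + `|b| + r) => x; rewrite ltr_normr => /orP[] xM.
  have := ler_norm a; have := ler_norm b; have := normr_ge0 a; have := normr_ge0 b => h1 h2 h3 h4.
  rewrite /ramp !step_right ?subrr// ler_pdivlMl// mulr1; lra.
have := ler_norm (- a); have := ler_norm (- b); rewrite !normrN.
have := normr_ge0 a; have := normr_ge0 b => h1 h2 h3 h4.
rewrite /ramp !step_left ?subrr// ler_pdivrMl// mulrN1; lra.
Qed.

(** Testing the weak derivative against a plateau with steep sides at two
    Lebesgue points turns it into the fundamental theorem of calculus. *)
Lemma weak_derivative_increment f g a b : in_L1 f -> in_L1 g ->
  weak_derivative f g -> lebesgue_pt f a -> lebesgue_pt f b -> a < b ->
  f b - f a = prim g b - prim g a.
Proof.
move=> fi gi [_ _ fg] fa fb ab; have Z0 := @step1_gt0 R.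
apply/eqP; rewrite -subr_eq0; apply/eqP.
suff : Z * (f b - f a - (prim g b - prim g a)) = 0.
  by move/eqP; rewrite mulf_eq0 (gt_eqF Z0) => /eqP.
apply/eqP; rewrite -normr_le0; apply/ler_addgt0Pr => e e0; rewrite add0r.
have e40 : 0 < e / 4 by rewrite divr_gt0.
have [d1 d10 H1] := kernel_cvg fi fa e40.
have [d2 d20 H2] := kernel_cvg fi fb e40.
have [d3 d30 H3] := ramp_cvg a gi e40.
have [d4 d40 H4] := ramp_cvg b gi e40.
pose D := Num.min (Num.min d1 d2) (Num.min d3 d4).
have D0 : 0 < D by rewrite !lt_min d10 d20 d30.
pose r := D / 2.
have r0 : 0 < r by rewrite divr_gt0.
have : r < D by exact: half_lt.
rewrite !lt_min => /andP[/andP[r1 r2] /andP[r3 r4]].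
have {}H1 := H1 r; rewrite r0 r1 in H1; move: (H1 isT) => {}H1.
have {}H2 := H2 r; rewrite r0 r2 in H2; move: (H2 isT) => {}H2.
have {}H3 := H3 r; rewrite r0 r3 in H3; move: (H3 isT) => {}H3.
have {}H4 := H4 r; rewrite r0 r4 in H4; move: (H4 isT) => {}H4.
have test := fg _ (ramp_test ab r0).
have L : \int[mu]_x (f x * derive1 (fun y => ramp a r y - ramp b r y) x) =
    \int[mu]_x (kernel a r x * f x) - \int[mu]_x (kernel b r x * f x).
  rewrite -RintegralB//; try exact: kernel_mul_L1.
  apply: eq_Rintegral => x _.
  by rewrite (derivE (derivB (ramp_deriv a r x) (ramp_deriv b r x))); ring.
have rL1 c : in_L1 (fun x => ramp c r x * g x).
  apply: (in_L1_bounded_mul (c := Z)) => //.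
    by apply: continuous_measurable_fun; exact: ramp_continuous.
  apply: aeW => y; have /andP[y1 y2] := step_bounds (r^-1 * (y - c)).
  by rewrite ger0_norm.
have M : \int[mu]_x (g x * (ramp a r x - ramp b r x)) =
    \int[mu]_x (ramp a r x * g x) - \int[mu]_x (ramp b r x * g x).
  rewrite -RintegralB//; try exact: rL1.
  by apply: eq_Rintegral => x _; ring.
rewrite L M in test; have {}test := canRL (subrK _) test.
move: test H1 H2 H3 H4.
move: (\int[mu]_x (kernel a r x * f x)) (\int[mu]_x (kernel b r x * f x)) => i1 i2.
move: (\int[mu]_x (ramp a r x * g x)) (\int[mu]_x (ramp b r x * g x)) => i3 i4.
move: (\int[mu]_y g y) => G -> h1 h2 h3 h4.
have -> : Z * (f b - f a - (prim g b - prim g a)) =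
    (- (i3 - i4) + i2 - Z * f a) - (i2 - Z * f b)
    + ((i3 - Z * (G - prim g a)) - (i4 - Z * (G - prim g b))) by ring.
have -> : e = (e / 4 + e / 4) + (e / 4 + e / 4) by field.
apply: le_trans (ler_normD _ _) _; apply: lerD;
  by apply: le_trans (ler_normB _ _) _; apply: lerD.
Qed.

(** Almost every point is a Lebesgue point, so [f] is a primitive of [g] up to a
    constant, and integrability of [f] removes both the constant and the limit of the
    primitive at infinity. *)
Lemma weak_derivative_prim f g : in_L1 f -> in_L1 g -> weak_derivative f g ->
  {ae mu, forall x, f x = prim g x} /\ \int[mu]_x g x = 0.
Proof.
move=> fi gi fg; have [lf _ _] := fg.
have leb_pts := lebesgue_differentiation lf.
have [c Hc] : exists c, {ae mu, forall x, f x = c + prim g x}.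
  have [[a0 Ha0]|no] := pselect (exists a, lebesgue_pt f a); last first.
    exists 0; apply: (aeS leb_pts) => x fx; exfalso; apply: no; by exists x.
  exists (f a0 - prim g a0); apply: (aeS leb_pts) => x fx.
  have [xa|ax|->] := ltgtP x a0; last by rewrite subrK.
    by have := weak_derivative_increment fi gi fg fx Ha0 xa; lra.
  by have := weak_derivative_increment fi gi fg Ha0 fx ax; lra.
have [c0 g0] := L1_prim_const fi gi Hc; split => //.
by apply: (aeS Hc) => x ->; rewrite c0 add0r.
Qed.

End WeakDerivative.

(** * Convolution estimates *)

Section Convolution.
Context {R : realType}.
Local Notation mu := (@lebesgue_measure R).
Implicit Types (f g V Vx : R -> R) (x y z h c K S : R).

Lemma measurable_reflection f c : measurable_fun setT f ->
  measurable_fun setT (fun y => f (c - y)).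
Proof.
move=> mf; apply: measurableT_comp => //.
apply: continuous_measurable_fun; apply: contD; first exact: cont_cst.
by apply: contN => y; exact: cvg_id.
Qed.

Lemma in_L1_reflection f c : in_L1 f -> in_L1 (fun y => f (c - y)).
Proof.
move=> fi; have mf := in_L1_measurable fi; apply/integrableP; split.
  by apply/measurable_EFinP; exact: measurable_reflection.
rewrite (ge0_integral_reflection c (f := fun y => (`|f y|)%:E)) => //.
  by move/integrableP : fi => [].
by apply/measurable_EFinP; exact: measurableT_comp.
Qed.

Lemma Rintegral_norm_reflection f c : in_L1 f ->
  \int[mu]_y `|f (c - y)| = \int[mu]_y `|f y|.
Proof.
move=> fi; have mf := in_L1_measurable fi; rewrite /Rintegral; congr fine.
apply: (ge0_integral_reflection c (f := fun y => (`|f y|)%:E)) => //.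
by apply/measurable_EFinP; exact: measurableT_comp.
Qed.

Lemma convolution_L1 V f c x : in_L1 f -> measurable_fun setT V ->
  {ae mu, forall z, `|V z| <= c} -> in_L1 (fun y => V (x - y) * f y).
Proof.
move=> fi mV Vc; apply: (in_L1_bounded_mul (c := c)) => //.
  exact: measurable_reflection.
exact: (ae_reflection x Vc).
Qed.

Lemma convolution_norm_le V f c x : in_L1 f -> measurable_fun setT V ->
  {ae mu, forall z, `|V z| <= c} ->
  `|convolution V f x| <= c * \int[mu]_y `|f y|.
Proof.
move=> fi mV Vc; have Vfi := convolution_L1 x fi mV Vc.
apply: (le_trans (le_normr_Rintegral _ Vfi)) => //.
rewrite -RintegralZl//; last exact: in_L1_norm.
apply: ae_Rintegral_le; [exact: in_L1_norm|exact/in_L1Z/in_L1_norm|].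
by apply: (aeS (ae_reflection x Vc)) => y yc; rewrite normrM ler_wpM2r.
Qed.

Lemma convolution_sup_le V f c K x : in_L1 f -> in_L1 V ->
  {ae mu, forall z, `|V z| <= c} -> {ae mu, forall y, `|f y| <= K} ->
  `|convolution V f x| <= (\int[mu]_y `|V y|) * K.
Proof.
move=> fi Vi Vc fK; have Vfi := convolution_L1 x fi (in_L1_measurable Vi) Vc.
apply: (le_trans (le_normr_Rintegral _ Vfi)) => //.
have Vx := in_L1_norm (in_L1_reflection x Vi).
rewrite mulrC -(Rintegral_norm_reflection x Vi) -RintegralZl//.
apply: ae_Rintegral_le; [exact: in_L1_norm|exact: in_L1Z|].
by apply: (aeS fK) => y yc; rewrite normrM mulrC ler_wpM2r.
Qed.

Lemma tonelli_set (E : set (R * R)) f g : measurable E ->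
  measurable_fun setT f -> measurable_fun setT g ->
  (forall y, 0 <= f y) -> (forall z, 0 <= g z) ->
  (\int[mu]_y \int[mu]_z (f y * g z * \1_E (y, z))%:E =
   \int[mu]_z \int[mu]_y (f y * g z * \1_E (y, z))%:E)%E.
Proof.
move=> mE mf mg f0 g0.
pose F (p : R * R) := (f p.1 * g p.2 * \1_E p)%:E.
apply: (@fubini_tonelli _ _ _ _ R mu mu F).
- apply/measurable_EFinP; apply: measurable_funM.
    apply: measurable_funM.
      exact: measurableT_comp mf measurable_fst.
    exact: measurableT_comp mg measurable_snd.
  exact: measurable_indic.
- by move=> p; rewrite /F lee_fin !mulr_ge0.
Qed.

Lemma Rintegral_indic_mul (D : set R) g : measurable D ->
  \int[mu]_z (g z * \1_D z) = \int[mu]_(z in D) g z.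
Proof.
move=> mD; rewrite [RHS]Rintegral_mkcond; congr Rintegral.
by apply/funext => z; rewrite indicE patchE; case: (_ \in _); rewrite ?mulr1 ?mulr0.
Qed.

Lemma in_L1_indic_mul (D : set R) g : measurable D -> in_L1 g ->
  in_L1 (fun z => g z * \1_D z).
Proof.
move=> mD gi; have -> : (fun z => g z * \1_D z) = (fun z => (\1_D z : R) * g z).
  by apply/funext => z; exact: mulrC.
have mI : measurable_fun setT (\1_D : R -> R) by exact: measurable_indic.
apply: (in_L1_bounded_mul (g := \1_D) (c := 1)) => //.
by apply: aeW => z; rewrite indicE; case: (_ \in _); rewrite ?normr1 ?normr0.
Qed.

Lemma EFin_Rintegral g : in_L1 g ->
  ((\int[mu]_z g z)%:E = \int[mu]_z (g z)%:E)%E.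
Proof. by move=> gi; rewrite /Rintegral fineK//; exact: integrable_fin_num gi. Qed.

Lemma slice_integral g c (a b : R) : in_L1 g -> a <= b ->
  (\int[mu]_z (c * (g z * \1_(`]a, b]%classic) z))%:E =
   (c * (prim g b - prim g a))%:E)%E.
Proof.
move=> gi ab.
have gin : in_L1 (fun z => g z * \1_(`]a, b]%classic) z) by exact: in_L1_indic_mul.
rewrite primB// -Rintegral_indic_mul// -RintegralZl// EFin_Rintegral//.
exact: in_L1Z.
Qed.

Lemma ae_prim f g x : in_L1 f -> in_L1 g -> {ae mu, forall x, f x = g x} ->
  prim f x = prim g x.
Proof.
move=> fi gi fg; apply/eqP; rewrite -subr_eq0 -normr_le0.
apply: le_trans (prim_dist x fi gi) _.
have c0 : \int[mu]_(y in setT) (fun=> 0 : R) y = 0 by rewrite Rintegral_cst// mul0r.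
rewrite -[leRHS]c0; apply: ae_Rintegral_le.
- exact/in_L1_norm/in_L1B.
- by have := in_L1Z 0 fi; congr in_L1; apply/funext => y; rewrite mul0r.
- by apply: (aeS fg) => y ->; rewrite subrr normr0.
Qed.

(** |V (x + h - y) - V (x - y)| is at most the integral of |Vx| over an interval of
    length [h]. Exchanging the order of integration, the mass of [f] over a reflected
    interval of the same length appears, which is an increment of its primitive. *)
Lemma convolution_osc V Vx f S x h : in_L1 f -> in_L1 V -> in_L1 Vx ->
  {ae mu, forall z, V z = prim Vx z} -> {ae mu, forall y, 0 <= f y} ->
  0 <= h -> (forall z, prim f (z + h) - prim f z <= S) ->
  `|convolution V f (x + h) - convolution V f x| <= (\int[mu]_z `|Vx z|) * S.
Proof.
move=> fi Vi Vxi VE f0 h0 spread.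
have Vc : {ae mu, forall z, `|V z| <= \int[mu]_z `|Vx z|}.
  by apply: (aeS VE) => z ->; exact: prim_norm_le.
have mV := in_L1_measurable Vi.
have i1 := convolution_L1 (x + h) fi mV Vc; have i2 := convolution_L1 x fi mV Vc.
have nfi := in_L1_norm fi; have nVi := in_L1_norm Vxi.
have mnf := in_L1_measurable nfi; have mnV := in_L1_measurable nVi.
rewrite /convolution -RintegralB//.
have i3 := in_L1B i1 i2.
apply: (le_trans (le_normr_Rintegral _ i3)) => //.
have i4 := in_L1_norm i3.
pose E : set (R * R) := (fun p : R * R => p.1 + p.2) @^-1` `]x, x + h]%classic.
have mE : measurable E.
  have ms : measurable_fun [set: R * R] (fun p : R * R => p.1 + p.2).
    by apply: measurable_funD; [exact: measurable_fst|exact: measurable_snd].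
  by rewrite -[E]setTI; exact: ms.
have indE (y z : R) : (\1_E (y, z) : R) = \1_(`]x - y, x + h - y]%classic) z.
  rewrite !indicE; congr ((_ : bool)%:R); apply/idP/idP; rewrite !inE /E /= !in_itv /=;
  by move=> /andP[? ?]; apply/andP; split; lra.
have indE' (y z : R) : (\1_E (y, z) : R) = \1_(`]x - z, x + h - z]%classic) y.
  rewrite !indicE; congr ((_ : bool)%:R); apply/idP/idP; rewrite !inE /E /= !in_itv /=;
  by move=> /andP[? ?]; apply/andP; split; lra.
have ord (y : R) : x - y <= x + h - y by lra.
pose F (y z : R) := `|f y| * `|Vx z| * \1_E (y, z).
have sliceV (y : R) : (\int[mu]_z (F y z)%:E =
    (`|f y| * (prim (fun z => `|Vx z|) (x + h - y) - prim (fun z => `|Vx z|) (x - y)))%:E)%E.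
  rewrite -(slice_integral _ nVi (ord y)); apply: eq_integral => z _.
  by rewrite /F indE mulrA.
have slicef (z : R) : (\int[mu]_y (F y z)%:E =
    (`|Vx z| * (prim f (x + h - z) - prim f (x - z)))%:E)%E.
  have nff (w : R) : prim (fun y => `|f y|) w = prim f w.
    by apply: ae_prim => //; apply: (aeS f0) => y y0; rewrite ger0_norm.
  rewrite -!nff -(slice_integral _ nfi (ord z)); apply: eq_integral => y _.
  by rewrite /F indE' mulrCA mulrA.
rewrite -lee_fin EFin_Rintegral//.
apply: (@le_trans _ _ (\int[mu]_y \int[mu]_z (F y z)%:E)%E).
  apply: ae_ge0_le_integral => //.
  - exact: measurable_int i4.
  - move=> y _; apply: integral_ge0 => z _.
    by rewrite lee_fin /F !mulr_ge0.
  - have -> : (fun y => \int[mu]_z (F y z)%:E)%E = EFin \o (fun y => `|f y| *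
       (prim (fun z => `|Vx z|) (x + h - y) - prim (fun z => `|Vx z|) (x - y))).
      by apply/funext => y; exact: sliceV.
    apply/measurable_EFinP; apply: measurable_funM => //.
    by apply: measurable_funB; apply: measurable_reflection;
      apply: continuous_measurable_fun; exact: prim_continuous.
  - apply: (aeS2 (ae_reflection (x + h) VE) (ae_reflection x VE)) => y E1 E2 _.
    rewrite sliceV lee_fin E1 E2 -mulrBl normrM mulrC ler_wpM2l//.
    rewrite !primB//; apply: le_normr_Rintegral => //.
    exact: in_L1S.
rewrite (tonelli_set mE mnf mnV)//.
rewrite mulrC -RintegralZl// EFin_Rintegral; last exact: in_L1Z.
apply: ge0_le_integral => //.
- by move=> z _; apply: integral_ge0 => y _; rewrite lee_fin /F !mulr_ge0.
- have -> : (fun z => \int[mu]_y (F y z)%:E)%E = EFin \o (fun z => `|Vx z| *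
     (prim f (x + h - z) - prim f (x - z))).
    by apply/funext => z; exact: slicef.
  apply/measurable_EFinP; apply: measurable_funM => //.
  by apply: measurable_funB; apply: measurable_reflection;
    apply: continuous_measurable_fun; exact: prim_continuous.
- by apply/measurable_EFinP; exact: measurable_funM.
- move=> z _; rewrite slicef lee_fin mulrC ler_wpM2r//.
  by have := spread (x - z); rewrite addrAC.
Qed.

Lemma convolution_sg f x : in_L1 f ->
  in_L1 (fun y => Num.sg (x - y) * f y) /\
  convolution Num.sg f x = 2 * prim f x - \int[mu]_y f y.
Proof.
move=> fi.
have sgE : (fun y => Num.sg (x - y) * f y) =
    (fun y => f y * \1_(`]-oo, x[%classic) y - f y * \1_(`]x, +oo[%classic) y).
  apply/funext => y; rewrite !indicE.
  have -> : (y \in `]-oo, x[%classic) = (y < x).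
    by apply/idP/idP; rewrite inE /= in_itv.
  have -> : (y \in `]x, +oo[%classic) = (x < y).
    by apply/idP/idP; rewrite inE /= in_itv /= andbT.
  by case: (ltgtP y x) => [yx|xy|->]; rewrite ?subrr ?sgr0 ?mul0r ?mulr0 ?mulr1 ?subr0 ?sub0r//;
    [rewrite gtr0_sg ?mul1r// subr_gt0|rewrite ltr0_sg ?mulN1r// subr_lt0].
have i1 : in_L1 (fun y => f y * \1_(`]-oo, x[%classic) y) by exact: in_L1_indic_mul.
have i2 : in_L1 (fun y => f y * \1_(`]x, +oo[%classic) y) by exact: in_L1_indic_mul.
split; first by rewrite sgE; exact: in_L1B.
rewrite /convolution sgE RintegralB// !Rintegral_indic_mul// -prim_compl//.
rewrite Rintegral_itv_bndo_bndc; last exact: in_L1S.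
by rewrite -/(prim f x); ring.
Qed.

End Convolution.

(** * Time regularity with values in L1 *)

Section Regularity.
Context {R : realType}.
Local Notation mu := (@lebesgue_measure R).
Implicit Types (f g : R -> R) (t s x y z h c e : R).

Lemma cont_L1_dist (D : set R) (w : R -> R -> R) t e : cont_L1 D w -> D t -> 0 < e ->
  exists2 d, 0 < d & forall s, D s -> `|s - t| < d ->
    \int[mu]_x `|w s x - w t x| <= e.
Proof.
move=> cw Dt e0; have [wt H] := cw t Dt.
have : \forall s \near within D (nbhs t), (Lpnorm 1 (w s \- w t)%R < e%:E)%E.
  have : nbhs (0%E : \bar R) [set z | (z < e%:E)%E].
    by apply: open_nbhs_nbhs; split; [exact: open_ereal_lt_ereal|rewrite /= lte_fin].
  exact: H.
rewrite near_withinE => /nbhs_ballP[d /= d0 Hd].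
exists d => // s Ds sd; have [ws _] := cw s Ds.
have := Hd s; rewrite /ball /= distrC => /(_ sd Ds).
by rewrite Lpnorm1E ?lte_fin; [exact: ltW|exact: in_L1B].
Qed.

Lemma cont1_L1_increment (w wt : R -> R -> R) t e : cont1_L1 `]0, +oo[ w wt ->
  0 < t -> 0 < e -> exists2 d, 0 < d & forall h, `|h| < d ->
    in_L1 (w (t + h)) /\
    \int[mu]_x `|w (t + h) x - w t x - h * wt t x| <= e * `|h|.
Proof.
move=> [cw cwt H] t0 e0.
have Dpos s : 0 < s -> `]0, +oo[%classic s by move=> s0; rewrite /= in_itv /= s0.
have nb : nbhs (0%E : \bar R) [set z | (z < e%:E)%E].
  by apply: open_nbhs_nbhs; split; [exact: open_ereal_lt_ereal|rewrite /= lte_fin].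
have : nbhs (0 : R) (fun h => h != 0 ->
    (Lpnorm 1 (fun x => h^-1 * (w (t + h) x - w t x) - wt t x)%R < e%:E)%E).
  exact: H t (Dpos t t0) _ nb.
move=> /nbhs_ballP[d /= d0 Hd].
have m0 : 0 < Num.min d t by rewrite lt_min d0.
exists (Num.min d t) => // h; rewrite lt_min => /andP[hd ht].
have th0 : 0 < t + h by have /ltr_normlP[] := ht; lra.
have [wth _] := cw _ (Dpos _ th0); have [wt0 _] := cw _ (Dpos _ t0).
have [wtt _] := cwt _ (Dpos _ t0).
split => //; have [->|hn0] := eqVneq h 0.
  rewrite normr0 mulr0 addr0.
  have -> : (fun x => `|w t x - w t x - 0 * wt t x|) = (fun=> 0).
    by apply/funext => x; rewrite subrr mul0r subr0 normr0.
  by rewrite Rintegral_cst// mul0r.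
have := Hd h; rewrite /ball /= sub0r normrN => /(_ hd hn0).
have Li : in_L1 (fun x => h^-1 * (w (t + h) x - w t x) - wt t x).
  by apply: in_L1B => //; apply: in_L1Z; exact: in_L1B.
rewrite Lpnorm1E// lte_fin => /ltW H1.
have -> : (fun x => `|w (t + h) x - w t x - h * wt t x|) =
    (fun x => `|h| * `|h^-1 * (w (t + h) x - w t x) - wt t x|).
  by apply/funext => x; rewrite -normrM; congr `|_|; field.
by rewrite RintegralZl//; [rewrite mulrC ler_wpM2r|exact: in_L1_norm].
Qed.

Lemma in_L1_ae f g : in_L1 f -> measurable_fun setT g ->
  {ae mu, forall x, f x = g x} -> in_L1 g.
Proof.
move=> fi mg fg; apply/integrableP; split; first exact/measurable_EFinP.
have mf := in_L1_measurable fi; have nfi := in_L1_norm fi.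
have -> : (\int[mu]_x `|(EFin \o g) x| = \int[mu]_x (`|f x|)%:E)%E.
  apply: ae_eq_integral => //.
  - by apply/measurable_EFinP; exact: measurableT_comp.
  - exact: measurable_int nfi.
  - by apply: (aeS fg) => x -> _.
by move/integrableP : fi => [].
Qed.

End Regularity.

(** * From weak to classical solutions *)

Section ClassicalSolution.
Context {R : realType}.
Local Notation mu := (@lebesgue_measure R).
Implicit Types (t s x y z h c e K : R).

Lemma increment_le_of_slope (F g : R -> R) K z h :
  (forall x, is_derive x 1 F (g x)) -> (forall x, g x <= K) -> 0 <= h ->
  F (z + h) - F z <= K * h.
Proof.
move=> dF gK h0.
have dp (y : R) : is_derive y 1 (fun y => K * y - F y) (K - g y).
  by have := derivB (derivZ K (deriv_id y)) (dF y); rewrite mulr1.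
have : K * z - F z <= K * (z + h) - F (z + h).
  apply: (deriv_ge0_le _ (fun y _ => dp y)); first by rewrite lerDl.
    by move=> y _; rewrite subr_ge0.
  by apply: derivable_within_continuous => y _; case: (dp y).
by rewrite mulrDr; lra.
Qed.

Variables (A eps : R) (V Vx : R -> R) (u ux ut : R -> R -> R).
Hypotheses (A0 : 0 < A) (eps0 : 0 < eps).
Hypothesis VW : in_W11 V Vx.
Hypothesis cu : cont_L1 `[0, +oo[ u.
Hypothesis cux : cont_W11 `]0, +oo[ u ux.
Hypothesis cut : cont1_L1 `]0, +oo[ u ut.
Hypothesis flux_ut : forall t, 0 < t -> weak_derivative
  (fun x => eps * ux t x + u t x * convolution (interaction_kernel A V) (u t) x) (ut t).
Hypothesis u_pos : forall t, 0 <= t -> {ae mu, forall x, 0 <= u t x}.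
Hypothesis mass0 : \int[mu]_x u 0 x = 1.

Let lam := \int[mu]_z `|Vx z|.
Let U := centered_primitive u.
Let Du t := prim (ux t).
Let v t := convolution V (u t).
(* The equation solved for U_xx, with prim (ut t) in place of U_t. It is continuous by
   construction and turns out to be a representative of u_x. *)
Let w t x := (prim (ut t) x - Du t x * (- A * U t x + v t x)) / eps.

Let UE t x : U t x = prim (u t) x - 2^-1. Proof. by []. Qed.

Let V_L1 : in_L1 V. Proof. by case: VW. Qed.
Let Vx_L1 : in_L1 Vx. Proof. by case: VW. Qed.
Let V_prim : {ae mu, forall z, V z = prim Vx z}.
Proof. by case: VW => ? ? /weak_derivative_prim[]. Qed.
Let V_bound : {ae mu, forall z, `|V z| <= lam}.
Proof. by apply: (aeS V_prim) => z ->; exact: prim_norm_le. Qed.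
Let lam0 : 0 <= lam. Proof. exact: Rintegral_ge0. Qed.

Let u_L1 t : 0 <= t -> in_L1 (u t).
Proof. by move=> t0; have [] := cu (t := t); rewrite /= ?in_itv /= ?t0. Qed.

Let pos_itv t : 0 < t -> `]0, +oo[%classic t.
Proof. by move=> t0; rewrite /= in_itv /= t0. Qed.

Let ux_L1 t : 0 < t -> in_L1 (ux t).
Proof. by move=> t0; case: cux => H _ _; case: (H _ (pos_itv t0)). Qed.

Let ut_L1 t : 0 < t -> in_L1 (ut t).
Proof. by move=> t0; case: cut => _ H _; case: (H _ (pos_itv t0)). Qed.

Let u_Du t : 0 < t -> {ae mu, forall x, u t x = Du t x}.
Proof.
move=> t0; case: cux => H _ _; have [ui uxi W] := H _ (pos_itv t0).
by have [] := weak_derivative_prim ui uxi W.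
Qed.

Let Du_cont t : 0 < t -> continuous (Du t).
Proof. by move=> t0; exact: prim_continuous (ux_L1 t0). Qed.

Let Du_L1 t : 0 < t -> in_L1 (Du t).
Proof.
move=> t0; apply: (in_L1_ae (u_L1 (ltW t0)) _ (u_Du t0)).
by apply: continuous_measurable_fun; exact: Du_cont.
Qed.

Let prim_u_deriv t x : 0 < t -> is_derive x 1 (prim (u t)) (Du t x).
Proof.
move=> t0; have -> : prim (u t) = prim (Du t).
  by apply/funext => y; exact: ae_prim (u_L1 (ltW t0)) (Du_L1 t0) (u_Du t0).
exact: prim_deriv (Du_L1 t0) (@Du_cont t t0).
Qed.

Let Du_le t x : 0 < t -> Du t x <= \int[mu]_y `|ux t y|.
Proof. by move=> t0; apply: le_trans (ler_norm _) (prim_norm_le x (ux_L1 t0)). Qed.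

Let v_osc t h K x : 0 <= t -> 0 <= h ->
  (forall z, prim (u t) (z + h) - prim (u t) z <= K) ->
  `|v t (x + h) - v t x| <= lam * K.
Proof.
move=> t0 h0; exact: convolution_osc (u_L1 t0) V_L1 Vx_L1 V_prim (u_pos t0) h0.
Qed.

Let v_cont t : 0 < t -> continuous (v t).
Proof.
move=> t0 x; set K := \int[mu]_y `|ux t y|.
have K0 : 0 <= K by exact: Rintegral_ge0.
have osc y h : 0 <= h -> `|v t (y + h) - v t y| <= lam * (K * h).
  move=> h0; apply: v_osc => //; first exact: ltW.
  move=> z; apply: increment_le_of_slope h0; first by move=> y'; exact: prim_u_deriv.
  by move=> y'; exact: Du_le.
apply/cvgrPdist_le => e e0.
have L0 : 0 < lam * K + 1 by rewrite ltr_wpDl// mulr_ge0.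
apply/nbhs_ballP; exists (e / (lam * K + 1)) => /=; first by rewrite divr_gt0.
move=> y; rewrite /ball /= => xy.
have main h : 0 <= h -> h < e / (lam * K + 1) -> lam * (K * h) <= e.
  move=> h0; rewrite ltr_pdivlMr// => he; rewrite mulrA.
  by apply: le_trans (ltW he); rewrite mulrC ler_wpM2l// lerDl.
have [xley|yltx] := leP x y.
  have h0 : 0 <= y - x by rewrite subr_ge0.
  have := osc x _ h0; rewrite (addrC x) subrK distrC => /le_trans; apply.
  by apply: main => //; rewrite -(ger0_norm h0) distrC.
have h0 : 0 <= x - y by rewrite subr_ge0 ltW.
have := osc y _ h0; rewrite (addrC y) subrK => /le_trans; apply.
by apply: main => //; rewrite -(ger0_norm h0).
Qed.

Let kernel_conv t x : 0 <= t ->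
  convolution (interaction_kernel A V) (u t) x =
  - A * (prim (u t) x - (\int[mu]_y u t y) / 2) + v t x.
Proof.
move=> t0; have [sgi sgE] := convolution_sg x (u_L1 t0).
have Vi := convolution_L1 x (u_L1 t0) (in_L1_measurable V_L1) V_bound.
have -> : convolution (interaction_kernel A V) (u t) x =
    \int[mu]_y (- (A / 2) * (Num.sg (x - y) * u t y) + V (x - y) * u t y).
  by apply: eq_Rintegral => y _; rewrite /interaction_kernel; ring.
rewrite RintegralD//; last exact: in_L1Z.
rewrite RintegralZl// -/(convolution Num.sg (u t) x) sgE -/(v t x).
by congr (_ + _); field.
Qed.

Let flux_L1 t : 0 < t -> in_L1 (fun x =>
  eps * ux t x + u t x * convolution (interaction_kernel A V) (u t) x).
Proof.
move=> t0; have t00 := ltW t0; have ui := u_L1 t00.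
set m := \int[mu]_y u t y; set n := \int[mu]_y `|u t y|.
have -> : (fun x => eps * ux t x + u t x * convolution (interaction_kernel A V) (u t) x)
   = (fun x => eps * ux t x + (- A * (prim (u t) x - m / 2) + v t x) * u t x).
  by apply/funext => x; rewrite kernel_conv// (mulrC (u t x)).
apply: in_L1D; first by apply: in_L1Z; exact: ux_L1.
apply: (in_L1_bounded_mul (c := A * (n + `|m / 2|) + lam * n)) => //.
  apply: continuous_measurable_fun; apply: contD; last exact: v_cont.
  apply: contM; first exact: cont_cst.
  by apply: contD; [exact: prim_continuous|exact: cont_cst].
apply: aeW => x; apply: le_trans (ler_normD _ _) _; apply: lerD.
  rewrite normrM normrN (gtr0_norm A0) ler_wpM2l ?(ltW A0)//.
  by apply: le_trans (ler_normB _ _) _; rewrite lerD2r; exact: prim_norm_le.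
exact: convolution_norm_le (in_L1_measurable V_L1) V_bound.
Qed.

Let flux_prim t : 0 < t -> {ae mu, forall x,
  eps * ux t x + u t x * convolution (interaction_kernel A V) (u t) x = prim (ut t) x}
  /\ \int[mu]_x ut t x = 0.
Proof. by move=> t0; exact: weak_derivative_prim (flux_L1 t0) (ut_L1 t0) (flux_ut t0). Qed.

Let Rint_dist (f g : R -> R) : in_L1 f -> in_L1 g ->
  `|\int[mu]_x f x - \int[mu]_x g x| <= \int[mu]_x `|f x - g x|.
Proof.
move=> fi gi; rewrite -RintegralB//.
exact: (le_normr_Rintegral measurableT (in_L1B fi gi)).
Qed.

(** The flux is integrable with an integrable derivative, so [u_t] has zero mean
    and the mass is conserved. *)
Lemma mass_conservation t : 0 <= t -> \int[mu]_x u t x = 1.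
Proof.
pose m t := \int[mu]_x u t x.
have dm s : 0 < s -> is_derive s 1 m 0.
  move=> s0.
  have L : (fun h => h^-1 *: (m (h *: 1 + s) - m s)) @ 0^' --> (0 : R).
    apply/cvgrPdist_le => e e0.
    have [d d0 Hd] := cont1_L1_increment cut s0 e0.
    rewrite near_withinE; apply/nbhs_ballP; exists d => // h.
    rewrite /ball /= sub0r normrN => hd hn0; have [ush Hh] := Hd h hd.
    rewrite sub0r normrN normrM normfV ler_pdivrMl ?normr_gt0// mulrC.
    rewrite [h *: 1]mulr1 (addrC h); apply: le_trans Hh.
    have us := u_L1 (ltW s0); have uts := ut_L1 s0.
    have i2 : in_L1 (fun x => u (s + h) x - u s x) by exact: in_L1B.
    have i3 : in_L1 (fun x => h * ut s x) by exact: in_L1Z.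
    have -> : m (s + h) - m s = \int[mu]_x (u (s + h) x - u s x) - \int[mu]_x (h * ut s x).
      by rewrite RintegralB// RintegralZl// (flux_prim s0).2 mulr0 subr0.
    exact: Rint_dist.
  by split; [apply/cvg_ex; exists 0|exact: cvg_lim L].
have cm T : {within `[0, T], continuous m}.
  apply: within_continuous_near => s /andP[s0 sT] e e0.
  have s0' : `[0, +oo[%classic s by rewrite /= in_itv /= s0.
  have [d d0 Hd] := cont_L1_dist cu s0' e0; exists d => // r /andP[r0 rT] rs.
  have r0' : `[0, +oo[%classic r by rewrite /= in_itv /= r0.
  by apply: le_trans (Rint_dist (u_L1 r0) (u_L1 s0)) (Hd r r0' rs).
move=> t0; have m0 : m 0 = 1 by exact: mass0.
have dNm s : 0 < s < t -> is_derive s 1 (fun s => - m s) 0.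
  by move=> /andP[s0 _]; have := derivN (dm s s0); rewrite oppr0.
have dm' s : 0 < s < t -> is_derive s 1 m 0 by move=> /andP[s0 _]; exact: dm.
have le1 : m 0 <= m t by apply: (deriv_ge0_le t0 dm' _ (@cm t)).
have le2 : - m 0 <= - m t.
  apply: (deriv_ge0_le t0 dNm) => // r; apply: continuousN; exact: cm.
by move: le1 le2; rewrite -/(m t) m0; lra.
Qed.

Let abs_mass t : 0 <= t -> \int[mu]_x `|u t x| = 1.
Proof.
by move=> t0; rewrite ae_ge0_Rintegral_norm ?mass_conservation//; [exact: u_L1|exact: u_pos].
Qed.

Let U_cont t : 0 <= t -> continuous (U t).
Proof.
move=> t0; apply: contD; last exact: cont_cst.
exact: prim_continuous (u_L1 t0).
Qed.

Let w_cont t : 0 < t -> continuous (w t).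
Proof.
move=> t0; apply: contM; last exact: cont_cst.
apply: contD; first exact: prim_continuous (ut_L1 t0).
apply: contN; apply: contM; first exact: Du_cont.
apply: contD; last exact: v_cont.
by apply: contM; [exact: cont_cst|apply: U_cont; exact: ltW].
Qed.

Let ux_w t : 0 < t -> {ae mu, forall x, ux t x = w t x}.
Proof.
move=> t0; apply: (aeS2 (u_Du t0) (flux_prim t0).1) => x ux1.
rewrite kernel_conv ?(ltW t0)// mass_conservation ?(ltW t0)// ux1 mul1r -UE => E.
by rewrite /w -E; field; rewrite gt_eqF.
Qed.

Let Du_deriv t x : 0 < t -> is_derive x 1 (Du t) (w t x).
Proof.
move=> t0; have wi : in_L1 (w t).
  apply: (in_L1_ae (ux_L1 t0) _ (ux_w t0)).
  by apply: continuous_measurable_fun; exact: w_cont.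
have -> : Du t = prim (w t).
  by apply/funext => y; exact: ae_prim (ux_L1 t0) wi (ux_w t0).
exact: prim_deriv wi (@w_cont t t0).
Qed.

(** Almost everywhere [u] is [Du], the flux is prim (ut t), and hence u_x is [w]. Being
    continuous representatives, they are classical derivatives of one another. The
    primitive is Lipschitz from L1 to the uniform norm, which transports continuity and
    differentiability in time from [u] to [U]. *)
Lemma solution_viscous_flow : viscous_flow A eps U Du w v.
Proof.
split.
- move=> t x t0; have := prim_le_mass x (u_L1 t0) (u_pos t0).
  by rewrite mass_conservation// UE ler_norml => /andP[p0 p1]; apply/andP; split; lra.
- by move=> t t0; exact: U_cont.
- move=> t t0 e e0; have t0' : `[0, +oo[%classic t by rewrite /= in_itv /= t0.
  have [d d0 Hd] := cont_L1_dist cu t0' e0; exists d => // s s0 st x.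
  have s0' : `[0, +oo[%classic s by rewrite /= in_itv /= s0.
  have -> : U s x - U t x = prim (u s) x - prim (u t) x by rewrite !UE; lra.
  by apply: le_trans (prim_dist x (u_L1 s0) (u_L1 t0)) (Hd s s0' st).
- move=> t x t0; have := derivB (prim_u_deriv x t0) (deriv_cst 2^-1 x).
  by rewrite subr0.
- by move=> t x t0; exact: Du_deriv.
- by move=> t t0; exact: w_cont.
- by move=> t t0; exact: v_cont.
- move=> t x t0; apply/ler_addgt0Pr => e e0.
  have [d d0 Hd] := deriv_left_increment e0 (prim_u_deriv x t0).
  have d20 : 0 < d / 2 by rewrite divr_gt0.
  have := Hd (d / 2); rewrite d20 => /(_ _)/ler_normlP[|_].
    by rewrite andTb; lra.
  have := prim_nondecreasing (u_L1 (ltW t0)) (u_pos (ltW t0)) (_ : x - d / 2 <= x).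
  move=> /(_ _) H1 H2; have {}H1 := H1 _.
  have H3 : prim (u t) (x - d / 2) <= prim (u t) x by apply: H1; lra.
  have : 0 <= d / 2 * (Du t x + e) by lra.
  by rewrite pmulr_rge0.
- by move=> t t0; exists (\int[mu]_y `|ux t y|) => x; exact: Du_le.
- move=> t t0 e e0; have [d d0 Hd] := cont1_L1_increment cut t0 e0.
  exists d => // h hd x; have [uth Hh] := Hd h hd.
  have -> : eps * w t x + Du t x * (- A * U t x + v t x) = prim (ut t) x.
    by rewrite /w; field; rewrite gt_eqF.
  have ui := u_L1 (ltW t0); have uti := ut_L1 t0.
  have i2 : in_L1 (fun x => u (t + h) x - u t x) by exact: in_L1B.
  have i3 : in_L1 (fun x => h * ut t x) by exact: in_L1Z.
  have -> : U (t + h) x - U t x - h * prim (ut t) x =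
      prim (fun x => u (t + h) x - u t x) x - prim (fun x => h * ut t x) x.
    by rewrite prim_sub// primZ// !UE; lra.
  exact: le_trans (prim_dist x i2 i3) Hh.
Qed.

Lemma solution_drift_bounds :
  drift_bounds lam lam (\int[mu]_z `|V z|) U Du v.
Proof.
split.
- move=> t x t0; have := convolution_norm_le x (u_L1 (ltW t0)) (in_L1_measurable V_L1) V_bound.
  by rewrite abs_mass ?(ltW t0)// mulr1.
- move=> t K t0 DK x; apply: convolution_sup_le (u_L1 (ltW t0)) V_L1 V_bound _.
  apply: (aeS2 (u_Du t0) (u_pos (ltW t0))) => y yD y0.
  by rewrite ger0_norm// yD.
- move=> t h S t0 h0 spread x; apply: v_osc => //; first exact: ltW.
  by move=> z; have := spread z; rewrite !UE; lra.
Qed.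

End ClassicalSolution.

(** * The initial data *)

Section InitialData.
Context {R : realType}.
Local Notation mu := (@lebesgue_measure R).
Implicit Types (x y N : R).

Lemma Rintegral_subset_le (f : R -> R) (D : set R) : measurable D -> in_L1 f ->
  (forall x, 0 <= f x) -> \int[mu]_(x in D) f x <= \int[mu]_x f x.
Proof.
move=> mD fi f0; have fD := in_L1S mD fi; rewrite /Rintegral fine_le//.
- exact: integrable_fin_num fD.
- exact: integrable_fin_num fi.
- apply: ge0_subset_integral => //.
  + exact: measurable_int fi.
  + by move=> x _; rewrite lee_fin.
Qed.

Definition heaviside x : R := \1_(`[0, +oo[%classic) x - 2^-1.

Lemma heavisideE x : heaviside x = if x < 0 then - 2^-1 else 2^-1.
Proof.
rewrite /heaviside indicE; have -> : (x \in `[0, +oo[%classic) = (0 <= x).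
  by apply/idP/idP; rewrite inE /= in_itv /= andbT.
by rewrite leNgt; case: (x < 0); rewrite ?sub0r//=; field.
Qed.

Lemma rarefaction_heaviside (A : R) x : 0 < A ->
  `|heaviside x - rarefaction A 1 x| <= 2^-1 * \1_(`[- (A / 2), A / 2]%classic) x.
Proof.
move=> A0; rewrite indicE.
have -> : (x \in `[- (A / 2), A / 2]%classic) = (- (A / 2) <= x <= A / 2).
  by apply/idP/idP; rewrite inE /= in_itv.
rewrite heavisideE; have := rarefaction_cases A 1 x; rewrite mulr1.
case=> -[xx ->].
- have -> : x < 0 by lra.
  by rewrite subrr normr0 mulr_ge0.
- move: xx => /andP[x1 x2]; rewrite (ltW x1) (ltW x2) mulr1 ler_norml.
  have h1 : - 2^-1 <= x / A by rewrite ler_pdivlMr//; lra.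
  have h2 : x / A <= 2^-1 by rewrite ler_pdivrMr//; lra.
  case: ltP => x0.
    have : x / A <= 0 by rewrite ler_pdivrMr//; lra.
    by move=> ?; apply/andP; split; lra.
  have : 0 <= x / A by rewrite ler_pdivlMr//; lra.
  by move=> ?; apply/andP; split; lra.
- have -> : (x < 0) = false by apply/negbTE; rewrite -leNgt; lra.
  by rewrite subrr normr0 mulr_ge0.
Qed.

Variables (A : R) (u0 : R -> R).
Hypotheses (A0 : 0 < A) (ui : in_L1 u0) (u_pos : {ae mu, forall x, 0 <= u0 x}).
Hypothesis (mass : \int[mu]_x u0 x = 1).
Hypothesis (moment : (\int[mu]_x (u0 x * `|x|)%:E < +oo)%E).

Let abs_prim x : prim (fun y => `|u0 y|) x = prim u0 x.
Proof.
apply: ae_prim => //; first exact: in_L1_norm.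
by apply: (aeS u_pos) => y y0; rewrite ger0_norm.
Qed.

Let abs_mass : \int[mu]_x `|u0 x| = 1.
Proof. by rewrite ae_ge0_Rintegral_norm. Qed.

(** For x < 0 the integrand is the mass to the left of x, and otherwise the mass to
    its right. A unit of mass at y is thus counted over an interval of length |y|,
    as exchanging the order of integration makes precise. *)
Lemma heaviside_distance :
  (\int[mu]_x (`|prim u0 x - 2^-1 - heaviside x|)%:E = \int[mu]_y (`|u0 y| * `|y|)%:E)%E.
Proof.
have ni := in_L1_norm ui.
pose E : set (R * R) :=
  (snd @^-1` `]-oo, 0[%classic `&` (fun p : R * R => p.2 - p.1) @^-1` `[0, +oo[%classic)
  `|` (snd @^-1` `[0, +oo[%classic `&` (fun p : R * R => p.1 - p.2) @^-1` `]0, +oo[%classic).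
have m1 : measurable_fun [set: R * R] (fun p : R * R => p.2 - p.1).
  by apply: measurable_funB; [exact: measurable_snd|exact: measurable_fst].
have m2 : measurable_fun [set: R * R] (fun p : R * R => p.1 - p.2).
  by apply: measurable_funB; [exact: measurable_fst|exact: measurable_snd].
have m3 : measurable_fun [set: R * R] (snd : R * R -> R) by exact: measurable_snd.
have mE : measurable E.
  by apply: measurableU; apply: measurableI; rewrite -[X in measurable X]setTI;
    [exact: m3|exact: m1|exact: m3|exact: m2].
have EE y x : (\1_E (y, x) : R) = (if x < 0 then y <= x else x < y)%:R.
  rewrite indicE; congr (_%:R); congr nat_of_bool.
  apply/idP/idP.
    rewrite inE => -[] /= []; rewrite !in_itv /= !andbT ?subr_ge0 ?subr_gt0.
      by move=> ->.
    by rewrite leNgt => /negbTE ->.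
  case: ltP => x0 xy; rewrite inE; [left|right]; split => /=;
    by rewrite in_itv /= ?andbT ?subr_ge0 ?subr_gt0.
have := tonelli_set mE (in_L1_measurable ni) (measurable_cst (1 : R)) _ _.
move=> /(_ (fun y => normr_ge0 _) (fun _ => ler01)) T.
transitivity (\int[mu]_x \int[mu]_y (`|u0 y| * cst 1 x * \1_E (y, x))%:E)%E.
  apply: eq_integral => x _.
  pose D : set R := if x < 0 then `]-oo, x]%classic else `]x, +oo[%classic.
  have mD : measurable D by rewrite /D; case: ifP.
  have -> : (\int[mu]_y (`|u0 y| * cst 1 x * \1_E (y, x))%:E =
      \int[mu]_y (`|u0 y| * \1_D y)%:E)%E.
    apply: eq_integral => y _; rewrite mulr1 EE /D indicE; congr ((_ * _%:R)%:E).
    by case: ifP => _; congr nat_of_bool; apply/idP/idP; rewrite inE /= in_itv /= ?andbT.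
  rewrite -EFin_Rintegral; last exact: in_L1_indic_mul.
  congr EFin; rewrite (Rintegral_indic_mul _ mD) heavisideE /D.
  have /andP[p0 p1] := prim_le_mass x ui u_pos; rewrite mass in p1.
  case: ifP => _.
    by rewrite -/(prim (fun y => `|u0 y|) x) abs_prim ger0_norm; lra.
  by rewrite -(prim_compl x ni) abs_mass abs_prim ler0_norm; lra.
rewrite -T; apply: eq_integral => y _.
pose D : set R := if y < 0 then `[y, 0[%classic else `[0, y[%classic.
have mD : measurable D by rewrite /D; case: ifP.
have -> : (\int[mu]_x (`|u0 y| * cst 1 x * \1_E (y, x))%:E =
    \int[mu]_x (`|u0 y|%:E * (\1_D x)%:E))%E.
  apply: eq_integral => x _; rewrite mulr1 EE /D indicE -EFinM; congr ((_ * _%:R)%:E).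
  congr nat_of_bool; apply/idP/idP.
    case: ltP => x0 xy; rewrite inE.
      by rewrite (le_lt_trans xy x0) /= in_itv /= xy.
    by rewrite ltNge (le_trans x0 (ltW xy)) /= in_itv /= x0.
  rewrite inE; case: (ltP y 0) => y0 /=; rewrite in_itv /= => /andP[x1 x2].
    by rewrite x2.
  by rewrite ltNge x1.
have mI : measurable_fun setT (fun x => (\1_D x : R)%:E).
  by apply/measurable_EFinP; exact: measurable_indic.
rewrite (ge0_integralZl mu measurableT mI); last 2 first.
- by move=> x _; rewrite lee_fin indicE.
- by rewrite lee_fin.
rewrite (integral_indic mu measurableT mD) /= setIT EFinM; congr (_ * _)%E.
rewrite /D; case: ltP => y0; rewrite lebesgue_measure_itv /= lte_fin.
  by rewrite y0 -EFinD sub0r ltr0_norm.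
case: ltP => y1; first by rewrite -EFinD subr0 gtr0_norm.
by have -> : y = 0 by [lra]; rewrite normr0.
Qed.

Definition initial_constant := \int[mu]_x `|prim u0 x - 2^-1 - heaviside x| + A / 2.

Let dist_L1 : in_L1 (fun x => prim u0 x - 2^-1 - heaviside x).
Proof.
have mh : measurable_fun setT heaviside.
  by apply: measurable_funB; [exact: measurable_indic|exact: measurable_cst].
apply/integrableP; split.
  apply/measurable_EFinP; apply: measurable_funB => //.
  apply: continuous_measurable_fun; apply: contD; last exact: cont_cst.
  exact: prim_continuous.
rewrite heaviside_distance.
have -> : (\int[mu]_y (`|u0 y| * `|y|)%:E = \int[mu]_y (u0 y * `|y|)%:E)%E; last exact: moment.
have mn : measurable_fun setT (fun y : R => `|y|) by exact: normr_measurable.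
apply: ae_eq_integral => //.
- apply/measurable_EFinP; apply: measurable_funM => //.
  exact: in_L1_measurable (in_L1_norm ui).
- apply/measurable_EFinP; apply: measurable_funM => //.
  exact: in_L1_measurable ui.
- by apply: (aeS u_pos) => x x0 _; rewrite ger0_norm.
Qed.

(** Both the distribution function and the rarefaction wave at time 1 are at a finite
    L1 distance from the centred step. *)
Lemma initial_distance N :
  \int[mu]_(x in `[- N, N]) `|prim u0 x - 2^-1 - rarefaction A 1 x| <= initial_constant.
Proof.
pose ind : R -> R := \1_(`[- (A / 2), A / 2]%classic).
have iI : in_L1 (fun x => 2^-1 * ind x).
  by apply: in_L1Z; exact: integrable_indic_itv.
have di := in_L1_norm dist_L1.
have AA : - (A / 2) < A / 2 by rewrite gtrN ?divr_gt0.
have -> : initial_constant =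
    \int[mu]_x (`|prim u0 x - 2^-1 - heaviside x| + 2^-1 * ind x).
  rewrite RintegralD//; congr (_ + _); rewrite RintegralZl//; last exact: integrable_indic_itv.
  rewrite /Rintegral integral_indic//= setIT lebesgue_measure_itv /= lte_fin AA /=.
  by move: (A) => B; field.
have si := in_L1D di iI.
apply: le_trans (Rintegral_subset_le (measurable_itv `[- N, N]) si _); last first.
  by move=> x; rewrite addr_ge0// mulr_ge0// /ind indicE.
apply: le_Rintegral => //.
- apply: continuous_integrable_itv; apply: cont_norm; apply: contD.
    by apply: contD; [exact: prim_continuous|exact: cont_cst].
  by apply: contN; exact: rarefaction_continuous.
- exact: in_L1S.
- move=> x _; apply: le_trans (ler_distD (heaviside x) _ _) _.
  by rewrite lerD2l; exact: rarefaction_heaviside.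
Qed.

Lemma initial_constant_ge0 : 0 <= initial_constant.
Proof. by rewrite addr_ge0 ?divr_ge0 ?(ltW A0)//; exact: Rintegral_ge0. Qed.

End InitialData.

Theorem theorem2p4 (R : realType) (A : R) (V Vx u0 : R -> R)
    (A_gt0 : 0 < A)
    (V_W11 : in_W11 V Vx)
    (Vx_lt : (Lpnorm 1 Vx < A%:E)%E)
    (u0_L1 : in_L1 u0)
    (u0_ge0 : {ae @leb R, forall x, 0 <= u0 x})
    (u0_mass : (\int[@leb R]_x (u0 x)%:E = 1)%E)
    (u0_moment : (\int[@leb R]_x (u0 x * `|x|)%:E < +oo)%E)
    (eps0 : R) (eps0_gt0 : 0 < eps0) :
  exists C : R, 0 < C /\
    forall eps : R, 0 < eps <= eps0 ->
    forall u : R -> R -> R,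
      solution eps (interaction_kernel A V) u0 u ->
      (forall t, 0 < t -> {ae @leb R, forall x, 0 <= u t x}) ->
      forall (t : R) (p : \bar R), 0 < t -> (1 < p)%E ->
        (Lpnorm p (centered_primitive u t \- rarefaction A t)%R
         <= (C * t `^ (- 2^-1 * (1 - fine p^-1))
               * ln (2 + t) `^ (2^-1 * (1 + fine p^-1)))%:E)%E.
Proof.
have [V_L1 Vx_L1 _] := V_W11.
pose lam := \int[@leb R]_z `|Vx z|.
have lam0 : 0 <= lam by exact: Rintegral_ge0.
have lamA : lam < A by rewrite -lte_fin -Lpnorm1E.
have V10 : 0 <= \int[@leb R]_z `|V z| by exact: Rintegral_ge0.
have mass : \int[@leb R]_x u0 x = 1 by rewrite /Rintegral u0_mass.
have I0 := initial_constant_ge0 u0 A_gt0.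
have [C [C0 HC]] := flow_bound A_gt0 lam0 lamA lam0 V10 I0 eps0_gt0.
exists C; split => // eps epsE u [ux [ut [cu cux cut flux u0E]]] u_pos t p t0 p1.
have eps_gt0 : 0 < eps by case/andP: epsE.
have u00 : in_L1 (u 0) by have [] := cu 0; rewrite /= ?in_itv /= ?lexx.
have pos s : 0 <= s -> {ae @leb R, forall x, 0 <= u s x}.
  rewrite le_eqVlt => /predU1P[<-|]; last exact: u_pos.
  by apply: (aeS2 u0E u0_ge0) => x ->.
have mass0 : \int[@leb R]_x u 0 x = 1.
  rewrite -mass /Rintegral; congr fine; apply: ae_eq_integral => //.
  - exact: measurable_int u00.
  - exact: measurable_int u0_L1.
  - by apply: (aeS u0E) => x -> _.
have flow := solution_viscous_flow A_gt0 eps_gt0 V_W11 cu cux cut flux pos mass0.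
have drift := solution_drift_bounds A_gt0 V_W11 cu cux cut flux pos mass0.
apply: (HC _ _ _ _ _ epsE flow drift) => // N.
have -> : (fun x => `|centered_primitive u 0 x - rarefaction A 1 x|) =
    (fun x => `|prim u0 x - 2^-1 - rarefaction A 1 x|).
  apply/funext => x; rewrite /centered_primitive -/(prim (u 0) x).
  by rewrite (ae_prim x u00 u0_L1 u0E).
exact: initial_distance.
Qed.
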